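(* Let $N\ge3$, $2^*=\frac{2N}{N-2}$, $\mu\in\mathbb{R}$. If $2<p<q<2^*$, then the equation $$-\Delta u-\mu|u|^{p-2}u+|u|^{q-2}u=0,\qquad x\in\mathbb{R}^N,$$ has no weak solution $u\in\mathcal D\setminus0$ with any energy level $E\ge0$, i.e. with $E_\mu(u)=E$ for some $E\ge0$.
   Context: $\mathcal D=\mathcal D^{1,2}(\mathbb{R}^N)\cap L^q(\mathbb{R}^N)\cap L^p(\mathbb{R}^N)$, where $\mathcal D^{1,2}(\mathbb{R}^N)=\{u\in L^{2^*}(\mathbb{R}^N):\nabla u\in L^2(\mathbb{R}^N)\}$. The energy functional on $\mathcal D$ is $$E_\mu(u)=\int_{\mathbb{R}^N}\Big(\frac12|\nabla u|^2-\frac\mu p|u|^p+\frac1q|u|^q\Big)dx,$$ and weak solutions are its critical points in $\mathcal D$. *)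

(* Defs.v *)
From HB Require Import structures.
From mathcomp Require Import all_boot all_order all_algebra.
From mathcomp Require Import all_classical all_reals all_analysis.

Set Implicit Arguments.
Unset Strict Implicit.
Unset Printing Implicit Defensive.

Import Order.TTheory GRing.Theory Num.Theory.
Import numFieldNormedType.Exports.

Local Open Scope classical_set_scope.
Local Open Scope ring_scope.

(* The sigma-algebra generated by the coordinates, i.e. the Borel
   sigma-algebra of R^n. *)
Section measurable_rV.
Context {R : realType} (n : nat).

Let coord (i : 'I_n) (x : 'rV[R]_n) : R := x ord0 i.

Let rV_set0 : g_sigma_preimage coord set0.
Proof. exact: sigma_algebra0. Qed.

Let rV_setC A : g_sigma_preimage coord A -> g_sigma_preimage coord (~` A).
Proof. exact: sigma_algebraC. Qed.

Let rV_bigcup (F : _^nat) : (forall i, g_sigma_preimage coord (F i)) ->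
  g_sigma_preimage coord (\bigcup_i (F i)).
Proof. exact: sigma_algebra_bigcup. Qed.

HB.instance Definition _ :=
  @isMeasurable.Build default_measure_display 'rV[R]_n
    (g_sigma_preimage coord) rV_set0 rV_setC rV_bigcup.

Lemma measurable_coord_rV (i : 'I_n) :
  measurable_fun [set: 'rV[R]_n] (fun x : 'rV[R]_n => x ord0 i).
Proof.
move=> _ Y mY; rewrite setTI; apply: sub_sigma_algebra => /=.
rewrite -bigcup_seq/=; exists i => /=; first by rewrite mem_index_enum.
by exists Y => //; rewrite setTI.
Qed.

Lemma measurable_fun_rVP d (T : measurableType d) (f : T -> 'rV[R]_n) :
  (forall i, measurable_fun [set: T] (fun t => f t ord0 i)) ->
  measurable_fun [set: T] f.
Proof.
move=> mf; suff pS : g_sigma_preimage (fun i => coord i \o f) `<=` measurable.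
  move=> _ A mA; rewrite setTI; apply: pS; rewrite g_sigma_preimage_comp.
  by exists A => //; rewrite setTI.
apply: smallest_sub; first exact: sigma_algebra_measurable.
rewrite -bigcup_seq/=; apply: bigcup_sub => i _.
by move=> A [B mB <-]; exact: mf.
Qed.

End measurable_rV.

(* N-dimensional Lebesgue measure on R^n, as the n-fold product of the
   one-dimensional one. *)
Section lebesgue_rV.
Context {R : realType}.

Definition cons_rV n (p : measurableTypeR R * 'rV[R]_n) : 'rV[R]_n.+1 :=
  row_mx (p.1 : R)%:M p.2.

Lemma measurable_cons_rV n : measurable_fun setT (@cons_rV n).
Proof.
apply: measurable_fun_rVP => i; rewrite /cons_rV.
case: (split_ordP (i : 'I_(1 + n))) => j ->.
  apply: (eq_measurable_fun fst) => [p _|]; last exact: measurable_fst.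
  by rewrite [RHS]row_mxEl !ord1 mxE eqxx mulr1n.
apply: (eq_measurable_fun ((fun x : 'rV[R]_n => x ord0 j) \o snd)) => [p _|].
  by rewrite [RHS]row_mxEr.
by apply: measurableT_comp; [exact: measurable_coord_rV|exact: measurable_snd].
Qed.

Section step.
Variables (n : nat) (m : {sigma_finite_measure set 'rV[R]_n -> \bar R}).

Definition lebesgue_rV_step : set 'rV[R]_n.+1 -> \bar R :=
  pushforward (lebesgue_measure \x m)%E (@cons_rV n).

Let step0 : lebesgue_rV_step set0 = 0%E.
Proof. by rewrite /lebesgue_rV_step /pushforward preimage_set0 measure0. Qed.

Let step_ge0 A : (0 <= lebesgue_rV_step A)%E.
Proof. by rewrite /lebesgue_rV_step /pushforward; exact: measure_ge0. Qed.

Let step_sigma_additive : semi_sigma_additive lebesgue_rV_step.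
Proof.
have mc := @measurable_cons_rV n.
move=> F mF tF mUF; rewrite /lebesgue_rV_step /pushforward preimage_bigcup.
apply: measure_semi_sigma_additive.
- by move=> k; rewrite -[X in measurable X]setTI; exact: mc.
- apply/trivIsetP => /= i j _ _ ij; rewrite -preimage_setI.
  by move/trivIsetP : tF => /(_ _ _ _ _ ij) ->//; rewrite preimage_set0.
- by rewrite -preimage_bigcup -[X in measurable X]setTI; exact: mc.
Qed.

HB.instance Definition _ := isMeasure.Build _ _ _
  lebesgue_rV_step step0 step_ge0 step_sigma_additive.

Let uncons (x : 'rV[R]_n.+1) : measurableTypeR R * 'rV[R]_n :=
  (x ord0 ord0, \row_j x ord0 (lift ord0 j)).

Let consK : cancel (@cons_rV n) uncons.
Proof.
case=> a x; rewrite /uncons /cons_rV; congr pair => /=.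
  have -> : (ord0 : 'I_n.+1) = lshift n (ord0 : 'I_1) :> 'I_(1 + n).
    exact/val_inj.
  by rewrite [LHS]row_mxEl mxE eqxx mulr1n.
apply/rowP => j; rewrite mxE.
have -> : lift ord0 j = rshift 1 j :> 'I_(1 + n) by exact/val_inj.
by rewrite [LHS]row_mxEr.
Qed.

Let measurable_uncons : measurable_fun setT uncons.
Proof.
apply/measurable_fun_pair; first exact: measurable_coord_rV.
apply: measurable_fun_rVP => j.
apply: (eq_measurable_fun (fun x : 'rV[R]_n.+1 => x ord0 (lift ord0 j))).
  by move=> x _; rewrite mxE.
exact: measurable_coord_rV.
Qed.

Let step_sigma_finite : sigma_finite setT lebesgue_rV_step.
Proof.
have [F TF Foo] : sigma_finite setT (lebesgue_measure \x m)%E.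
  have /sigma_finiteP[F [TF ndF Foo]] :=
    sigma_finiteT (@lebesgue_measure R).
  have /sigma_finiteP[G [TG ndG Goo]] := sigma_finiteT m.
  exists (fun k => F k `*` G k).
    rewrite -setXTT TF TG predeqE => -[x y]; split.
      move=> [/= [k _ Fkx] [l _ Gly]]; exists (maxn k l) => //; split.
      - by move: x Fkx; exact/subsetPset/ndF/leq_maxl.
      - by move: y Gly; exact/subsetPset/ndG/leq_maxr.
    by move=> [k _ []/= ? ?]; split; exists k.
  move=> k; have [? ?] := Foo k; have [? ?] := Goo k.
  split; first exact: measurableX.
  by rewrite product_measure1E// lte_mul_pinfty// ge0_fin_numE.
exists (fun k => uncons @^-1` F k); first by rewrite -preimage_bigcup -TF.
move=> k; have [mF Fk] := Foo k; split.
  by rewrite -[X in measurable X]setTI; exact: measurable_uncons.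
rewrite /lebesgue_rV_step /pushforward -comp_preimage.
by rewrite (_ : uncons \o _ = id) ?preimage_id//; apply/funext => x /=.
Qed.

HB.instance Definition _ := Measure_isSigmaFinite.Build _ _ _
  lebesgue_rV_step step_sigma_finite.

End step.

Fixpoint lebesgue_rV n : {sigma_finite_measure set 'rV[R]_n -> \bar R} :=
  if n is k.+1 then lebesgue_rV_step (lebesgue_rV k)
  else \d_(0 : 'rV[R]_0).

End lebesgue_rV.

Section sobolev.
Context {R : realType} {N : nat}.
Local Notation E := 'rV[R]_N.
Local Notation leb := (@lebesgue_rV R N).
Implicit Types (u v phi : E -> R) (g : E -> E).

(* Elements of Lebesgue spaces are represented by Borel functions; nothing
   below depends on the choice of a representative. *)

(* The canonical norm `|x| of 'rV[R]_N is the sup norm. *)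
Definition enorm (x : E) : R := Num.sqrt (\sum_(i < N) x ord0 i ^+ 2).

Definition pderive (i : 'I_N) (f : E -> R) : E -> R :=
  fun x => 'D_(delta_mx ord0 i) f x.

Definition pderives (s : seq 'I_N) (f : E -> R) : E -> R := foldr pderive f s.

Definition smooth (f : E -> R) := forall s : seq 'I_N,
  continuous (pderives s f) /\
  forall (i : 'I_N) (x : E), derivable (pderives s f) x (delta_mx ord0 i).

Definition test_function phi :=
  smooth phi /\ compact (closure [set x | phi x != 0]).

Definition loc_integrable u := measurable_fun setT u /\
  forall K : set E, compact K -> leb.-integrable K (EFin \o u).

Definition is_weak_gradient u g :=
  [/\ loc_integrable u,
      forall i, loc_integrable (fun x => g x ord0 i) &
      forall phi i, test_function phi ->
        \int[leb]_x (u x * pderive i phi x)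
        = - \int[leb]_x (g x ord0 i * phi x)].

(* A weak gradient of u if there is one; weak gradients are unique almost
   everywhere. *)
Definition wgrad u : E -> E := get (is_weak_gradient u).

(* The Sobolev exponent 2^*. *)
Definition crit_exp : R := 2 * N%:R / (N%:R - 2).

Definition D12 u :=
  [/\ u \in Lfun leb crit_exp%:E,
      is_weak_gradient u (wgrad u) &
      forall i, (fun x => wgrad u x ord0 i) \in Lfun leb 2%:E].

Definition Dspace (p q : R) u :=
  [/\ D12 u, u \in Lfun leb q%:E & u \in Lfun leb p%:E].

Definition energy (mu p q : R) u : R :=
  \int[leb]_x (2^-1 * enorm (wgrad u x) ^+ 2
               - mu / p * `|u x| `^ p + q^-1 * `|u x| `^ q).

(* u is a critical point of the energy on Dspace p q; the energy is C^1 there,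
   so that its derivative at u is determined by the directional ones. *)
Definition weak_solution (mu p q : R) u :=
  Dspace p q u /\
  forall v, Dspace p q v ->
    is_derive (0 : R) (1 : R)
      (fun t : R => energy mu p q (fun x => u x + t * v x)) 0.

End sobolev.

Arguments crit_exp : clear implicits.

(* Main.v *)
(* Let A, B, C be the integrals of |grad u|^2, mu |u|^p, |u|^q. Testing with u
   itself gives the Nehari identity A - B + C = 0, and the Pohozaev identity reads
   A / 2^* - B / p + C / q = 0. Together A (1 / 2^* - 1 / p) = C (1 / p - 1 / q),
   where the left side is nonpositive and the right side nonnegative because
   p < q < 2^*; hence C = 0 and u = 0 almost everywhere, whatever the energy.

   The Pohozaev identity is obtained without regularity theory. Write
   u_r (x) = u (x / r), let chi be a cutoff function and test with
   v = chi (u_r - u), for r close to 1 on either side. As 2 < p < q, the potential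
   G(s) = |s|^q / q - mu |s|^p / p is convex up to a quadratic term K s^2, so that
   E(u + t v) >= E(u) - o(t) yields
     int chi (|grad u_r|^2 / 2 + G(u_r)) - int chi (|grad u|^2 / 2 + G(u))
       + int |u_r - u| |grad u| |grad chi| + K int chi (u_r - u)^2 >= 0.
   Since u_r - u is almost everywhere the integral of a radial derivative over an
   interval of length |r - 1|, the last term is O((r - 1)^2), and the third one is
   |r - 1| times a quantity that vanishes as chi tends to 1. Rescaling the first
   term, dividing by r - 1 with either sign and letting r tend to 1, then chi
   to 1, gives the identity. *)

(* The classical Pohozaev test function x . grad u is only locally square integrable, and without
   regularity it has no weak gradient. The finite difference u_r - u replaces it, because a dilate
   of u has an explicit weak gradient. The cutoff is forced: finite energy gives no decay of |x|
   |grad u|, while every bound on u_r - u costs a power of |x|. The same bounds give the square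
   integrability of (u_r - u) grad chi, so that neither Hoelder nor Sobolev inequalities enter.

   The order of the limits matters. With chi = beta (eps x) and eps fixed, the quadratic error has a
   constant that depends on eps, and it disappears as r tends to 1. The linear error has a constant
   uniform in eps, since |x| |grad chi| is invariant under dilation. Its density is dominated by min
   (1, eps |x|) times an integrable function, so dominated convergence removes it as eps tends to 0.

   Semiconvexity bounds E(u + t v) from above by a polynomial in t. Hence the derivative of the
   energy is never computed along v; it is only known to be zero. *)
Require Import Defs.
From mathcomp Require Import all_boot all_order all_algebra.
From mathcomp Require Import all_classical all_reals all_analysis.
From mathcomp Require Import measurable_realfun ring lra.
Import Order.TTheory GRing.Theory Num.Theory.
Import numFieldNormedType.Exports.
Set Implicit Arguments.
Unset Strict Implicit.
Unset Printing Implicit Defensive.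
Local Open Scope classical_set_scope.
Local Open Scope ring_scope.

(** * Borel sets and dilations of R^n *)

Section borel_rV.
Context {R : realType} {n : nat}.
Local Notation E := 'rV[R]_n.

Definition obox (a b : 'I_n -> R) : set E :=
  [set x | forall i, a i < x ord0 i < b i].

Lemma measurable_obox a b : measurable (obox a b).
Proof.
have -> : obox a b = \bigcap_(i in [set: 'I_n])
    ((fun x : E => x ord0 i) @^-1` `]a i, b i[%classic).
  apply/seteqP; split => x /=.
    by move=> h i _ /=; rewrite in_itv/=; exact: h.
  by move=> h i; have /= := h i I; rewrite in_itv.
apply: fin_bigcap_measurable => // i _.
by rewrite -[X in measurable X]setTI; exact: measurable_coord_rV.
Qed.

(** The sigma-algebra is generated by the coordinates, so an open set is exhibited as a countable
    union of boxes with rational centres and half-widths [k.+1%:R^-1]. *)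
Lemma open_measurable_rV (U : set E) : open U -> measurable U.
Proof.
move=> oU.
pose B (ck : 'rV[rat]_n * nat) : set E :=
  obox (fun i => ratr (ck.1 ord0 i) - ck.2.+1%:R^-1)
       (fun i => ratr (ck.1 ord0 i) + ck.2.+1%:R^-1).
pose F ck := if `[< B ck `<=` U >] then B ck else set0.
have -> : U = \bigcup_ck F ck.
  apply/seteqP; split => [x Ux|x [ck _]]; last first.
    by rewrite /F; case: asboolP => // h /h.
  have /nbhs_ballP[e /= e0 xeU] : nbhs x U by exact: open_nbhs_nbhs.
  (* Half of [e]: one half-width leads from [x] to the rational centre, another one covers the
     box. *)
  have [k] : exists k : nat, 0 + k.+1%:R^-1 < e / 2.
    by apply: ltr_add_invr; rewrite divr_gt0.
  rewrite add0r => ke.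
  have q i : {z : R | x ord0 i - k.+1%:R^-1 < z < x ord0 i + k.+1%:R^-1 &
      exists r : rat, ratr r = z}.
    apply/cid2.
    have [|r /[!in_itv] rx] := @rat_in_itvoo R (x ord0 i - k.+1%:R^-1) (x ord0 i + k.+1%:R^-1).
      by rewrite ltrD2l gtrN// invr_gt0.
    by exists (ratr r) => //; exists r.
  have {}q i : {r : rat | x ord0 i - k.+1%:R^-1 < (ratr r : R) < x ord0 i + k.+1%:R^-1}.
    by case: (q i) => z zx /cid[r rz]; exists r; rewrite rz.
  exists (\row_i sval (q i), k) => //.
  rewrite /F; case: asboolP => [_|].
    move=> i /=; rewrite mxE; case: (q i) => /= r.
    move: (ratr r : R) (k.+1%:R^-1) => z d /andP[? ?]; apply/andP; split; lra.
  case=> y /= By; apply: xeU; split => // i j; rewrite ord1 {i}.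
  have := By j; rewrite /= mxE; case: (q j) => /= r.
  move: ke (ratr r : R) => /=; move: (k.+1%:R^-1) => d dk z /andP[? ?] /andP[? ?].
  by rewrite /ball/= ltr_norml; apply/andP; split; lra.
apply: countable_bigcupT_measurable => // ck.
by rewrite /F; case: asboolP => // _; exact: measurable_obox.
Qed.

Lemma closed_measurable_rV (U : set E) : closed U -> measurable U.
Proof.
by move=> cU; rewrite -[U]setCK; apply: measurableC; apply: open_measurable_rV; exact: closed_openC.
Qed.

Lemma compact_measurable_rV (U : set E) : compact U -> measurable U.
Proof.
by move=> cU; apply: closed_measurable_rV; apply: compact_closed => //; exact: norm_hausdorff.
Qed.

Lemma continuous_measurable_rV (f : E -> R) :
  continuous f -> measurable_fun setT f.
Proof.
move=> /continuousP cf; apply: (measurability _ (measurable_realfun.RGenOpens.measurableE R)).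
move=> _ [_ [a [b ->] <-]]; rewrite setTI.
by apply: open_measurable_rV; apply: cf; exact: interval_open.
Qed.

End borel_rV.

(** By uniqueness of Lebesgue measure: [c] times its image under multiplication by [c] gives every
    half-open interval its length. *)
Lemma ge0_integral_scale_line {R : realType} (c : R) (f : measurableTypeR R -> \bar R) :
  0 < c -> measurable_fun [set: measurableTypeR R] f -> (forall x, (0 <= f x)%E) ->
  (\int[lebesgue_measure]_x f (c * x)%R = c^-1%:E * \int[lebesgue_measure]_x f x)%E.
Proof.
move=> c0 mf f0.
have mc : measurable_fun [set: measurableTypeR R] (fun x : measurableTypeR R => c * x : measurableTypeR R).
  exact: measurable_funM.
pose m0 : {measure set (measurableTypeR R) -> \bar R} := mscale (NngNum (ltW c0)) (pushforward (@lebesgue_measure R) (fun x : measurableTypeR R => c * x : measurableTypeR R)).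
pose m1 := m0 mc.
have E (A : set (measurableTypeR R)) : measurable A -> lebesgue_measure A = m1 A.
  apply: lebesgue_measure_unique => _ [[a b]/= _ <-].
  rewrite /m1 /m0 /mscale/= /pushforward/=.
  have -> : (fun x : R => c * x) @^-1` `]a, b] = `](a / c), (b / c)]%classic.
    by apply/seteqP; split => x/=; rewrite !in_itv/= ler_pdivlMr// ltr_pdivrMr// mulrC.
  rewrite !lebesgue_measure_itv/= !lte_fin ltr_pM2r ?invr_gt0//.
  case: ifP => _; last by rewrite mule0.
  rewrite -!EFinB -EFinM; congr _%:E.
  by rewrite -mulrBl mulrC divfK ?gt_eqF.
have -> : (\int[lebesgue_measure]_x f x = \int[m1]_x f x)%E.
  by apply: eq_measure_integral => A mA _; exact: E.
rewrite ge0_integral_mscale//= muleA -EFinM mulVf ?gt_eqF// mul1e.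
by rewrite ge0_integral_pushforward.
Qed.

Lemma measurable_scale_rV {R : realType} n d (T : measurableType d)
    (s : T -> R) (f : T -> 'rV[R]_n) :
  measurable_fun setT s -> measurable_fun setT f ->
  measurable_fun setT (fun t => s t *: f t).
Proof.
move=> ms mf; apply: measurable_fun_rVP => i.
apply: (eq_measurable_fun (fun t => s t * f t ord0 i)) => [t _|].
  by rewrite mxE.
apply: measurable_funM => //.
exact: (measurableT_comp (measurable_coord_rV i)).
Qed.

Lemma ge0_integral_rVS {R : realType} n (f : 'rV[R]_n.+1 -> \bar R) :
  measurable_fun setT f -> (forall x, (0 <= f x)%E) ->
  (\int[lebesgue_rV n.+1]_x f x =
   \int[@lebesgue_measure R]_a \int[lebesgue_rV n]_x f (cons_rV (a, x)))%E.
Proof.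
move=> mf f0.
pose m0 : {measure set 'rV[R]_n.+1 -> \bar R} :=
  pushforward (@lebesgue_measure R \x lebesgue_rV n)%E (@cons_rV R n).
pose m1 := m0 (@measurable_cons_rV R n).
transitivity (\int[m1]_x f x)%E; first exact: eq_measure_integral.
rewrite ge0_integral_pushforward//.
rewrite preimage_setT fubini_tonelli1//.
- exact: (measurableT_comp mf (measurable_cons_rV (n := n))).
- by move=> x; exact: f0.
- exact: measurable_cons_rV.
Qed.

Lemma cons_rVZ {R : realType} n (c a : R) (x : 'rV[R]_n) :
  cons_rV (c * a, c *: x) = c *: cons_rV (a, x).
Proof. by rewrite /cons_rV/= -scale_scalar_mx -(scale_row_mx c (m := 1) (n1 := 1)). Qed.

(** Tonelli scales one coordinate at a time, each contributing a factor [c^-1]. Nonnegativity spares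
    integrability conditions; signed functions follow in [Rintegral_scale]. *)
Lemma ge0_integral_scale_rV {R : realType} n (c : R) (f : 'rV[R]_n -> \bar R) :
  0 < c -> measurable_fun setT f -> (forall x, (0 <= f x)%E) ->
  (\int[lebesgue_rV n]_x f (c *: x)%R =
   (c^-1 ^+ n)%:E * \int[lebesgue_rV n]_x f x)%E.
Proof.
move=> c0; elim: n f => [|n IH] f mf f0.
  rewrite expr0 mul1e; apply: eq_integral => x _.
  by rewrite !thinmx0.
have mcf : measurable_fun setT (fun x : 'rV[R]_n.+1 => f (c *: x)).
  apply: (measurableT_comp mf); apply: measurable_scale_rV => //.
pose g (a : measurableTypeR R) : \bar R := (\int[lebesgue_rV n]_x f (cons_rV (a, x)))%E.
have mfc : measurable_fun [set: measurableTypeR R * 'rV[R]_n] (f \o @cons_rV R n).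
  exact: (measurableT_comp mf (measurable_cons_rV (n := n))).
have mg : measurable_fun [set: measurableTypeR R] g.
  by apply: (measurable_fun_fubini_tonelli_F (f \o @cons_rV R n)) => // x; exact: f0.
have g0 x : (0 <= g x)%E by apply: integral_ge0.
rewrite !ge0_integral_rVS//.
transitivity (\int[@lebesgue_measure R]_a ((c^-1 ^+ n)%:E * g (c * a)%R))%E.
  apply: eq_integral => a _.
  under eq_integral do rewrite -cons_rVZ.
  rewrite (IH (fun x => f (cons_rV (c * a, x))))//.
  exact: (measurableT_comp mfc (measurable_pair1 _)).
have mgc : measurable_fun [set: measurableTypeR R] (fun a : measurableTypeR R => g (c * a)).
  apply: (measurableT_comp mg); exact: measurable_funM.
rewrite (@ge0_integralZl _ _ R (@lebesgue_measure R) setT measurableT _ mgc); last 2 first.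
- by move=> a _; exact: g0.
- by rewrite lee_fin exprn_ge0// invr_ge0 ltW.
by rewrite ge0_integral_scale_line// muleA -EFinM -exprSr.
Qed.

(** Cubes stand in for arbitrary compact sets: every compact set lies in one, and dilations map
    cubes to cubes. *)
Definition cube {R : realType} {n} (M : R) : set 'rV[R]_n :=
  [set x | forall i, `|x ord0 i| <= M].

Lemma closed_cube {R : realType} {n} (M : R) : closed (@cube R n M).
Proof.
have -> : @cube R n M = \bigcap_(i in [set: 'I_n]) ((fun x : 'rV[R]_n => `|x ord0 i|) @^-1` [set r | r <= M]).
  by apply/seteqP; split => x /= h => [i _|i]; [exact: h|exact: (h i I)].
apply: closed_bigI => i _; apply: closed_comp; last exact: closed_le.
move=> x _; apply: continuous_comp; first exact: coord_continuous.
exact: norm_continuous.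
Qed.

Lemma measurable_cube {R : realType} {n} (M : R) : measurable (@cube R n M).
Proof. by apply: closed_measurable_rV; exact: closed_cube. Qed.

Lemma compact_cube {R : realType} {n} (M : R) : compact (@cube R n M).
Proof.
have -> : @cube R n M = [set v : 'rV[R]_n | forall i, `[-M, M]%classic (v ord0 i)].
  by apply/seteqP; split => x h i; have := h i; rewrite /= in_itv/= ler_norml.
by apply: (@rV_compact R n (fun=> `[-M, M]%classic)) => i; exact: segment_compact.
Qed.

(** * Smooth functions *)

Section flat.
Context {R : realType}.
Implicit Types (k : nat) (x : R).

(** The usual flat function is the case k = 0. The negative powers of x are included so that
    derivatives are combinations of members of the same family. *)
Definition flat k x : R := if 0 < x then x^-1 ^+ k * expR (- x^-1) else 0.

Lemma flat_ge0 k x : 0 <= flat k x.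
Proof.
by rewrite /flat; case: ifPn => // x0; rewrite mulr_ge0 ?expR_ge0// exprn_ge0// invr_ge0 ltW.
Qed.

(** A quadratic bound makes the difference quotient at 0 vanish. With y = 1/x it amounts to y^(k+2)
    / (k+2)! <= exp y, one term of the exponential series. *)
Lemma flat_le_sqr k x : flat k x <= (k.+2)`!%:R * x ^+ 2.
Proof.
rewrite /flat; case: ifPn => x0; last by rewrite mulr_ge0 ?ler0n ?sqr_ge0.
have y0 : 0 < x^-1 by rewrite invr_gt0.
rewrite expRN ler_pdivrMr ?expR_gt0//.
have h : (x^-1) ^+ k.+2 <= (k.+2)`!%:R * expR x^-1.
  rewrite mulrC -ler_pdivrMr ?ltr0n ?fact_gt0//.
  by apply: le_trans (expR_ge1Dxn k.+1 (ltW y0)); rewrite lerDr.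
have -> : x^-1 ^+ k = x^-1 ^+ k.+2 * x ^+ 2.
  by rewrite -addn2 exprD -mulrA -exprMn mulVf ?gt_eqF// expr1n mulr1.
by rewrite [leRHS]mulrAC ler_wpM2r// sqr_ge0.
Qed.

Lemma is_derive_flat k x :
  is_derive x 1 (flat k) (flat k.+2 x - k%:R * flat k.+1 x).
Proof.
have [x0|x0|<-] := ltgtP 0 x.
- apply: (@near_eq_is_derive _ _ _ (fun y : R => (y^-1) ^+ k * expR (- y^-1))).
    near=> y; rewrite /flat ifT//; near: y; exact: lt_nbhsr.
  have dV : is_derive x 1 (fun y : R => y^-1) (- x ^- 2).
    by rewrite -[X in is_derive _ _ _ X]mulr1; apply: is_deriveV; rewrite gt_eqF.
  have dN : is_derive x 1 (fun y : R => - y^-1) (x ^- 2).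
    by rewrite -[x ^- 2]opprK; apply: is_deriveN.
  have dE : is_derive x 1 (fun y : R => expR (- y^-1)) (expR (- x^-1) * x ^- 2).
    exact: (@is_derive1_comp _ expR).
  have dX : is_derive x 1 (fun y : R => y^-1 ^+ k) ((k%:R * x^-1 ^+ k.-1) * (- x ^- 2)).
    have := @is_deriveX _ _ _ k _ _ _ dV.
    by congr (is_derive _ _ _ _); apply/funext => y; rewrite fctE.
  apply: (is_derive_eq (@is_deriveM _ _ _ _ _ _ _ _ dX dE)).
  rewrite /flat x0 -!exprVn !scalerAl/= /GRing.scale/=.
  case: k {dX} => [|k]/=; rewrite ?mul0r ?mulr0; first by ring.
  by rewrite !exprS; ring.
- apply: (@near_eq_is_derive _ _ _ (cst 0)).
    near=> y; rewrite /flat ifF//; apply/negbTE; rewrite -leNgt ltW//.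
    near: y; exact: lt_nbhsl.
  apply: (is_derive_eq (is_derive_cst _ _ _)).
  by rewrite /flat !ifF ?mulr0 ?subr0//; apply/negbTE; rewrite -leNgt ltW.
- have e : forall k, flat k 0 = 0 by move=> j; rewrite /flat ltxx.
  rewrite !e mulr0 subr0.
  have hM : (fun h : R => (k.+2)`!%:R * `|h|) @ 0^' --> (0 : R).
    have hn : (fun h : R => `|h|) @ 0^' --> `|0 : R| by apply: cvg_norm; exact: cvg_within.
    by rewrite -[X in _ --> X](mulr0 ((k.+2)`!%:R)); rewrite normr0 in hn; exact: cvgMl_tmp.
  have c : (fun h : R => h^-1 *: (flat k (h *: 1 + 0) - flat k 0)) @ 0^' --> (0 : R).
    apply: (@squeeze_cvgr _ _ _ _ (fun h : R => - ((k.+2)`!%:R * `|h|)) (fun h : R => (k.+2)`!%:R * `|h|)).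
    + near=> h.
      rewrite e subr0 addr0 /GRing.scale/= mulr1 -ler_norml normrM normfV.
      have h0 : h != 0 by near: h; exact: nbhs_dnbhs_neq.
      rewrite ler_pdivrMl ?normr_gt0// ger0_norm ?flat_ge0//.
      rewrite mulrCA -expr2 real_normK ?num_real//; exact: flat_le_sqr.
    + by rewrite -[X in _ --> X]oppr0; apply: cvgN; exact: hM.
    + exact: hM.
  split; first by apply/cvg_ex; exists 0.
  exact/cvg_lim.
Unshelve. all: by end_near.
Qed.

End flat.

(** Moves a directional derivative to a function of one real variable, where the chain rule
    [is_derive1_comp] applies. *)
Lemma is_derive_lineP {R : numFieldType} {V W : normedModType R} (f : V -> W) x v d :
  is_derive x v f d <-> is_derive (0 : R) (1 : R) (fun h : R => f (h *: v + x)) d.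
Proof.
have e : (fun h : R => h^-1 *: ((f \o shift x) (h *: v) - f x)) =
  (fun h : R => h^-1 *: (((fun h : R => f (h *: v + x)) \o shift 0) (h *: 1) - f (0 *: v + x))).
  have h1 (h : R) : h *: (1 : R) = h by exact: mulr1.
  by apply/funext => h /=; rewrite h1 addr0 scale0r add0r.
split=> -[].
- by rewrite /derivable /derive e => ? ?; split.
- by rewrite /derivable /derive -e => ? ?; split.
Qed.

Lemma is_derive_affine {R : realType} (a b t : R) :
  is_derive t (1 : R) (fun h : R => a * h + b) a.
Proof.
apply: (is_derive_eq (is_deriveD (is_deriveZ a (is_derive_id t (1 : R))) (is_derive_cst b t (1 : R)))).
by rewrite addr0; exact: mulr1.
Qed.

Section smooth_class.
Context {R : realType} {N : nat}.
Local Notation E := 'rV[R]_N.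

(* A class of explicit smooth functions, stable under differentiation and rich
   enough to approximate the indicators of boxes. Its members have all
   directional derivatives, which is not apparent from [smooth]. *)
Inductive tame : (E -> R) -> Prop :=
| tame_cst c : tame (cst c)
| tame_coord i : tame (fun x => x ord0 i)
| tame_flat k c d i : tame (fun x => flat k (c * x ord0 i + d))
| tame_add f g : tame f -> tame g -> tame (fun x => f x + g x)
| tame_mul f g : tame f -> tame g -> tame (fun x => f x * g x).

Lemma tame_scale c f : tame f -> tame (fun x => f (c *: x)).
Proof.
elim=> [a|i|k a d i|g h _ IH1 _ IH2|g h _ IH1 _ IH2].
- exact: tame_cst.
- rewrite (_ : (fun x : E => _) = (fun x : E => cst c x * x ord0 i)).
    by apply: tame_mul; [exact: tame_cst|exact: tame_coord].
  by apply/funext => x; rewrite mxE.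
- rewrite (_ : (fun x : E => _) = (fun x : E => flat k ((a * c) * x ord0 i + d))).
    exact: tame_flat.
  by apply/funext => x; rewrite mxE mulrA.
- exact: (tame_add IH1 IH2).
- exact: (tame_mul IH1 IH2).
Qed.

Lemma tame_sum (I : Type) (r : seq I) (F : I -> E -> R) :
  (forall i, tame (F i)) -> tame (fun x => \sum_(i <- r) F i x).
Proof.
move=> tF; elim: r => [|i r IH].
  by rewrite (_ : (fun _ => _) = cst 0); [exact: tame_cst|apply/funext => x; rewrite big_nil].
rewrite (_ : (fun x : E => _) = (fun x : E => F i x + \sum_(i <- r) F i x)).
  exact: tame_add.
by apply/funext => x; rewrite big_cons.
Qed.

Lemma tame_prod (I : Type) (r : seq I) (F : I -> E -> R) :
  (forall i, tame (F i)) -> tame (fun x => \prod_(i <- r) F i x).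
Proof.
move=> tF; elim: r => [|i r IH].
  by rewrite (_ : (fun _ => _) = cst 1); [exact: tame_cst|apply/funext => x; rewrite big_nil].
rewrite (_ : (fun x : E => _) = (fun x : E => F i x * \prod_(i <- r) F i x)).
  exact: tame_mul.
by apply/funext => x; rewrite big_cons.
Qed.

Lemma is_derive_coord (x v : E) i : is_derive x v (fun x : E => x ord0 i) (v ord0 i).
Proof.
apply/is_derive_lineP.
rewrite (_ : (fun _ => _) = (fun h : R => v ord0 i * h + x ord0 i)); last first.
  by apply/funext => h; rewrite !mxE mulrC.
exact: is_derive_affine.
Qed.

(** A single induction yields tame partial derivatives and the linear formula in every direction.
    The family [df] is existential because it is recognised as [pderive] only afterwards, by taking
    coordinate directions. *)
Lemma tame_derive f : tame f -> exists2 df : 'I_N -> E -> R,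
  (forall i, tame (df i)) &
  (forall x v, is_derive x v f (\sum_i v ord0 i * df i x)).
Proof.
elim=> [c|i|k c d i|g h tg [dg tdg Dg] th [dh tdh Dh]|g h tg [dg tdg Dg] th [dh tdh Dh]].
- exists (fun _ => cst 0); first by move=> i; exact: tame_cst.
  by move=> x v; rewrite big1 => [|i _]; [exact: is_derive_cst|rewrite mulr0].
- exists (fun j => cst (i == j)%:R); first by move=> j; exact: tame_cst.
  move=> x v; rewrite (bigD1 i)//= eqxx mulr1 big1 ?addr0; first exact: is_derive_coord.
  by move=> j /negPf ij; rewrite eq_sym ij mulr0.
- pose D (x : E) : R := flat k.+2 (c * x ord0 i + d) + cst (- k%:R) x * flat k.+1 (c * x ord0 i + d).
  exists (fun j (x : E) => cst (c * (i == j)%:R) x * D x).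
    move=> j; apply: tame_mul; first exact: tame_cst.
    by apply: tame_add; [|apply: tame_mul; [exact: tame_cst|]]; exact: tame_flat.
  move=> x v; rewrite (bigD1 i)//= eqxx mulr1 big1 ?addr0; last first.
    by move=> j /negPf ij; rewrite eq_sym ij mulr0 mul0r mulr0.
  apply/is_derive_lineP.
  rewrite (_ : (fun _ => _) = flat k \o (fun h : R => (c * v ord0 i) * h + (c * x ord0 i + d))); last first.
    by apply/funext => h /=; rewrite !mxE; congr flat; ring.
  have dl := is_derive_affine (c * v ord0 i) (c * x ord0 i + d) 0.
  apply: (is_derive_eq (is_derive1_comp (is_derive_flat _ _) dl)).
  by rewrite mulr0 add0r /D /=; ring.
- exists (fun i x => dg i x + dh i x); first by move=> i; exact: tame_add.
  move=> x v; have := is_deriveD (Dg x v) (Dh x v).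
  by rewrite -big_split/=; under eq_bigr do rewrite -mulrDr.
- exists (fun i x => g x * dh i x + h x * dg i x).
    by move=> i; apply: tame_add; exact: tame_mul.
  move=> x v; apply: (is_derive_eq (is_deriveM (Dg x v) (Dh x v))).
  rewrite /GRing.scale/= !mulr_sumr -big_split/=; apply: eq_bigr => i _; ring.
Qed.

Lemma tame_continuous f : tame f -> continuous f.
Proof.
elim=> [c|i|k c d i|g h tg IH1 th IH2|g h tg IH1 th IH2] x.
- exact: cst_continuous.
- exact: (@coord_continuous R 1 N ord0 i x).
- have cf : {for c * x ord0 i + d, continuous (@flat R k)}.
    apply/differentiable_continuous/derivable1_diffP.
    by have [] := is_derive_flat k (c * x ord0 i + d).
  apply: (@continuous_comp _ _ _ (fun x : E => c * x ord0 i + d) (flat k)) => //.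
  apply: continuousD; last exact: cst_continuous.
  by apply: continuousM; [exact: cst_continuous|exact: coord_continuous].
- by apply: continuousD; [exact: IH1|exact: IH2].
- by apply: continuousM; [exact: IH1|exact: IH2].
Qed.

Lemma sum_delta_mx (i : 'I_N) (F : 'I_N -> R) :
  \sum_j (delta_mx ord0 i : E) ord0 j * F j = F i.
Proof.
rewrite (bigD1 i)//= mxE !eqxx mul1r big1 ?addr0// => j /negPf ij.
by rewrite mxE ij andbF mul0r.
Qed.

Lemma tame_pderive f i : tame f -> tame (pderive i f).
Proof.
move=> /tame_derive[df tdf D].
rewrite (_ : pderive i f = df i)//; apply/funext => x; rewrite /pderive.
by have [_ ->] := D x (delta_mx ord0 i); rewrite sum_delta_mx.
Qed.

Lemma tame_is_derive f x v : tame f ->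
  is_derive x v f (\sum_i v ord0 i * pderive i f x).
Proof.
move=> /tame_derive[df tdf D].
have e i : pderive i f x = df i x.
  by rewrite /pderive; have [_ ->] := D x (delta_mx ord0 i); rewrite sum_delta_mx.
by under eq_bigr do rewrite e.
Qed.

Lemma tame_derivable f x v : tame f -> derivable f x v.
Proof. by move=> /(tame_is_derive x v) []. Qed.

(** Smoothness speaks of all iterated partial derivatives; an invariant stable under [pderive]
    replaces an induction on the list of indices. *)
Lemma smooth_coind (P : (E -> R) -> Prop) f :
  (forall g, P g -> [/\ continuous g,
     forall i x, derivable g x (delta_mx ord0 i) & forall i, P (pderive i g)]) ->
  P f -> smooth f.
Proof.
move=> H Pf s; have : P (pderives s f).
  by elim: s => //= i s /H[].
by move=> /H[].
Qed.

Lemma smooth_pderive (f : E -> R) i : smooth f -> smooth (pderive i f).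
Proof. by move=> sf s; have := sf (rcons s i); rewrite /pderives foldr_rcons. Qed.

Lemma tame_smooth (f : E -> R) : tame f -> smooth f.
Proof.
apply: smooth_coind => g tg; split; first exact: tame_continuous.
- by move=> i x; exact: tame_derivable.
- by move=> i; exact: tame_pderive.
Qed.

Lemma smooth_continuous (f : E -> R) : smooth f -> continuous f.
Proof. by move=> /(_ [::])[]. Qed.

Lemma smooth_derivable (f : E -> R) i x : smooth f -> derivable f x (delta_mx ord0 i).
Proof. by move=> /(_ [::])[_]; exact. Qed.

Lemma pderiveM (f g : E -> R) i : smooth f -> smooth g ->
  pderive i (fun x => f x * g x) = (fun x => pderive i f x * g x + f x * pderive i g x).
Proof.
move=> sf sg; apply/funext => x; rewrite /pderive.
rewrite [LHS](@deriveM _ _ f g x (delta_mx ord0 i)); [|exact: smooth_derivable..].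
by rewrite /GRing.scale/= addrC mulrC.
Qed.

(** The invariant for [smooth_coind] in the proof that products are smooth: by Leibniz, products
    alone are not stable under differentiation, but the algebra generated by smooth functions is. *)
Inductive smooth_alg : (E -> R) -> Prop :=
| smooth_alg_base (f : E -> R) : smooth f -> smooth_alg f
| smooth_alg_add f g : smooth_alg f -> smooth_alg g -> smooth_alg (fun x => f x + g x)
| smooth_alg_mul f g : smooth_alg f -> smooth_alg g -> smooth_alg (fun x => f x * g x).

Lemma smoothM (f g : E -> R) : smooth f -> smooth g -> smooth (fun x => f x * g x).
Proof.
move=> sf sg; apply: (@smooth_coind smooth_alg); last first.
  by apply: smooth_alg_mul; exact: smooth_alg_base.
move=> {f g sf sg} h; elim=> [f sf|f g af [cf df pf] ag [cg dg pg]|f g af [cf df pf] ag [cg dg pg]].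
- split; [exact: smooth_continuous|by move=> i x; exact: smooth_derivable|].
  by move=> i; apply/smooth_alg_base/smooth_pderive.
- split; [by move=> x; apply: continuousD; [exact: cf|exact: cg]|by move=> i x; apply: derivableD|].
  move=> i; have -> : pderive i (fun x => f x + g x) = (fun x => pderive i f x + pderive i g x).
    by apply/funext => x; apply: deriveD.
  exact: smooth_alg_add.
- split; [by move=> x; apply: continuousM; [exact: cf|exact: cg]|by move=> i x; apply: derivableM|].
  move=> i; have -> : pderive i (fun x => f x * g x) = (fun x => f x * pderive i g x + g x * pderive i f x).
    by apply/funext => x; apply: deriveM.
  by apply: smooth_alg_add; exact: smooth_alg_mul.
Qed.

End smooth_class.

(** * Test functions, local integrability and smooth approximations of boxes *)

Section test.
Context {R : realType} {N : nat}.
Local Notation E := 'rV[R]_N.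
Local Notation leb := (@lebesgue_rV R N).
Implicit Types (u v f g : E -> R) (M C : R).

Lemma coord_le_norm (x : E) i : `|x ord0 i| <= `|x|.
Proof.
rewrite [leRHS]/Num.norm/= mx_normrE.
exact: (le_bigmax _ (fun ij : 'I_1 * 'I_N => `|x ij.1 ij.2|) (ord0, i)).
Qed.

Lemma cube_subset (M M' : R) : M <= M' -> @cube R N M `<=` cube M'.
Proof. by move=> MM' x Mx i; exact: le_trans (Mx i) MM'. Qed.

Lemma compact_sub_cube (K : set E) : compact K ->
  exists2 M : R, 0 < M & K `<=` cube M.
Proof.
move=> /compact_bounded[M [_ HM]]; exists (`|M| + 1).
  by rewrite ltr_wpDl.
move=> x Kx i; apply: le_trans (coord_le_norm x i) _.
by apply: HM Kx; rewrite (le_lt_trans (ler_norm M))// ltrDl.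
Qed.

(** An explicit cube replaces the closure of the support, so that its size can be followed through
    dilations and derivatives. *)
Definition supp_in (M : R) (f : E -> R) := forall x, ~ cube M x -> f x = 0.

Lemma supp_in_le (M M' : R) f : M <= M' -> supp_in M f -> supp_in M' f.
Proof. by move=> MM' sf x /(contra_not (cube_subset MM' (t := x))); exact: sf. Qed.

Lemma supp_inMl M f g : supp_in M g -> supp_in M (fun x => f x * g x).
Proof. by move=> sg x /sg ->; rewrite mulr0. Qed.

Lemma supp_inMr M f g : supp_in M f -> supp_in M (fun x => f x * g x).
Proof. by move=> sg x /sg ->; rewrite mul0r. Qed.

Lemma supp_in_pderive M f i : supp_in M f -> supp_in M (pderive i f).
Proof.
move=> sf x xM; rewrite /pderive (@near_eq_derive _ _ _ f (cst 0)).
  by rewrite derive_cst.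
have oC : open (~` @cube R N M) by apply: closed_openC; exact: closed_cube.
have nC : nbhs x (~` @cube R N M) by exact: open_nbhs_nbhs.
by apply: filterS nC => y /sf.
Qed.

Lemma test_functionP (phi : E -> R) : test_function phi <->
  smooth phi /\ exists2 M : R, 0 < M & supp_in M phi.
Proof.
split=> -[sphi].
  move=> /compact_sub_cube[M M0 HM]; split=> //; exists M => // x xM.
  by apply/eqP; apply: contra_notT xM => ?; apply/HM/subset_closure.
move=> [M M0 HM]; split=> //; apply: (subclosed_compact _ (@compact_cube R N M)).
  exact: closed_closure.
rewrite closureEbigcap; apply: bigcap_inf => /=; split; first exact: closed_cube.
by move=> x /=; apply: contra_neqP => /HM.
Qed.

Lemma supp_in_bounded M f : continuous f -> supp_in M f ->
  exists2 C : R, 0 < C & forall x, `|f x| <= C.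
Proof.
move=> cf sf.
have /compact_bounded[C [_ HC]] : compact (f @` (@cube R N M)).
  apply: continuous_compact; last exact: compact_cube.
  exact: continuous_subspaceT.
exists (`|C| + 1); first by rewrite ltr_wpDl.
move=> x; have [xM|xM] := pselect (cube M x).
  apply: HC; last by exists x.
  by rewrite (le_lt_trans (ler_norm C))// ltrDl.
by rewrite (sf _ xM) normr0 addr_ge0.
Qed.

Lemma loc_integrable_cube (u : E -> R) M : loc_integrable u ->
  leb.-integrable (cube M) (EFin \o u).
Proof. by move=> [_]; apply; exact: compact_cube. Qed.

Lemma loc_integrableP (u : E -> R) : loc_integrable u <->
  measurable_fun setT u /\ forall M, 0 < M -> leb.-integrable (cube M) (EFin \o u).
Proof.
split=> -[mu iu]; split=> //; first by move=> M _; apply: iu; exact: compact_cube.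
move=> K cK.
have [M M0 KM] := compact_sub_cube cK.
apply: (integrableS (@measurable_cube R N M) _ KM (iu M M0)).
exact: compact_measurable_rV.
Qed.

Lemma integrable_loc_supp u f (M C : R) : loc_integrable u -> measurable_fun setT f ->
  (forall x, `|f x| <= C) -> supp_in M f ->
  leb.-integrable setT (fun x => (u x * f x)%:E).
Proof.
move=> lu mf fC sf; have iu := loc_integrable_cube M lu.
have := integrableZl (@measurable_cube R N M) C iu.
rewrite integrable_mkcond; last exact: measurable_cube.
apply: le_integrable => //; first by apply/measurable_EFinP; apply: measurable_funM => //; case: lu.
move=> x _ /=; rewrite patchE; case: ifPn => [_|].
  rewrite -EFinM /= lee_fin !normrM mulrC ler_wpM2r//.
  by rewrite (le_trans (fC x))// ler_norm.
by rewrite notin_setE => xM; rewrite (sf _ xM) mulr0.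
Qed.

Lemma integrable_loc_test u f M : loc_integrable u -> continuous f ->
  supp_in M f -> leb.-integrable setT (fun x => (u x * f x)%:E).
Proof.
move=> lu cf sf; have [C _ HC] := supp_in_bounded cf sf.
by apply: (integrable_loc_supp lu _ HC sf); exact: continuous_measurable_rV.
Qed.

Lemma loc_integrableM u f : loc_integrable u -> continuous f ->
  loc_integrable (fun x => f x * u x).
Proof.
move=> /[dup] lu [mu _] cf; apply/loc_integrableP; split.
  by apply: measurable_funM => //; exact: continuous_measurable_rV.
move=> M M0; have iu := loc_integrable_cube M lu.
have /compact_bounded[C [_ HC]] : compact (f @` (@cube R N M)).
  apply: continuous_compact; last exact: compact_cube.
  exact: continuous_subspaceT.
have := integrableZl (@measurable_cube R N M) (`|C| + 1) iu.
apply: le_integrable; first exact: measurable_cube.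
  apply/measurable_EFinP; apply: measurable_funTS; apply: measurable_funM => //.
  exact: continuous_measurable_rV.
move=> x xM /=; rewrite lee_fin !normrM ler_wpM2r// [leRHS]ger0_norm ?addr_ge0//.
apply: HC; last by exists x.
by rewrite (le_lt_trans (ler_norm C))// ltrDl.
Qed.

Lemma loc_integrableD u v : loc_integrable u -> loc_integrable v ->
  loc_integrable (fun x => u x + v x).
Proof.
move=> /[dup] lu [mu _] /[dup] lv [mv _]; apply/loc_integrableP; split.
  exact: measurable_funD.
move=> M M0; have := integrableD (@measurable_cube R N M) (loc_integrable_cube M lu) (loc_integrable_cube M lv).
by apply: eq_integrable => //; exact: measurable_cube.
Qed.

Lemma loc_integrableZ c u : loc_integrable u -> loc_integrable (fun x => c * u x).
Proof. by move=> lu; apply: (@loc_integrableM u (cst c)) => // x; exact: cst_continuous. Qed.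

(** Inside the box each factor is exp (-1 / ((n+1) s)), where s is the distance to a face. The
    values lie in [0, 1] and tend to the indicator of the box as n grows. The case n = 0 later
    serves as the cutoff. *)
Definition bump (a b : 'I_N -> R) n (x : E) : R :=
  \prod_(i < N) (flat 0 (n.+1%:R * x ord0 i - n.+1%:R * a i) *
                 flat 0 ((- n.+1%:R) * x ord0 i + n.+1%:R * b i)).

Lemma tame_bump a b n : tame (bump a b n).
Proof. by apply: tame_prod => i; apply: tame_mul; exact: tame_flat. Qed.

Lemma flat0_le1 (x : R) : flat 0 x <= 1.
Proof.
rewrite /flat; case: ifPn => // x0.
by rewrite expr0 mul1r -expR0 ler_expR oppr_le0 invr_ge0 ltW.
Qed.

Lemma bump_ge0 a b n x : 0 <= bump a b n x.
Proof. by apply: prodr_ge0 => i _; rewrite mulr_ge0// flat_ge0. Qed.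

Lemma bump_le1 a b n x : bump a b n x <= 1.
Proof.
rewrite -[leRHS](@big1_eq R 1 *%R _ (index_enum 'I_N) predT); apply: ler_prod => i _.
by rewrite mulr_ge0 ?flat_ge0//= mulr_ile1 ?flat_ge0 ?flat0_le1.
Qed.

Lemma bump_obox a b n x : bump a b n x != 0 -> obox a b x.
Proof.
move=> /prodf_neq0 + i => /(_ i isT); rewrite mulf_eq0 negb_or => /andP[].
rewrite /flat; case: ifPn => [h1 _|]; last by rewrite eqxx.
case: ifPn => [h2 _|]; last by rewrite eqxx.
have n0 : 0 < n.+1%:R :> R by rewrite ltr0n.
move: h1 h2; rewrite subr_gt0 ltr_pM2l// => -> /=.
by rewrite mulNr addrC subr_gt0 ltr_pM2l.
Qed.

Lemma obox_cube a b (x : E) : obox a b x -> cube (\sum_i (`|a i| + `|b i|)) x.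
Proof.
move=> abx i; rewrite (bigD1 i)//=; apply: (@le_trans _ _ (`|a i| + `|b i|)); last first.
  by rewrite lerDl; apply: sumr_ge0 => j _; rewrite addr_ge0.
have /andP[ax xb] := abx i; have a0 := ler_norm (- a i); rewrite normrN in a0.
have := ler_norm (b i); have := normr_ge0 (a i); have := normr_ge0 (b i).
by move: a0 ax xb => *; rewrite ler_norml; apply/andP; split; lra.
Qed.

Lemma supp_bump a b n : supp_in (\sum_i (`|a i| + `|b i|)) (bump a b n).
Proof.
by move=> x; apply: contra_notP => /eqP/bump_obox/obox_cube.
Qed.

Lemma test_tame f M : tame f -> supp_in M f -> test_function f.
Proof.
move=> tf sf; apply/test_functionP; split; first exact: tame_smooth.
exists (`|M| + 1); first by rewrite ltr_wpDl.
by apply: supp_in_le sf; rewrite (le_trans (ler_norm M))// lerDl.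
Qed.

Lemma cvg_flat0 (r : R) : 0 < r -> (fun n : nat => flat 0 (n.+1%:R * r)) @ \oo --> (1 : R).
Proof.
move=> r0; rewrite (_ : (fun _ => _) = (fun n : nat => expR (- (r^-1 * n.+1%:R^-1)))); last first.
  by apply/funext => n; rewrite /flat mulr_gt0// expr0 mul1r invfM mulrC.
rewrite -[X in _ --> X]expR0; apply: (@continuous_cvg _ _ _ _ _ _ expR); first exact: continuous_expR.
rewrite -[X in _ --> X]oppr0; apply: cvgN; rewrite -[X in _ --> X](mulr0 r^-1).
by apply: cvgMl_tmp; exact: (@cvg_harmonic R).
Qed.

Lemma cvg_bump a b x : (fun n => bump a b n x) @ \oo --> (\1_(obox a b) x : R).
Proof.
rewrite indicE; have [xab|xab] := boolP (x \in obox a b); last first.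
  rewrite (_ : (fun _ => _) = cst 0); first exact: cvg_cst.
  apply/funext => n; apply/eqP; apply: contraNT xab => /bump_obox.
  by rewrite inE.
rewrite -[X in _ --> X](@big1_eq R 1 *%R _ (index_enum 'I_N) predT).
apply: cvg_big; first exact: mul_continuous.
move=> i _; rewrite -[X in _ --> X](mulr1 1); move: xab; rewrite inE => /(_ i)/andP[ax xb].
apply: cvgM.
  have := @cvg_flat0 (x ord0 i - a i); rewrite subr_gt0 => /(_ ax).
  by under eq_fun do rewrite mulrBr.
have := @cvg_flat0 (b i - x ord0 i); rewrite subr_gt0 => /(_ xb).
by under eq_fun do rewrite mulrBr addrC -mulNr.
Qed.

End test.

(** * The fundamental lemma of the calculus of variations *)

Section fundamental_lemma.
Context {R : realType} {N : nat}.
Local Notation E := 'rV[R]_N.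
Local Notation leb := (@lebesgue_rV R N).
Implicit Types (u v f g h : E -> R) (M C : R).

Lemma sub_obox_cube (a b : 'I_N -> R) : obox a b `<=` cube (\sum_i (`|a i| + `|b i|)).
Proof. by move=> x; exact: obox_cube. Qed.

(** The bumps are bounded by 1 and live in one fixed cube, on which |h| is integrable; dominated
    convergence then passes from bumps to the indicator. *)
Lemma integral_obox_eq0 h (a b : 'I_N -> R) : loc_integrable h ->
  (forall phi, tame phi -> test_function phi -> \int[leb]_x (h x * phi x) = 0) ->
  (\int[leb]_(x in obox a b) (h x)%:E = 0)%E.
Proof.
move=> lh H; set M := \sum_i (`|a i| + `|b i|).
rewrite integral_mkcond.
pose f_ n (x : E) := (h x * bump a b n x)%:E.
have ih : leb.-integrable setT ((fun x => `|(h x)%:E|)%E \_ (cube M)).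
  rewrite -integrable_mkcond; last exact: measurable_cube.
  by apply: integrable_abse; exact: loc_integrable_cube.
have mh : measurable_fun setT h by case: lh.
have [|||||_ _ cv] := @dominated_convergence _ _ R leb setT measurableT f_
    ((fun x => (h x)%:E) \_ (obox a b)) ((fun x => `|(h x)%:E|)%E \_ (cube M)).
- move=> n; apply/measurable_EFinP; apply: measurable_funM => //.
  by apply: continuous_measurable_rV; apply: tame_continuous; exact: tame_bump.
- apply/(measurable_restrictT _ _).1; first exact: measurable_obox.
  by apply: measurable_funTS; exact/measurable_EFinP.
- apply: aeW => x _; rewrite patchE.
  rewrite (_ : (if _ then _ else _) = (h x * \1_(obox a b) x)%:E); last first.
    by rewrite indicE; case: ifPn => _; rewrite ?mulr1 ?mulr0.
  apply: cvg_EFin; first by apply: nearW.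
  have c : (fun n => h x * bump a b n x) @ \oo --> (h x * \1_(obox a b) x : R).
    by apply: cvgMl_tmp; exact: cvg_bump.
  exact: c.
- exact: ih.
- apply: aeW => x n _; rewrite /f_ patchE; case: ifPn => [_|].
    rewrite lee_fin normrM ler_piMr// ger0_norm ?bump_ge0//; exact: bump_le1.
  by rewrite notin_setE => xM; rewrite (supp_bump n xM) mulr0 abse0.
suff e n : (\int[leb]_x f_ n x = 0)%E.
  by move/cvg_lim : cv => <- //; under eq_fun do rewrite e; exact: lim_cst.
have tb := tame_bump a b n.
have tt : test_function (bump a b n) by apply: test_tame tb (@supp_bump _ _ a b n).
have := H _ tb tt; rewrite /Rintegral => e0.
have : (\int[leb]_x f_ n x)%E \is a fin_num.
  apply: integrable_fin_num => //.
  apply: integrable_loc_test lh _ (@supp_bump _ _ a b n).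
  exact: tame_continuous.
by move/fineK => <-; rewrite e0.
Qed.

Definition oboxes : set (set E) := [set A | exists a b, A = obox a b].

Lemma measurable_oboxE : @measurable _ E = <<s oboxes >>.
Proof.
apply/seteqP; split; last first.
  apply: smallest_sub; first exact: sigma_algebra_measurable.
  by move=> _ [a [b ->]]; exact: measurable_obox.
pose T := g_sigma_algebraType oboxes.
have mi : measurable_fun [set: T] (id : T -> E).
  apply: measurable_fun_rVP => i.
  apply: (measurability _ (measurable_realfun.RGenOpens.measurableE R)).
  move=> _ [_ [c [d ->]] <-]; rewrite setTI.
  (* An infinite strip in the coordinate [i] is the union of the boxes whose other sides are ]-k,
     k[. *)
  rewrite (_ : _ @^-1` _ = \bigcup_k obox (fun j : 'I_N => if j == i then c else - k%:R)
     (fun j : 'I_N => if j == i then d else k%:R)).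
    apply: bigcupT_measurable => k; apply: sub_sigma_algebra.
    by eexists; eexists.
  apply/seteqP; split => [x /=|x [k _] /(_ i)/=]; last by rewrite eqxx in_itv.
  rewrite in_itv/= => cxd; have [k kx] : exists k : nat, `|x| < k%:R.
    by exists (Num.bound `|x|); rewrite archi_boundP.
  exists k => // j; case: eqP => [->//|_]; rewrite -ltr_norml.
  exact: le_lt_trans (coord_le_norm _ _) kx.
by move=> A mA; have := mi measurableT A mA; rewrite setTI.
Qed.

Lemma setI_obox (a b c d : 'I_N -> R) : obox a b `&` obox c d =
  obox (fun i => Num.max (a i) (c i)) (fun i => Num.min (b i) (d i)).
Proof.
apply/seteqP; split => x /=.
  move=> [h1 h2] i; rewrite gt_max lt_min.
  by have /andP[p1 p2] := h1 i; have /andP[p3 p4] := h2 i; rewrite p1 p2 p3 p4.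
move=> h; split => i; have := h i; rewrite gt_max lt_min => /andP[/andP[p1 p2] /andP[p3 p4]].
  by rewrite p1.
by rewrite p2.
Qed.

(** Boxes form a generating family stable under intersection, so Dynkin's theorem extends the
    vanishing of the integral from boxes to all measurable sets. Only tame functions are tested,
    since they include the bumps. *)
Lemma fundamental_lemma h : loc_integrable h ->
  (forall phi, tame phi -> test_function phi -> \int[leb]_x (h x * phi x) = 0) ->
  {ae leb, forall x, h x = 0}.
Proof.
move=> lh H; have mh : measurable_fun setT h by case: lh.
(* Since [h] is only locally integrable, the argument runs in bounded sets. Choosing boxes keeps the
   intersections with boxes of the same kind. *)
pose D (k : nat) : set E := obox (fun _ => - k%:R) (fun _ => k%:R).
have mD k : measurable (D k) by exact: measurable_obox.
have iD k : leb.-integrable (D k) (EFin \o h).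
  apply: (integrableS (@measurable_cube R N _) (mD k) (@sub_obox_cube _ _)).
  exact: loc_integrable_cube.
have ID k S : measurable S -> (\int[leb]_(x in S `&` D k) (h x)%:E = 0)%E.
  move=> mS; have := mS; rewrite measurable_oboxE.
  pose P : set_system E := [set A | (\int[leb]_(x in A `&` D k) (h x)%:E = 0)%E].
  apply: (@dynkin_induction _ _ oboxes P).
  - exact: measurable_oboxE.
  - move=> _ _ [a [b ->]] [c [d ->]]; rewrite setI_obox; by eexists; eexists.
  - by rewrite /P/= setTI; exact: integral_obox_eq0.
  - by move=> _ [a [b ->]]; rewrite /P/= /D setI_obox; exact: integral_obox_eq0.
  - move=> A mA; rewrite /P/= => IA.
    have : (\int[leb]_(x in D k) (h x)%:E = 0)%E by exact: integral_obox_eq0.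
    have eD : D k = (A `&` D k) `|` (~` A `&` D k) by rewrite -setIUl setUCr setTI.
    rewrite {1}eD integral_setU.
    + by rewrite IA add0e.
    + exact: measurableI.
    + by apply: measurableI => //; exact: measurableC.
    + by apply: measurable_funTS; exact/measurable_EFinP.
    + by apply/disj_setPS => x [[Ax _] []].
  - move=> F mF tF IF; rewrite /P/= setI_bigcupl integral_bigcup.
    + by rewrite eseries0// => i _ _; exact: IF.
    + by apply/trivIsetP => i j _ _ ij; rewrite setIACA setIid; move/trivIsetP : tF => ->//; rewrite set0I.
    + by move=> n; exact: measurableI.
    + apply: (integrableS (mD k) _ _ (iD k)).
        by apply: bigcup_measurable => n _; exact: measurableI.
      by apply: bigcup_sub => n _; exact: subIsetr.
have ae k : ae_eq leb (D k) (EFin \o h) (cst 0%E).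
  apply: integral_ae_eq => // S SD mS.
  by rewrite integral0 -(setIidl SD); exact: ID.
have ae2 k : {ae leb, forall x, D k x -> h x = 0}.
  by apply: filterS (ae k) => x /[apply] -[].
have := ae_foralln ae2; apply: filterS => x hx.
have [k kx] : exists k : nat, `|x| < k%:R.
  by exists (Num.bound `|x|); rewrite archi_boundP.
apply: (hx k) => j; rewrite -ltr_norml; exact: le_lt_trans (coord_le_norm _ _) kx.
Qed.
End fundamental_lemma.

(** * Calculus of weak gradients *)

Section scaling.
Context {R : realType} {N : nat}.
Local Notation E := 'rV[R]_N.
Local Notation leb := (@lebesgue_rV R N).
Implicit Types (u v f : E -> R) (c : R) (g h : E -> E).

Lemma measurable_fun_scale d (T : measurableType d) (f : E -> T) c : measurable_fun setT f ->
  measurable_fun setT (fun x : E => f (c *: x)).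
Proof. by move=> mf; apply: (measurableT_comp mf); exact: measurable_scale_rV. Qed.

Lemma integrable_scale (f : E -> \bar R) c : 0 < c -> leb.-integrable setT f ->
  leb.-integrable setT (fun x => f (c *: x)).
Proof.
move=> c0 /integrableP[mf foo]; apply/integrableP; split.
  exact: measurable_fun_scale.
rewrite (ge0_integral_scale_rV (f := fun x => `|f x|%E))//; last exact: measurableT_comp.
by rewrite lte_mul_pinfty// lee_fin exprn_ge0// invr_ge0 ltW.
Qed.

Lemma Rintegral_scale f c : 0 < c -> leb.-integrable setT (EFin \o f) ->
  \int[leb]_x f (c *: x) = (c^-1) ^+ N * \int[leb]_x f x.
Proof.
move=> c0 /[dup] fi /integrableP[mf foo]; rewrite /Rintegral.
have c0' : 0 <= (c^-1) ^+ N by rewrite exprn_ge0// invr_ge0 ltW.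
rewrite -[X in _ = X * _]/(fine ((c^-1) ^+ N)%:E) -fineM//; last exact: integrable_fin_num.
congr fine; rewrite integralE [in RHS]integralE.
have p := @ge0_integral_scale_rV R N c ((EFin \o f)^\+)%E c0 (measurable_funepos mf) (funepos_ge0 _).
have n := @ge0_integral_scale_rV R N c ((EFin \o f)^\-)%E c0 (measurable_funeneg mf) (funeneg_ge0 _).
transitivity (((c^-1) ^+ N)%:E * (\int[leb]_x (EFin \o f)^\+ x) -
    ((c^-1) ^+ N)%:E * (\int[leb]_x (EFin \o f)^\- x))%E.
  congr (_ - _)%E; first by rewrite -p; apply: eq_integral => x _; rewrite !funeposE.
  by rewrite -n; apply: eq_integral => x _; rewrite !funenegE.
apply/esym/muleBr; first by [].
apply: fin_num_adde_defl; rewrite fin_numN.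
exact: (integrable_neg_fin_num measurableT fi).
Qed.

Lemma cube_scale M c x : 0 < c -> cube M (c *: x) <-> @cube R N (M / c) x.
Proof.
by move=> c0; split => h i; have := h i; rewrite mxE normrM gtr0_norm// ler_pdivlMr// mulrC.
Qed.

Lemma loc_integrable_scale u c : 0 < c -> loc_integrable u ->
  loc_integrable (fun x => u (c *: x)).
Proof.
move=> c0 /[dup] lu [mu _]; apply/loc_integrableP; split.
  exact: measurable_fun_scale.
move=> M M0; have := loc_integrable_cube (M * c) lu.
move=> /(integrable_mkcond _ (@measurable_cube R N (M * c))) ic.
apply/(integrable_mkcond _ (@measurable_cube R N M)); move: ic.
move=> /(integrable_scale c0); apply: eq_integrable => // x _.
rewrite !patchE; congr (if _ then _ else _).
have := cube_scale (M * c) x c0; rewrite mulfK ?gt_eqF// => e.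
by apply/idP/idP; rewrite !inE => /e.
Qed.

End scaling.

Section weak_gradient.
Context {R : realType} {N : nat}.
Local Notation E := 'rV[R]_N.
Local Notation leb := (@lebesgue_rV R N).
Implicit Types (u v f phi : E -> R) (c : R) (g h : E -> E).

Lemma test_integrable u phi : loc_integrable u -> test_function phi ->
  leb.-integrable setT (EFin \o (fun x => u x * phi x)).
Proof.
move=> lu /test_functionP[sphi [M _ sM]].
exact: (integrable_loc_test lu (smooth_continuous sphi) sM).
Qed.

Lemma test_pderive phi i : test_function phi -> test_function (pderive i phi).
Proof.
move=> /test_functionP[sphi [M M0 sM]]; apply/test_functionP; split.
  exact: smooth_pderive.
by exists M => //; exact: supp_in_pderive.
Qed.

Lemma test_smoothM f phi : smooth f -> test_function phi ->
  test_function (fun x => f x * phi x).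
Proof.
move=> sf /test_functionP[sphi [M M0 sM]]; apply/test_functionP; split.
  exact: smoothM.
by exists M => //; exact: supp_inMl.
Qed.

Lemma weak_gradient_unique u g h : is_weak_gradient u g -> is_weak_gradient u h ->
  {ae leb, forall x, g x = h x}.
Proof.
move=> [lu lg Hg] [_ lh Hh].
have key i : {ae leb, forall x, g x ord0 i + (-1) * h x ord0 i = 0}.
  apply: fundamental_lemma.
    by apply: loc_integrableD; [exact: lg|apply: loc_integrableZ; exact: lh].
  move=> phi _ tphi.
  rewrite [LHS](_ : _ = \int[leb]_x (g x ord0 i * phi x - h x ord0 i * phi x)); last first.
    by apply: eq_Rintegral => x _; ring.
  rewrite RintegralB//; [|exact: (test_integrable (lg i))|exact: (test_integrable (lh i))].
  by apply/eqP; rewrite subr_eq0 -eqr_opp -Hg// -Hh.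
have : {ae leb, forall x, forall i, g x ord0 i + (-1) * h x ord0 i = 0}.
  exact: filter_forall.
apply: filterS => x gh; apply/rowP => i.
by apply/eqP; rewrite -subr_eq0 -mulN1r gh.
Qed.

Lemma weak_gradientD u v g h c : is_weak_gradient u g -> is_weak_gradient v h ->
  is_weak_gradient (fun x => u x + c * v x) (fun x => g x + c *: h x).
Proof.
move=> [lu lg Hg] [lv lh Hh]; split.
- by apply: loc_integrableD => //; exact: loc_integrableZ.
- move=> i; rewrite (_ : (fun _ => _) = (fun x => g x ord0 i + c * h x ord0 i)).
    by apply: loc_integrableD; [exact: lg|apply: loc_integrableZ; exact: lh].
  by apply/funext => x; rewrite !mxE.
- move=> phi i tphi; have tp := test_pderive i tphi.
  rewrite [LHS](_ : _ = \int[leb]_x (u x * pderive i phi x + c * (v x * pderive i phi x))); last first.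
    by apply: eq_Rintegral => x _; ring.
  rewrite [in RHS](_ : \int[leb]_x _ = \int[leb]_x (g x ord0 i * phi x + c * (h x ord0 i * phi x))); last first.
    by apply: eq_Rintegral => x _; rewrite !mxE; ring.
  have i1 := test_integrable lu tp; have i2 := test_integrable lv tp.
  have i3 := test_integrable (lg i) tphi; have i4 := test_integrable (lh i) tphi.
  rewrite !RintegralD//; [|exact: (integrableZl measurableT c i4)|exact: (integrableZl measurableT c i2)].
  by rewrite !RintegralZl// Hg// Hh//; ring.
Qed.

Definition grad f (x : E) : E := \row_i pderive i f x.

(** The weak gradient of [u] is tested with [f * phi]; the Leibniz term containing the derivative of
    [f] then moves to the gradient side. *)
Lemma weak_gradientM u g f : is_weak_gradient u g -> smooth f ->
  is_weak_gradient (fun x => f x * u x) (fun x => f x *: g x + u x *: grad f x).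
Proof.
move=> [lu lg Hg] sf; have cf := smooth_continuous sf.
have cdf i := smooth_continuous (smooth_pderive i sf).
split.
- exact: loc_integrableM.
- move=> i; rewrite (_ : (fun _ => _) = (fun x => f x * g x ord0 i + pderive i f x * u x)).
    by apply: loc_integrableD; apply: loc_integrableM => //; exact: lg.
  by apply/funext => x; rewrite !mxE mulrC [u x * _]mulrC; congr (_ + _); rewrite mulrC.
- move=> phi i tphi; have [sphi _] := tphi.
  have tfphi := test_smoothM sf tphi.
  have t1 := test_smoothM sf (test_pderive i tphi).
  have t2 := test_smoothM (smooth_pderive i sf) tphi.
  have e := Hg _ i tfphi.
  rewrite pderiveM// in e.
  rewrite [LHS](_ : _ = \int[leb]_x (u x * (f x * pderive i phi x))); last first.
    by apply: eq_Rintegral => x _; ring.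
  rewrite [in RHS](_ : \int[leb]_x _ = \int[leb]_x (g x ord0 i * (f x * phi x) + u x * (pderive i f x * phi x))); last first.
    by apply: eq_Rintegral => x _; rewrite !mxE; ring.
  rewrite RintegralD//; [|exact: (test_integrable (lg i))|exact: (test_integrable lu)].
  rewrite opprD -e; apply/eqP; rewrite -subr_eq opprK; apply/eqP.
  rewrite -RintegralD//; [|exact: (test_integrable lu)..].
  by apply: eq_Rintegral => x _; ring.
Qed.

Lemma is_derive_scale f c (x v : E) d : is_derive (c *: x) v f d ->
  is_derive x v (fun y => f (c *: y)) (d * c).
Proof.
move=> /is_derive_lineP Df; apply/is_derive_lineP.
rewrite (_ : (fun _ => _) = (fun h : R => f (h *: v + c *: x)) \o (fun h : R => c * h + 0)).
  apply: is_derive1_comp; last exact: is_derive_affine.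
  by rewrite mulr0 addr0.
by apply/funext => h /=; rewrite addr0 scalerDr scalerA.
Qed.

Lemma smooth_is_derive f i x : smooth f -> is_derive x (delta_mx ord0 i) f (pderive i f x).
Proof. by move=> sf; split => //; exact: smooth_derivable. Qed.

Lemma pderive_scale f c i : smooth f ->
  pderive i (fun y => f (c *: y)) = (fun x => c * pderive i f (c *: x)).
Proof.
move=> sf; apply/funext => x; rewrite mulrC.
by have [_] := is_derive_scale (smooth_is_derive i (c *: x) sf).
Qed.

Lemma scale_continuous c : continuous (fun x : E => c *: x).
Proof. exact: scaler_continuous. Qed.

Lemma smooth_scale f c : smooth f -> smooth (fun x => f (c *: x)).
Proof.
(* The constant [k] collects the factors [c] produced by successive derivatives. *)
move=> sf; pose P (h : E -> R) := exists (k : R) (F : E -> R), smooth F /\ h = (fun x => k * F (c *: x)).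
apply: (@smooth_coind _ _ P); last first.
  by exists 1, f; split=> //; apply/funext => x; rewrite mul1r.
move=> _ [k [F [sF ->]]].
have D i x : is_derive x (delta_mx ord0 i) (fun x => k * F (c *: x)) (k * (pderive i F (c *: x) * c)).
  exact: (is_deriveZ k (is_derive_scale (smooth_is_derive i (c *: x) sF))).
split.
- move=> x; apply: continuousM; first exact: cst_continuous.
  by apply: continuous_comp; [exact: scale_continuous|exact: smooth_continuous].
- by move=> i x; have [] := D i x.
- move=> i; exists (k * c), (pderive i F); split; first exact: smooth_pderive.
  by apply/funext => x; rewrite /pderive; have [_ ->] := D i x; rewrite /pderive; ring.
Qed.

Lemma supp_in_scale M f c : 0 < c -> supp_in M f -> supp_in (M / c) (fun x => f (c *: x)).
Proof. by move=> c0 sf x xM; apply: sf => /(cube_scale M x c0). Qed.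

Lemma test_scale f c : 0 < c -> test_function f -> test_function (fun x => f (c *: x)).
Proof.
move=> c0 /test_functionP[sf [M M0 sM]]; apply/test_functionP; split.
  exact: smooth_scale.
by exists (M / c); [rewrite divr_gt0|exact: supp_in_scale].
Qed.

Lemma weak_gradient_scale u g c : 0 < c -> is_weak_gradient u g ->
  is_weak_gradient (fun x => u (c *: x)) (fun x => c *: g (c *: x)).
Proof.
move=> c0 [lu lg Hg]; split.
- exact: loc_integrable_scale.
- move=> i; rewrite (_ : (fun _ => _) = (fun x => c * g (c *: x) ord0 i)).
    by apply: loc_integrableZ; apply: (loc_integrable_scale c0 (lg i)).
  by apply/funext => x; rewrite !mxE.
- move=> phi i tphi; have [sphi _] := tphi.
  (* Undoing the dilation on the test function brings back the identity for [u] itself. *)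
  have tp : test_function (fun x => phi (c^-1 *: x)) by apply: test_scale; rewrite ?invr_gt0.
  have e := Hg _ i tp; rewrite pderive_scale// in e.
  have cK (x : E) : c^-1 *: (c *: x) = x by rewrite scalerA mulVf ?scale1r// gt_eqF.
  have := Rintegral_scale c0 (test_integrable lu (test_pderive i tp)).
  rewrite pderive_scale// e => e1.
  have := Rintegral_scale c0 (test_integrable (lg i) tp) => e2.
  have i1 := test_integrable (loc_integrable_scale c0 (lg i)) tphi.
  transitivity (c * \int[leb]_x (u (c *: x) * (c^-1 * pderive i phi (c^-1 *: (c *: x))))).
    rewrite -RintegralZl//; last first.
      have := integrable_scale c0 (test_integrable lu (test_pderive i tp)).
      by rewrite pderive_scale.
    apply: eq_Rintegral => x _; rewrite cK mulrCA mulVKf//. 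
    by rewrite gt_eqF.
  rewrite e1 !mulrN -e2 -RintegralZl//; last exact: (integrable_scale c0 (test_integrable (lg i) tp)).
  by congr (- _); apply: eq_Rintegral => x _; rewrite cK mxE mulrA.
Qed.

End weak_gradient.

(** * Difference of two dilates of a function *)

(** The inverse is continuous away from 0, where it takes the default value 0; the line is split
    accordingly. *)
Lemma measurable_funV {R : realType} d (T : measurableType d) (f : T -> R) :
  measurable_fun setT f -> measurable_fun setT (fun x => (f x)^-1).
Proof.
move=> mf; apply: (measurableT_comp (f := fun x : R => x^-1)) => //.
have -> : [set: R] = [set x | x != 0] `|` [set 0].
  by apply/seteqP; split => x //= _; have [->|] := eqVneq x 0; [right|left].
have o : open [set x : R | x != 0] by exact: open_neq.
apply/measurable_funU => //; first exact: open_measurable.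
split; last exact: measurable_fun_set1.
apply: open_continuous_measurable_fun => // x; rewrite inE/= => x0.
exact: inv_continuous.
Qed.

(** * Integration over a slab of radii *)

Section slab.
Context {R : realType} {N : nat}.
Local Notation E := 'rV[R]_N.
Local Notation leb := (@lebesgue_rV R N).
Local Notation mu := (@lebesgue_measure R).
Local Notation L := (measurableTypeR R).
Variables (c d : R) (c0 : 0 < c) (cd : c < d).
Local Notation I := (`[c, d]%classic : set L).

Lemma itv_pos r : I r -> 0 < r.
Proof. by rewrite /= in_itv/= => /andP[/(lt_le_trans c0)]. Qed.

Lemma integral_indic_itv : (\int[mu]_r (\1_I r)%:E = (d - c)%:E)%E.
Proof.
rewrite integral_indic ?setIT; [|by []|exact: measurable_itv].
have := @lebesgue_measure_itv R `[c, d]; rewrite /= lte_fin cd -EFinB; exact.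
Qed.

Lemma measurable_partial_integral (f : L * E -> \bar R) : measurable_fun setT f ->
  measurable_fun setT (fun x => \int[mu]_r f (r, x))%E.
Proof.
move=> mf.
have -> : (fun x => \int[mu]_r f (r, x))%E =
  (fun x => \int[mu]_r f^\+ (r, x) - \int[mu]_r f^\- (r, x))%E.
  apply/funext => x; rewrite [LHS]integralE; congr (_ - _)%E; apply: eq_integral => r _.
    by rewrite !funeposE.
  by rewrite !funenegE.
apply: emeasurable_funB.
  apply: (measurable_fun_fubini_tonelli_G (f^\+)%E) => //.
  exact: measurable_funepos.
apply: (measurable_fun_fubini_tonelli_G (f^\-)%E) => //.
exact: measurable_funeneg.
Qed.

Lemma measurable_indic_fst (A : set L) : measurable A ->
  measurable_fun [set: L * E] (fun z => \1_A z.1 : R).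
Proof. by move=> mA; apply: (measurableT_comp (measurable_indic mA)); exact: measurable_fst. Qed.

(** The hypothesis of Fubini's theorem in the form in which it will be checked: a bound on the inner
    integral, uniform over the bounded range of radii. *)
Lemma integrable_slab (F : L * E -> R) (K : R) : measurable_fun setT F ->
  (forall r, I r -> (\int[leb]_x `|(F (r, x))%:E| <= K%:E)%E) ->
  (mu \x leb)%E.-integrable setT (fun z => (\1_I z.1 * F z)%:E).
Proof.
move=> mF FK.
have mI : measurable I by exact: measurable_itv.
have mG : measurable_fun [set: L * E] (fun z => (\1_I z.1 * F z)%:E).
  by apply/measurable_EFinP; apply: measurable_funM => //; exact: measurable_indic_fst.
apply/(integrable12ltyP _ _ mG).
apply: (@le_lt_trans _ _ (\int[mu]_r ((\1_I r)%:E * `|K|%:E)))%E.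
  apply: ge0_le_integral => //.
  - by move=> r _; exact: integral_ge0.
  - apply: (measurable_fun_fubini_tonelli_F (abse \o (fun z : L * E => (\1_I z.1 * F z)%:E))) => //.
      exact: measurableT_comp.
    by move=> z; exact: abse_ge0.
  - by apply: emeasurable_funM => //; exact/measurable_EFinP/measurable_indic.
  - move=> r _; rewrite indicE; have [rI|rI] := boolP (r \in I).
      rewrite mul1e; rewrite inE in rI; apply: (@le_trans _ _ K%:E); last by rewrite lee_fin ler_norm.
      by under eq_integral do rewrite mul1r; exact: FK.
    by rewrite mul0e integral0_eq// => x _; rewrite mul0r abse0.
rewrite ge0_integralZr//; last exact/measurable_EFinP/measurable_indic.
by rewrite integral_indic_itv -EFinM ltry.
Qed.

(** After exchanging the integrals, the substitution x = r y costs the Jacobian r^N <= d^N and moves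
    the dilation onto the weight. The factor [d - c] gained here supplies a power of r - 1 in the
    final estimates. *)
Lemma tonelli_scale (q rho rho' : E -> R) :
  measurable_fun setT q -> measurable_fun setT rho -> measurable_fun setT rho' ->
  (forall x, 0 <= q x) -> (forall x, 0 <= rho x) ->
  (forall r x, I r -> rho (r *: x) <= rho' x) ->
  (\int[leb]_x ((rho x)%:E * \int[mu]_(r in I) (q (r^-1 *: x))%:E) <=
   ((d - c) * d ^+ N)%:E * \int[leb]_x (rho' x * q x)%:E)%E.
Proof.
move=> mq mr mr' q0 r0 rr'.
have mI : measurable I by exact: measurable_itv.
have rho'0 x : 0 <= rho' x by apply: le_trans (rr' c x _); rewrite ?r0//= in_itv/= lexx ltW.
pose F (z : L * E) : \bar R := ((rho z.2 * q (z.1^-1 *: z.2)) * \1_I z.1)%:E.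
have mqz : measurable_fun [set: L * E] (fun z => q (z.1^-1 *: z.2)).
  apply: (measurableT_comp mq); apply: measurable_scale_rV; last exact: measurable_snd.
  by apply: measurable_funV; exact: measurable_fst.
have mF : measurable_fun setT F.
  apply/measurable_EFinP; apply: measurable_funM; last exact: measurable_indic_fst.
  apply: measurable_funM => //; apply: (measurableT_comp mr); exact: measurable_snd.
have F0 z : (0 <= F z)%E by rewrite lee_fin !mulr_ge0.
rewrite [leLHS](_ : _ = \int[leb]_x \int[mu]_r F (r, x))%E; last first.
  apply: eq_integral => x _.
  rewrite -ge0_integralZl//; first last.
  - by rewrite lee_fin.
  - by move=> r _; rewrite lee_fin.
  - by apply/measurable_EFinP; apply: measurable_funTS; exact: (measurableT_comp mqz (measurable_pair2 _)).
  rewrite integral_mkcond; apply: eq_integral => r _.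
  by rewrite patchE /F /= indicE; case: ifPn => _; rewrite ?mulr1 ?mulr0.
rewrite -fubini_tonelli//.
apply: (@le_trans _ _ (\int[mu]_r ((\1_I r)%:E * ((d ^+ N)%:E * \int[leb]_x (rho' x * q x)%:E))))%E.
  apply: ge0_le_integral => //.
  - by move=> r _; exact: integral_ge0.
  - exact: (measurable_fun_fubini_tonelli_F F).
  - by apply: emeasurable_funM => //; exact/measurable_EFinP/measurable_indic.
  - move=> r _; rewrite /F /= indicE; have [rI|rI] := boolP (r \in I); last first.
      by rewrite mul0e integral0_eq// => x _; rewrite mulr0.
    rewrite mul1e; rewrite inE in rI; have r_0 := itv_pos rI.
    have mrq : measurable_fun setT (fun x : E => (rho (r *: x) * q x)%:E).
      by apply/measurable_EFinP; apply: measurable_funM => //; exact: measurable_fun_scale.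
    have e := @ge0_integral_scale_rV R N r^-1 (fun y : E => (rho (r *: y) * q y)%:E).
    rewrite invr_gt0 in e; have {}e := e r_0 mrq.
    have p (y : E) : (0 <= (rho (r *: y) * q y)%:E)%E by rewrite lee_fin mulr_ge0.
    rewrite (_ : (\int[leb]_x _)%E = \int[leb]_x (rho (r *: (r^-1 *: x)) * q (r^-1 *: x))%:E)%E; last first.
      by apply: eq_integral => x _; rewrite mulr1 scalerA mulfV ?gt_eqF// scale1r.
    rewrite [leLHS](e p) invrK; apply: lee_pmul => //.
    + by rewrite lee_fin exprn_ge0// ltW.
    + by apply: integral_ge0 => x _; rewrite lee_fin mulr_ge0.
    + rewrite lee_fin; apply: lerXn2r; rewrite ?nnegrE.
      * exact: ltW.
      * exact: ltW (lt_trans c0 cd).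
      * by move: rI; rewrite /= in_itv/= => /andP[].
    + apply: ge0_le_integral => //.
      * by apply/measurable_EFinP; exact: measurable_funM.
      * by move=> x _; rewrite lee_fin ler_wpM2r// rr'.
rewrite ge0_integralZr//; first last.
- by apply: mule_ge0; [rewrite lee_fin exprn_ge0// ltW// (lt_trans c0)|apply: integral_ge0 => x _; rewrite lee_fin mulr_ge0].
- exact/measurable_EFinP/measurable_indic.
by rewrite integral_indic_itv muleA -EFinM.
Qed.

End slab.

Section loc_integrable_sum.
Context {R : realType} {N : nat}.
Local Notation E := 'rV[R]_N.

Lemma loc_integrable_cst0 : loc_integrable (fun _ : E => 0 : R).
Proof. by split=> [|K cK]; [exact: measurable_cst|exact: integrable0]. Qed.

Lemma loc_integrable_sum (J : Type) (s : seq J) (F : J -> E -> R) :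
  (forall j, loc_integrable (F j)) -> loc_integrable (fun x => \sum_(j <- s) F j x).
Proof.
move=> lF; elim: s => [|j s IH].
  by under eq_fun do rewrite big_nil; exact: loc_integrable_cst0.
by under eq_fun do rewrite big_cons; exact: loc_integrableD.
Qed.

Lemma loc_integrable_norm (f : E -> R) : loc_integrable f ->
  loc_integrable (fun x => `|f x|).
Proof.
move=> [mf lf]; split; first exact: measurableT_comp.
by move=> K cK; apply: (integrable_abse (lf K cK)).
Qed.

End loc_integrable_sum.

(** * The radial integral of a weak gradient *)

Section radial.
Context {R : realType} {N : nat}.
Local Notation E := 'rV[R]_N.
Local Notation leb := (@lebesgue_rV R N).
Local Notation mu := (@lebesgue_measure R).
Local Notation L := (measurableTypeR R).
Variables (c d : R) (c0 : 0 < c) (cd : c < d).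
Local Notation I := (`[c, d]%classic : set L).
Variables (u : E -> R) (g : E -> E) (ug : is_weak_gradient u g).

Lemma integrable_partial_integral (f : L * E -> \bar R) :
  (mu \x leb)%E.-integrable setT f ->
  leb.-integrable setT (fun x => \int[mu]_r f (r, x))%E.
Proof.
move=> /[dup] intf /measurable_int mf.
have maf : measurable_fun setT (abse \o f) by exact: measurableT_comp.
apply/integrableP; split; first exact: measurable_partial_integral.
apply: le_lt_trans ((integrable21ltyP _ _ mf).1 intf).
apply: ge0_le_integral.
- by [].
- by move=> x _; exact: abse_ge0.
- by apply: measurableT_comp => //; exact: measurable_partial_integral.
- exact: (measurable_partial_integral maf).
- move=> x _; apply: le_abse_integral => //.
  exact: (measurableT_comp mf (measurable_pair2 x)).
Qed.

(** Formally minus the derivative in r of u (x / r). *)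
Definition radial_grad (r : R) (x : E) : R :=
  r ^- 2 * \sum_i x ord0 i * g (r^-1 *: x) ord0 i.

Lemma measurable_weak_gradient i : measurable_fun setT (fun x => g x ord0 i).
Proof. by have [_ lg _] := ug; have [] := lg i. Qed.

Lemma measurable_radial_grad : measurable_fun [set: L * E] (fun z => radial_grad z.1 z.2).
Proof.
have m1 : measurable_fun [set: L * E] (fun z => (z.1 : R)^-1).
  by apply: measurable_funV; exact: measurable_fst.
apply: measurable_funM.
  by apply: measurable_funV; apply: measurable_funX; exact: measurable_fst.
apply: (eq_measurable_fun (fun z : L * E => \sum_(i < N) (z.2 ord0 i * g (z.1^-1 *: z.2) ord0 i))) => //.
apply: measurable_sum => i; apply: measurable_funM.
  by apply: (measurableT_comp (measurable_coord_rV i)); exact: measurable_snd.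
apply: (measurableT_comp (measurable_weak_gradient i)).
by apply: measurable_scale_rV => //; exact: measurable_snd.
Qed.

(** Truncation in x, because the radial derivative is only locally integrable. *)
Definition slab_fun (M : R) (z : L * E) : R :=
  \1_(cube M) z.2 * radial_grad z.1 z.2.

Lemma measurable_slab_fun M : measurable_fun setT (slab_fun M).
Proof.
apply: measurable_funM; last exact: measurable_radial_grad.
apply: (measurableT_comp (measurable_indic (@measurable_cube R N M))).
exact: measurable_snd.
Qed.

Lemma integrable_slab_fun M : 0 < M ->
  (mu \x leb)%E.-integrable setT (fun z => (\1_I z.1 * slab_fun M z)%:E).
Proof.
move=> M0; have [_ lg _] := ug.
(* For r >= c and x in the cube of size M, [h (r^-1 *: x)] bounds the radial derivative and x / r
   lies in the cube of size M / c. *)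
pose h (y : E) : R := c ^- 2 * M * \sum_i `|g y ord0 i|.
have lh : loc_integrable h.
  apply: loc_integrableZ; apply: loc_integrable_sum => i.
  exact: (loc_integrable_norm (lg i)).
have h0 y : 0 <= h y.
  apply: mulr_ge0; last by apply: sumr_ge0.
  by rewrite mulr_ge0 ?invr_ge0 ?exprn_ge0 ?ltW.
pose k (y : E) : R := h y * \1_(cube (M / c)) y.
have k0 y : 0 <= k y by rewrite mulr_ge0.
have ik : leb.-integrable setT (EFin \o k).
  apply: (@integrable_loc_supp R N h \1_(cube (M / c)) (M / c) 1) => //.
  - by apply: measurable_indic; exact: measurable_cube.
  - by move=> x; rewrite indicE; case: (_ \in _); rewrite ?normr1 ?normr0.
  - by move=> x; rewrite indicE; case: (boolP (x \in _)) => //; rewrite inE => /[swap]/[apply].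
have mk : measurable_fun setT k by apply/measurable_EFinP; exact: measurable_int ik.
apply: (@integrable_slab R N c d cd _ (fine ((d ^+ N)%:E * \int[leb]_y (k y)%:E)%E)).
  exact: measurable_slab_fun.
move=> r rI; have r0 := itv_pos c0 rI.
have [cr rd] : c <= r /\ r <= d by move: rI; rewrite /= in_itv/= => /andP.
rewrite fineK; last by rewrite fin_numM//; exact: integrable_fin_num.
apply: (@le_trans _ _ (\int[leb]_x (k (r^-1 *: x))%:E)%E).
  apply: ge0_le_integral => //.
  - apply: measurableT_comp => //; apply/measurable_EFinP.
    exact: (measurableT_comp (measurable_slab_fun M) (measurable_pair1 (r : L))).
  - by apply/measurable_EFinP; exact: measurable_fun_scale.
  - move=> x _; rewrite lee_fin /slab_fun/= indicE.
    have [|xM] := boolP (x \in _); last by rewrite mul0r normr0.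
    rewrite inE => xM; rewrite mul1r /k indicE mem_set ?mulr1; last first.
      move=> i; rewrite mxE normrM [leLHS]mulrC [`|r^-1|]ger0_norm ?invr_ge0 ?(ltW r0)//.
      by apply: ler_pM => //; rewrite ?invr_ge0 ?(ltW r0)// lef_pV2.
    rewrite /radial_grad /h normrM -mulrA; apply: ler_pM => //.
      by rewrite ger0_norm ?invr_ge0 ?exprn_ge0 ?(ltW r0)// lef_pV2 ?posrE ?exprn_gt0// lerXn2r// nnegrE ltW.
    apply: le_trans (ler_norm_sum _ _ _) _; rewrite mulr_sumr; apply: ler_sum => i _.
    by rewrite normrM ler_wpM2r.
have ms : measurable_fun setT (EFin \o k) by exact/measurable_EFinP.
have e := @ge0_integral_scale_rV R N r^-1 (EFin \o k).
rewrite invr_gt0 in e; rewrite [leLHS](e r0 ms (fun x => _)) ?lee_fin//.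
rewrite invrK; apply: lee_wpmul2r; first by apply: integral_ge0 => x _; rewrite lee_fin.
by rewrite lee_fin lerXn2r// nnegrE ltW// (lt_trans c0).
Qed.

Definition radial_int (x : E) : R := \int[mu]_(r in I) radial_grad r x.

Lemma radial_intE x : radial_int x = fine (\int[mu]_r (\1_I r * radial_grad r x)%:E)%E.
Proof.
rewrite /radial_int /Rintegral integral_mkcond; congr fine.
apply: eq_integral => r _; rewrite patchE indicE.
by case: ifPn => _; rewrite ?mul1r ?mul0r.
Qed.

Lemma measurable_radial_int : measurable_fun setT radial_int.
Proof.
rewrite (_ : radial_int = fine \o (fun x => \int[mu]_r (\1_I r * radial_grad r x)%:E)%E); last first.
  by apply/funext => x; exact: radial_intE.
apply: (measurableT_comp (fine_measurable measurableT)).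
apply: (measurable_partial_integral (f := fun z : L * E => (\1_I z.1 * radial_grad z.1 z.2)%:E)).
apply/measurable_EFinP; apply: measurable_funM; last exact: measurable_radial_grad.
by apply: measurable_indic_fst; exact: measurable_itv.
Qed.

Lemma slab_fun_cube M x : cube M x ->
  radial_int x = fine (\int[mu]_r (\1_I r * slab_fun M (r, x))%:E)%E.
Proof.
move=> xM; rewrite radial_intE; congr fine; apply: eq_integral => r _.
have e : \1_(cube M) x = 1 :> R by rewrite indicE mem_set.
by rewrite /slab_fun/= e mul1r.
Qed.

Lemma loc_integrable_radial_int : loc_integrable radial_int.
Proof.
apply/loc_integrableP; split; first exact: measurable_radial_int.
move=> M M0; have iF := integrable_slab_fun M0.
have iG := integrable_partial_integral iF.
have := integrableS measurableT (@measurable_cube R N M) (@subsetT _ _) iG.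
apply: le_integrable; first exact: measurable_cube.
  by apply/measurable_EFinP; apply: measurable_funTS; exact: measurable_radial_int.
move=> x xM /=; rewrite (slab_fun_cube xM) /=.
(* Where the inner integral is infinite, [fine] returns 0 and the bound is trivial. *)
by case: (\int[mu]_r _)%E => //=; rewrite normr0 leey.
Qed.

End radial.

Lemma Rintegral_sum d (T : measurableType d) {R : realType}
    (mu : {measure set T -> \bar R}) (J : Type) (s : seq J) (F : J -> T -> R) :
  (forall j, mu.-integrable setT (EFin \o F j)) ->
  mu.-integrable setT (EFin \o (fun x => \sum_(j <- s) F j x)) /\
  \int[mu]_x (\sum_(j <- s) F j x) = \sum_(j <- s) \int[mu]_x F j x.
Proof.
move=> iF; elim: s => [|j s [IH1 IH2]].
  rewrite big_nil (_ : (fun x => _) = cst 0); last by apply/funext => x; rewrite big_nil.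
  split; first exact: integrable0.
  by rewrite /Rintegral integral0.
rewrite big_cons (_ : (fun x => _) = (fun x => F j x + \sum_(j <- s) F j x)); last first.
  by apply/funext => x; rewrite big_cons.
by split; [exact: (integrableD measurableT (iF j) IH1)|rewrite RintegralD// IH2].
Qed.

Section radial_test.
Context {R : realType} {N : nat}.
Local Notation E := 'rV[R]_N.
Local Notation leb := (@lebesgue_rV R N).
Local Notation mu := (@lebesgue_measure R).
Local Notation L := (measurableTypeR R).
Variables (phi : E -> R) (M : R) (tphi : tame phi) (M0 : 0 < M) (sphi : supp_in M phi).

(** The divergence of the vector field z phi(z). *)
Definition theta (z : E) : R := N%:R * phi z + \sum_i z ord0 i * pderive i phi z.

Lemma tame_theta : tame theta.
Proof.
apply: tame_add; first by apply: tame_mul => //; exact: tame_cst.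
apply: tame_sum => i; apply: tame_mul; first exact: tame_coord.
exact: tame_pderive.
Qed.

Lemma supp_theta : supp_in M theta.
Proof.
move=> x xM; rewrite /theta sphi// mulr0 add0r big1// => i _.
by rewrite (supp_in_pderive i sphi)// mulr0.
Qed.

Lemma is_derive_radial (y : E) (r : R) :
  is_derive r (1 : R) (fun r : R => phi (r *: y)) (\sum_i y ord0 i * pderive i phi (r *: y)).
Proof.
apply/is_derive_lineP.
have := tame_is_derive (r *: y) y tphi => /is_derive_lineP.
congr (is_derive _ _ _ _); apply/funext => h.
by rewrite scalerDl; congr (phi (_ *: _ + _)); rewrite /GRing.scale/= mulr1.
Qed.

(* The derivative in [r] of [r ^+ N * phi (r *: y)], written with [r ^-1] so that
   it also makes sense for [N = 0]. *)
Definition dradial (y : E) (r : R) : R := r ^+ N * r^-1 * theta (r *: y).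

Lemma is_derive_dradial (y : E) (r : R) : 0 < r ->
  is_derive r (1 : R) (fun r : R => r ^+ N * phi (r *: y)) (dradial y r).
Proof.
move=> r0.
have dX : is_derive r (1 : R) (fun r : R => r ^+ N) (N%:R * r ^+ N.-1).
  have := @is_deriveX _ _ id N r 1 1 (is_derive_id _ _).
  rewrite (_ : id ^+ N = fun r : R => r ^+ N); last by apply/funext => z; rewrite fctE.
  by move=> /is_derive_eq; apply; exact: mulr1.
apply: (is_derive_eq (is_deriveM dX (is_derive_radial y r))).
rewrite /dradial /theta /GRing.scale/= mulrDr addrC; congr (_ + _).
  have key n : n%:R * r ^+ n.-1 = r ^+ n * r^-1 * n%:R.
    case: n => [|n]; first by rewrite mul0r mulr0.
    by rewrite /= exprS [r * _]mulrC mulfK ?gt_eqF// mulrC.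
  by rewrite key mulrC -!mulrA.
rewrite -mulrA; congr (_ * _); rewrite mulr_sumr; apply: eq_bigr => i _.
by rewrite mxE mulrA mulrA mulVf ?mul1r ?gt_eqF.
Qed.

Lemma continuous_at_radial (f : E -> R) (y : E) (r : R) : continuous f ->
  {for r, continuous (fun r : R => f (r *: y))}.
Proof.
move=> cf; apply: (@continuous_comp _ _ _ (fun r : R => r *: y) f); last exact: cf.
exact: scalel_continuous.
Qed.

Lemma continuous_at_dradial (y : E) (r : R) : 0 < r -> {for r, continuous (dradial y)}.
Proof.
move=> r0; apply: continuousM; last by apply: continuous_at_radial; exact/tame_continuous/tame_theta.
apply: continuousM; first exact: exprn_continuous.
by apply: inv_continuous; rewrite gt_eqF.
Qed.

Lemma integral_dradial (c d : R) (y : E) : 0 < c -> c < d ->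
  mu.-integrable `[c, d] (EFin \o dradial y) /\
  (\int[mu]_(r in `[c, d]) (dradial y r)%:E =
   (d ^+ N * phi (d *: y) - c ^+ N * phi (c *: y))%:E)%E.
Proof.
move=> c0 cd.
have cw : {within `[c, d], continuous (dradial y)}.
  apply: continuous_in_subspaceT => r; rewrite inE/= in_itv/= => /andP[cr _].
  exact/continuous_at_dradial/(lt_le_trans c0).
split; first by apply: continuous_compact_integrable => //; exact: segment_compact.
rewrite (@continuous_FTC2 _ _ (fun r : R => r ^+ N * phi (r *: y)) _ _ cd cw) ?EFinB//.
- have cK r : 0 < r -> {for r, continuous (fun r : R => r ^+ N * phi (r *: y))}.
    move=> r0; apply/differentiable_continuous/derivable1_diffP.
    by have [] := is_derive_dradial y r0.
  split.
  + move=> r; rewrite in_itv/= => /andP[cr _].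
    by have [] := is_derive_dradial y (lt_trans c0 cr).
  + exact/cvg_at_right_filter/cK.
  + exact/cvg_at_left_filter/cK/(lt_trans c0).
- move=> r; rewrite in_itv/= => /andP[cr _]; rewrite derive1E.
  by have [_ ->] := is_derive_dradial y (lt_trans c0 cr).
Qed.

Variables (u : E -> R) (g : E -> E) (ug : is_weak_gradient u g).

Lemma supp_scaled (r : R) : 0 < r -> supp_in (M / r) (fun y => phi (r *: y)).
Proof. by move=> r0; exact: supp_in_scale. Qed.

(** The weak gradient is tested componentwise with the field y phi(r y), whose divergence is theta(r
    y). *)
Lemma weak_theta (r : R) : 0 < r ->
  leb.-integrable setT (EFin \o (fun y => \sum_i g y ord0 i * (y ord0 i * phi (r *: y)))) /\
  \int[leb]_y (u y * theta (r *: y)) =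
  - \int[leb]_y (\sum_i g y ord0 i * (y ord0 i * phi (r *: y))).
Proof.
move=> r0; have [lu lg Hg] := ug.
pose psi i (y : E) : R := y ord0 i * phi (r *: y).
have tr : tame (fun y => phi (r *: y)) by exact: tame_scale.
have tpsi i : test_function (psi i).
  apply: (@test_tame R N _ (M / r)); first by apply: tame_mul => //; exact: tame_coord.
  by apply: supp_inMl; exact: supp_scaled.
have [i1 e1] := Rintegral_sum (index_enum 'I_N) (fun i => test_integrable (lg i) (tpsi i)).
have [i2 e2] := Rintegral_sum (index_enum 'I_N) (fun i => test_integrable lu (test_pderive i (tpsi i))).
split=> //; rewrite e1 -sumrN (eq_bigr (fun i => \int[leb]_x (u x * pderive i (psi i) x))); last first.
  by move=> i _; rewrite Hg.
rewrite -e2; apply: eq_Rintegral => y _; rewrite -mulr_sumr; congr (_ * _).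
have dpsi i : pderive i (psi i) y = phi (r *: y) + y ord0 i * (r * pderive i phi (r *: y)).
  rewrite /psi pderiveM; [|exact/tame_smooth/tame_coord|exact: tame_smooth].
  rewrite pderive_scale; last exact: tame_smooth.
  congr (_ + _); rewrite /pderive.
  by have [_ ->] := is_derive_coord y (delta_mx ord0 i) i; rewrite mxE !eqxx mul1r.
rewrite (eq_bigr _ (fun i _ => dpsi i)) big_split/= sumr_const card_ord /theta mulr_natl.
by congr (_ + _); apply: eq_bigr => i _; rewrite mxE; ring.
Qed.

(** The substitution x = r y reduces this to [weak_theta]: the Jacobian r^N, the factor r^-2 and the
    r in x = r y combine to the power of r in [dradial]. *)
Lemma test_radial_grad (r : R) : 0 < r ->
  leb.-integrable setT (EFin \o (fun x => phi x * radial_grad g r x)) /\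
  \int[leb]_x (phi x * radial_grad g r x) = - \int[leb]_y (u y * dradial y r).
Proof.
move=> r0; have [lu lg Hg] := ug; have [i1 e1] := weak_theta r0.
pose f (y : E) : R := r^-1 * (\sum_i g y ord0 i * (y ord0 i * phi (r *: y))).
have fi : leb.-integrable setT (EFin \o f) by exact: (integrableZl measurableT r^-1 i1).
have fE x : f (r^-1 *: x) = phi x * radial_grad g r x.
  rewrite /f /radial_grad scalerA mulfV ?gt_eqF// scale1r.
  rewrite !mulr_sumr; apply: eq_bigr => i _; rewrite mxE; field; exact: lt0r_neq0.
have ri : 0 < r^-1 by rewrite invr_gt0.
have e2 := Rintegral_scale ri fi; rewrite invrK in e2.
have i2 := integrable_scale ri fi.
split; first by move: i2; apply: eq_integrable => // x _ /=; rewrite fE.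
transitivity (\int[leb]_x f (r^-1 *: x)); first by apply: eq_Rintegral => x _; rewrite fE.
rewrite e2 /f RintegralZl// -[X in _ * (_ * X)]opprK -e1 !mulrN mulrA; congr (- _).
rewrite -RintegralZl//; first by apply: eq_Rintegral => y _; rewrite /dradial; ring.
apply: (@integrable_loc_test R N u _ (M / r)) => //.
  by apply/tame_continuous/tame_scale/tame_theta.
by apply: supp_in_scale => //; exact: supp_theta.
Qed.

End radial_test.

Section radial_identity.
Context {R : realType} {N : nat}.
Local Notation E := 'rV[R]_N.
Local Notation leb := (@lebesgue_rV R N).
Local Notation mu := (@lebesgue_measure R).
Local Notation L := (measurableTypeR R).
Variables (c d : R) (c0 : 0 < c) (cd : c < d).
Local Notation I := (`[c, d]%classic : set L).
Variables (u : E -> R) (g : E -> E) (ug : is_weak_gradient u g).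

Section test.
Variables (phi : E -> R) (M : R) (tphi : tame phi) (M0 : 0 < M) (sphi : supp_in M phi).

Lemma integrable_dradial_slab :
  (mu \x leb)%E.-integrable setT
    (fun z : L * E => (\1_I z.1 * (u z.2 * dradial phi z.2 z.1))%:E).
Proof.
have [lu _ _] := ug; have mu' : measurable_fun setT u by case: lu.
have ttheta := tame_theta tphi.
have [C C0 HC] := supp_in_bounded (tame_continuous ttheta) (supp_theta sphi).
have d0 := lt_trans c0 cd.
pose k (y : E) : R := `|u y| * \1_(cube (M / c)) y.
have ik : leb.-integrable setT (EFin \o k).
  apply: (@integrable_loc_supp R N _ \1_(cube (M / c)) (M / c) 1) => //.
  - exact: loc_integrable_norm.
  - by apply: measurable_indic; exact: measurable_cube.
  - by move=> x; rewrite indicE; case: (_ \in _); rewrite ?normr1 ?normr0.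
  - by move=> x; rewrite indicE; case: (boolP (x \in _)) => //; rewrite inE => /[swap]/[apply].
(* Bounds the three factors of [dradial] for r in [c, d]. *)
pose K := d ^+ N * c^-1 * C.
apply: (@integrable_slab R N c d cd _ (fine (K%:E * \int[leb]_y (k y)%:E)%E)).
  apply: measurable_funM; first by apply: (measurableT_comp mu'); exact: measurable_snd.
  apply: measurable_funM; first apply: measurable_funM.
  - by apply: measurable_funX; exact: measurable_fst.
  - by apply: measurable_funV; exact: measurable_fst.
  - apply: (measurableT_comp (continuous_measurable_rV (tame_continuous ttheta))).
    by apply: measurable_scale_rV; [exact: measurable_fst|exact: measurable_snd].
move=> r rI; have r0 := itv_pos c0 rI.
have [cr rd] : c <= r /\ r <= d by move: rI; rewrite /= in_itv/= => /andP.
rewrite fineK; last by rewrite fin_numM//; exact: integrable_fin_num.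
have K0 : 0 <= K by rewrite /K !mulr_ge0 ?invr_ge0 ?exprn_ge0 ?ltW.
have mk : measurable_fun setT (EFin \o k) by exact: measurable_int ik.
rewrite -ge0_integralZl//; last by move=> y _; rewrite lee_fin /k mulr_ge0.
apply: ge0_le_integral => //.
- apply: measurableT_comp => //; apply/measurable_EFinP; apply: measurable_funM => //.
  have mt : measurable_fun setT (fun y : E => theta phi (r *: y)).
    exact: measurable_fun_scale (continuous_measurable_rV (tame_continuous ttheta)).
  by apply: (measurable_funM (f := fun=> r ^+ N * r^-1) _ mt).
- exact: measurable_funeM.
- move=> y _; rewrite lee_fin /k indicE.
  have [_|yM] := boolP (y \in _).
    rewrite mulr1 normrM mulrC ler_wpM2r// /dradial !normrM /K.
    rewrite /= normrX normfV (gtr0_norm r0).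
    apply: ler_pM => //; rewrite ?mulr_ge0 ?invr_ge0 ?exprn_ge0 ?(ltW r0)//.
    apply: ler_pM => //; rewrite ?invr_ge0 ?exprn_ge0 ?(ltW r0)//.
      by rewrite lerXn2r// nnegrE ltW.
    by rewrite lef_pV2.
  rewrite !mulr0 /dradial (supp_theta sphi) ?mulr0 ?normr0//.
  move=> h; move: yM; rewrite notin_setE; apply.
  have := (@cube_scale R N M r y r0).1 h; apply: cube_subset.
  by rewrite ler_wpM2l ?lef_pV2// ltW.
Qed.

Lemma integral_radial_int_test :
  \int[leb]_x (radial_int c d g x * phi x) =
  - \int[leb]_y (u y * (d ^+ N * phi (d *: y) - c ^+ N * phi (c *: y))).
Proof.
have iF := integrable_slab_fun c0 cd ug M0.
have [C C0 HC] := supp_in_bounded (tame_continuous tphi) sphi.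
have mphi := continuous_measurable_rV (tame_continuous tphi).
pose P (z : L * E) : \bar R := (\1_I z.1 * slab_fun g M z * phi z.2)%:E.
have iP : (mu \x leb)%E.-integrable setT P.
  have := integrableZl measurableT C iF; apply: le_integrable => //.
    apply/measurable_EFinP; apply: measurable_funM.
      by apply/measurable_EFinP; exact: measurable_int iF.
    by apply: (measurableT_comp mphi); exact: measurable_snd.
  move=> z _; rewrite -EFinM /P /= lee_fin [leLHS]normrM [leRHS]normrM mulrC ler_wpM2r//.
  by apply: le_trans (HC _) _; rewrite ler_norm.
(* The factor [phi x] passes through [fine] only where the slice in r is integrable, that is for
   almost every x. *)
have aeF := ae_integrable2 iF.
have e1 : (\int[leb]_x (radial_int c d g x * phi x)%:E = \int[leb]_x \int[mu]_r P (r, x))%E.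
  apply: ae_eq_integral => //.
  - apply/measurable_EFinP; apply: measurable_funM => //.
    exact: measurable_radial_int ug.
  - by apply: measurable_partial_integral; exact: measurable_int iP.
  - apply: filterS aeF => x ix _.
    have [xM|xM] := pselect (cube M x); last first.
      by rewrite /P sphi//= mulr0 integral0_eq// => r _; rewrite mulr0.
    rewrite (slab_fun_cube _ _ _ xM) /P /=.
    under [RHS]eq_integral do rewrite EFinM.
    rewrite integralZr// EFinM fineK//.
    exact: integrable_fin_num ix.
have e2 : (\int[mu]_r \int[leb]_x P (r, x) =
   \int[mu]_r \int[leb]_y ((-1)%:E * (\1_I r * (u y * dradial phi y r))%:E))%E.
  apply: eq_integral => r _; rewrite /P /= indicE.
  have [rI|_] := boolP (r \in _); last first.
    rewrite !integral0_eq// => x _; first by rewrite !mul0r mule0.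
    by rewrite !mul0r.
  rewrite inE in rI; have r0 := itv_pos c0 rI.
  have [i1 e] := test_radial_grad tphi sphi ug r0.
  have i3 : leb.-integrable setT (EFin \o (fun y => u y * dradial phi y r)).
    have [lu _ _] := ug.
    have := @integrable_loc_test R N u (fun y => theta phi (r *: y)) (M / r) lu.
    move=> /(_ (tame_continuous (tame_scale r (tame_theta tphi))) (supp_in_scale r0 (supp_theta sphi))).
    move=> /(integrableZl measurableT (r ^+ N * r^-1)); apply: eq_integrable => // y _.
    by rewrite /= -EFinM /dradial; congr EFin; ring.
  transitivity (\int[leb]_x (phi x * radial_grad g r x))%:E.
    rewrite /Rintegral fineK; last exact: integrable_fin_num.
    apply: eq_integral => x _; rewrite mul1r mulrC /slab_fun/= indicE.
    have [_|xM] := boolP (x \in _); first by rewrite mul1r.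
    by rewrite sphi ?mul0r//; move: xM; rewrite notin_setE.
  under [RHS]eq_integral do rewrite mul1r.
  rewrite integralZl// e EFinN /Rintegral fineK; last exact: integrable_fin_num.
  by rewrite EFinN mulN1e.
have iQ := integrableZl measurableT (-1) integrable_dradial_slab.
(* With the integral in r innermost again, the fundamental theorem of calculus evaluates it. *)
have e3 := Fubini iQ.
rewrite /Rintegral e1 -(Fubini iP) e2 [X in fine X]e3.
have eE (y : E) : (\int[mu]_r ((-1)%:E * (\1_I r * (u y * dradial phi y r))%:E) =
    (-1 * (u y * (d ^+ N * phi (d *: y) - c ^+ N * phi (c *: y))))%:E)%E.
  have [iy ey] := integral_dradial tphi y c0 cd.
  have e1' : (\int[mu]_(r in I) ((- u y)%:E * (dradial phi y r)%:E))%E =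
      ((- u y) * (d ^+ N * phi (d *: y) - c ^+ N * phi (c *: y)))%:E.
    by rewrite EFinM -ey integralZl.
  rewrite mulN1r -mulNr -e1' [RHS]integral_mkcond; apply: eq_integral => r _.
  rewrite patchE indicE; case: ifPn => _; rewrite ?mul0r ?mule0 ?mul1r//.
  by rewrite -!EFinM; congr EFin; ring.
transitivity (fine (\int[leb]_y (-1 * (u y * (d ^+ N * phi (d *: y) - c ^+ N * phi (c *: y))))%:E)%E).
  by congr fine; apply: eq_integral => y _; exact: eE.
have [lu _ _] := ug.
have i4 : leb.-integrable setT (EFin \o (fun y => u y * (d ^+ N * phi (d *: y) - c ^+ N * phi (c *: y)))).
  have d0 := lt_trans c0 cd.
  have ld : leb.-integrable setT (EFin \o (fun y => u y * phi (d *: y))).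
    apply: (integrable_loc_test lu _ (supp_in_scale d0 sphi)).
    exact/tame_continuous/tame_scale.
  have lc : leb.-integrable setT (EFin \o (fun y => u y * phi (c *: y))).
    apply: (integrable_loc_test lu _ (supp_in_scale c0 sphi)).
    exact/tame_continuous/tame_scale.
  have := integrableB measurableT (integrableZl measurableT (d ^+ N) ld) (integrableZl measurableT (c ^+ N) lc).
  by apply: eq_integrable => // z _ /=; rewrite -!EFinM -EFinB; congr EFin; ring.
rewrite -[RHS]mulN1r.
exact: (RintegralZl _ measurableT i4).
Qed.
End test.

(* Tested against [phi], both sides equal minus the integral over [c, d] of the
   derivative in [r] of the integral of [u y * r ^+ N * phi (r *: y)]. *)
Lemma radial_identity :
  {ae leb, forall x, u (c^-1 *: x) - u (d^-1 *: x) = radial_int c d g x}.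
Proof.
have [lu _ _] := ug; have d0 := lt_trans c0 cd.
have c1 : 0 < c^-1 by rewrite invr_gt0.
have d1 : 0 < d^-1 by rewrite invr_gt0.
have luc := loc_integrable_scale c1 lu.
have lud := loc_integrable_scale d1 lu.
have lr := loc_integrable_radial_int c0 cd ug.
pose h x := u (c^-1 *: x) + (-1) * u (d^-1 *: x) + (-1) * radial_int c d g x.
have : {ae leb, forall x, h x = 0}.
  apply: fundamental_lemma.
    by apply: loc_integrableD; [apply: loc_integrableD => //|]; exact: loc_integrableZ.
  move=> phi tphi testphi; have [_ [M M0 sM]] := (test_functionP phi).1 testphi.
  have e := integral_radial_int_test tphi M0 sM.
  have ic := test_integrable luc testphi.
  have id := test_integrable lud testphi.
  have ir := test_integrable lr testphi.
  rewrite [LHS](_ : _ = \int[leb]_x ((u (c^-1 *: x) * phi x - u (d^-1 *: x) * phi x) - radial_int c d g x * phi x)); last first.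
    by apply: eq_Rintegral => x _; rewrite /h; ring.
  rewrite RintegralB//; last exact: (integrableB _ ic id).
  rewrite RintegralB// e opprK.
  have tc : test_function (fun x => phi (c *: x)) by exact: test_scale.
  have td : test_function (fun x => phi (d *: x)) by exact: test_scale.
  have ec := Rintegral_scale c1 (test_integrable lu tc).
  have ed := Rintegral_scale d1 (test_integrable lu td).
  have Ec : \int[leb]_x (u (c^-1 *: x) * phi x) = c ^+ N * \int[leb]_y (u y * phi (c *: y)).
    rewrite invrK in ec; rewrite -ec; apply: eq_Rintegral => x _.
    by rewrite scalerA mulfV ?gt_eqF// scale1r.
  have Ed : \int[leb]_x (u (d^-1 *: x) * phi x) = d ^+ N * \int[leb]_y (u y * phi (d *: y)).
    rewrite invrK in ed; rewrite -ed; apply: eq_Rintegral => x _.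
    by rewrite scalerA mulfV ?gt_eqF// scale1r.
  rewrite Ec Ed -!RintegralZl//; [|exact: (test_integrable lu td)|exact: (test_integrable lu tc)].
  rewrite -RintegralB//; [|exact: (integrableZl measurableT _ (test_integrable lu tc))|exact: (integrableZl measurableT _ (test_integrable lu td))].
  rewrite -RintegralD//.
  - by rewrite /Rintegral integral0_eq// => x _; congr EFin; ring.
  - apply: (integrableB measurableT (integrableZl measurableT _ (test_integrable lu tc)) (integrableZl measurableT _ (test_integrable lu td))).
  - have := (integrableB measurableT (integrableZl measurableT (d ^+ N) (test_integrable lu td)) (integrableZl measurableT (c ^+ N) (test_integrable lu tc))).
    by apply: eq_integrable => // y _ /=; rewrite -!EFinM -EFinB; congr EFin; ring.
apply: filterS => x; rewrite /h !mulN1r => /eqP; rewrite subr_eq0 => /eqP.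
exact.
Qed.

End radial_identity.

(** * Weighted bounds for the difference of two dilates *)

Section radial_estimates.
Context {R : realType} {N : nat}.
Local Notation E := 'rV[R]_N.
Local Notation leb := (@lebesgue_rV R N).
Local Notation mu := (@lebesgue_measure R).
Local Notation L := (measurableTypeR R).
Implicit Types x y : E.

Lemma enorm_ge0 x : 0 <= enorm x. Proof. exact: sqrtr_ge0. Qed.

Lemma enorm_sqr x : enorm x ^+ 2 = \sum_i x ord0 i ^+ 2.
Proof. by rewrite sqr_sqrtr// sumr_ge0// => i _; exact: sqr_ge0. Qed.

Lemma coord_le_enorm x i : `|x ord0 i| <= enorm x.
Proof.
rewrite -sqrtr_sqr ler_wsqrtr// (bigD1 i)//= lerDl sumr_ge0// => j _.
exact: sqr_ge0.
Qed.

Lemma measurable_enorm d (T : measurableType d) (f : T -> E) :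
  (forall i, measurable_fun setT (fun t => f t ord0 i)) ->
  measurable_fun setT (fun t => enorm (f t)).
Proof.
move=> mf; apply: (measurableT_comp (f := @Num.sqrt R)) => //.
  by apply: continuous_measurable_fun; exact: sqrt_continuous.
by apply: measurable_sum => i; exact: measurable_funX.
Qed.

Variables (c d : R) (c0 : 2^-1 <= c) (cd : c < d) (d2 : d <= 2).
Local Notation I := (`[c, d]%classic : set L).
Variables (u : E -> R) (g : E -> E) (ug : is_weak_gradient u g).
Local Notation w := (fun x : E => u (c^-1 *: x) - u (d^-1 *: x)).
Local Notation S := (fun x : E => enorm (g x)).
Local Notation V := (fun x : E => \int[mu]_(r in I) ((S (r^-1 *: x) ^+ 2)%:E))%E.

Let cgt0 : 0 < c. Proof. by rewrite (lt_le_trans _ c0)// invr_gt0. Qed.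

Lemma measurable_S : measurable_fun setT S.
Proof. by apply: measurable_enorm => i; exact: measurable_weak_gradient ug i. Qed.

Lemma measurable_S_slab : measurable_fun [set: L * E] (fun z => S (z.1^-1 *: z.2)).
Proof.
apply: (measurableT_comp measurable_S); apply: measurable_scale_rV; last exact: measurable_snd.
by apply: measurable_funV; exact: measurable_fst.
Qed.

Lemma measurable_S_line x : measurable_fun [set: L] (fun r : L => S ((r : R)^-1 *: x)).
Proof. exact: (measurableT_comp measurable_S_slab (measurable_pair2 x)). Qed.

(** The 4 bounds r^-2 since r >= 1/2. The factor N comes from estimating each of the N products by
    the sup norm of x times the Euclidean norm of the gradient. *)
Lemma radial_grad_le r x : I r -> `|radial_grad g r x| <= 4 * N%:R * `|x| * S (r^-1 *: x).
Proof.
move=> rI; have r0 := itv_pos cgt0 rI.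
rewrite /radial_grad normrM -!mulrA; apply: ler_pM => //.
  rewrite normfV normrX gtr0_norm// -[leRHS]invrK lef_pV2 ?posrE ?invr_gt0// ?exprn_gt0//.
  have : 2^-1 <= r by apply: le_trans c0 _; move: rI; rewrite /= in_itv/= => /andP[].
  by move=> h; rewrite (_ : 4^-1 = 2^-1 ^+ 2); [rewrite lerXn2r// nnegrE ?invr_ge0// ltW|field].
apply: le_trans (ler_norm_sum _ _ _) _.
apply: (@le_trans _ _ (\sum_(i < N) `|x| * S (r^-1 *: x))).
  apply: ler_sum => i _; rewrite normrM; apply: ler_pM => //; first exact: coord_le_norm.
  exact: coord_le_enorm.
by rewrite sumr_const card_ord -[leLHS]mulr_natl.
Qed.

Lemma radial_int_le x :
  (`|radial_int c d g x|%:E <= \int[mu]_(r in I) (4 * N%:R * `|x| * S (r^-1 *: x))%:E)%E.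
Proof.
have mI : measurable I by exact: measurable_itv.
have mr : measurable_fun I (fun r => (radial_grad g r x)%:E).
  apply: measurable_funTS; apply/measurable_EFinP.
  exact: (measurableT_comp (measurable_radial_grad ug) (measurable_pair2 x)).
apply: (@le_trans _ _ `|\int[mu]_(r in I) (radial_grad g r x)%:E|%E).
  rewrite /radial_int /Rintegral; case: (\int[mu]_(r in I) _)%E => //=; by rewrite normr0 leey.
apply: le_trans (le_abse_integral _ _ _) _ => //.
apply: ge0_le_integral => //.
- exact: measurableT_comp.
- apply: measurable_funTS; apply/measurable_EFinP; apply: measurable_funM => //.
  exact: measurable_S_line.
- by move=> r rI; rewrite lee_fin; exact: radial_grad_le.
Qed.

(* Used with [alpha + beta * s ^+ 2] coming from the inequality between the
   arithmetic and geometric means, which replaces Cauchy-Schwarz in [r]. *)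
Lemma radial_int_mul_le x (a alpha beta : R) : 0 <= a -> 0 <= alpha -> 0 <= beta ->
  (forall s, 0 <= s -> a * (4 * N%:R * `|x| * s) <= alpha + beta * s ^+ 2) ->
  ((a * `|radial_int c d g x|)%:E <= (alpha * (d - c))%:E + beta%:E * V x)%E.
Proof.
move=> a0 al0 be0 H.
have mI : measurable I by exact: measurable_itv.
have mS2 : measurable_fun I (fun r : L => (S ((r : R)^-1 *: x) ^+ 2)%:E).
  apply: measurable_funTS; apply/measurable_EFinP; apply: measurable_funX.
  exact: measurable_S_line.
have mS1 : measurable_fun I (fun r : L => (4 * N%:R * `|x| * S ((r : R)^-1 *: x))%:E).
  apply: measurable_funTS; apply/measurable_EFinP; apply: measurable_funM => //.
  exact: measurable_S_line.
apply: (@le_trans _ _ (a%:E * \int[mu]_(r in I) (4 * N%:R * `|x| * S (r^-1 *: x))%:E)%E).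
  by rewrite EFinM; apply: lee_wpmul2l => //; exact: radial_int_le.
rewrite -ge0_integralZl//; last by move=> r _; rewrite lee_fin !mulr_ge0// enorm_ge0.
apply: (@le_trans _ _ (\int[mu]_(r in I) (alpha%:E + beta%:E * (S (r^-1 *: x) ^+ 2)%:E)))%E.
  apply: ge0_le_integral => //.
  - by move=> r _; rewrite -EFinM lee_fin !mulr_ge0// enorm_ge0.
  - exact: measurable_funeM.
  - by apply: emeasurable_funD => //; exact: measurable_funeM.
  - by move=> r _; rewrite -!EFinM -EFinD lee_fin; apply: H; exact: enorm_ge0.
rewrite ge0_integralD//; last 2 first.
- by move=> r _; rewrite -EFinM lee_fin mulr_ge0// sqr_ge0.
- exact: measurable_funeM.
rewrite ge0_integralZl//; last by move=> r _; rewrite lee_fin sqr_ge0.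
rewrite leeD2r// integral_cst// EFinM.
have := @lebesgue_measure_itv R `[c, d]; rewrite /= lte_fin cd -EFinB => e.
by rewrite [X in (_ * X <= _)%E]e.
Qed.

Lemma V_ge0 x : (0 <= V x)%E.
Proof. by apply: integral_ge0 => r _; rewrite lee_fin sqr_ge0. Qed.

Lemma radial_sqr_le x :
  ((radial_int c d g x ^+ 2)%:E <= (16 * N%:R ^+ 2 * (d - c) * `|x| ^+ 2)%:E * V x)%E.
Proof.
set a := `|radial_int c d g x|; set D := d - c.
have D0 : 0 < D by rewrite subr_gt0.
(* Here [alpha] is a^2 / (2 D), so that its contribution is half of a^2 and can be absorbed on the
   left; [beta] is then the value for which the difference of the two sides is a perfect square. *)
have h : ((a * a)%:E <= (a ^+ 2 / (2 * D) * D)%:E + (8 * N%:R ^+ 2 * D * `|x| ^+ 2)%:E * V x)%E.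
  apply: radial_int_mul_le.
  - exact: normr_ge0.
  - by rewrite divr_ge0 ?sqr_ge0// mulr_ge0// ltW.
  - by rewrite !mulr_ge0 ?sqr_ge0// ltW.
  - move=> s s0; rewrite -subr_ge0.
    rewrite (_ : _ - _ = (2 * D)^-1 * (a - 4 * N%:R * `|x| * D * s) ^+ 2); last by field; rewrite gt_eqF.
    by rewrite mulr_ge0 ?sqr_ge0// invr_ge0 mulr_ge0// ltW.
have e : a ^+ 2 / (2 * D) * D = a ^+ 2 / 2 by field; rewrite gt_eqF.
rewrite e -expr2 in h; rewrite -real_normK ?num_real// -/a.
rewrite (_ : 16 * _ * _ * _ = 2 * (8 * N%:R ^+ 2 * D * `|x| ^+ 2)); last by ring.
rewrite [in leRHS]EFinM -muleA; move: h; move: (_ * V x)%E => [y| |].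
- by rewrite -EFinM -EFinD !lee_fin => h; lra.
- by move=> _; rewrite gt0_muley ?leey// lte_fin.
- by rewrite /= leeNy_eq.
Qed.

(** The product of the gradients at x and at x / r is split by 2 S s <= S^2 + s^2, leaving two
    quadratic terms that can each be integrated against a weight. *)
Lemma radial_mul_le x :
  ((`|radial_int c d g x| * S x)%:E <=
   (2 * N%:R * `|x|)%:E * (((d - c) * S x ^+ 2)%:E + V x))%E.
Proof.
rewrite mulrC; apply: le_trans (@radial_int_mul_le x (S x) (2 * N%:R * `|x| * S x ^+ 2) (2 * N%:R * `|x|) _ _ _ _) _.
- exact: enorm_ge0.
- by rewrite !mulr_ge0 ?enorm_ge0.
- by rewrite !mulr_ge0.
- move=> s s0; rewrite -subr_ge0.
  rewrite (_ : _ - _ = 2 * N%:R * `|x| * (S x - s) ^+ 2); last by ring.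
  by apply: mulr_ge0; [rewrite !mulr_ge0|exact: sqr_ge0].
- have := V_ge0 x; move: (\int[mu]_(r in _) _)%E => v v0.
  rewrite ge0_muleDr; [|by rewrite lee_fin mulr_ge0 ?sqr_ge0// subr_ge0 ltW|by []].
  by rewrite -EFinM leeD2r// lee_fin le_eqVlt; apply/orP; left; apply/eqP; ring.
Qed.

End radial_estimates.

Section dilation_estimates.
Context {R : realType} {N : nat}.
Local Notation E := 'rV[R]_N.
Local Notation leb := (@lebesgue_rV R N).
Local Notation mu := (@lebesgue_measure R).
Local Notation L := (measurableTypeR R).
Variables (u : E -> R) (g : E -> E) (ug : is_weak_gradient u g).
Local Notation S := (fun x : E => enorm (g x)).

Lemma measurable_norm_rV : measurable_fun setT (fun x : E => `|x|).
Proof. by apply: continuous_measurable_rV; exact: norm_continuous. Qed.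

Section cd.
Variables (c d : R) (c0 : 2^-1 <= c) (cd : c < d) (d2 : d <= 2).
Local Notation I := (`[c, d]%classic : set L).
Local Notation w := (fun x : E => u (c^-1 *: x) - u (d^-1 *: x)).
Local Notation V := (fun x : E => \int[mu]_(r in I) ((S (r^-1 *: x) ^+ 2)%:E))%E.

Let cgt0 : 0 < c. Proof. by rewrite (lt_le_trans _ c0)// invr_gt0. Qed.

Let mu_ : measurable_fun setT u. Proof. by have [[]] := ug. Qed.

Let mw : measurable_fun setT w.
Proof. by apply: measurable_funB; exact: measurable_fun_scale. Qed.

Let mS2 : measurable_fun setT (fun x : E => S x ^+ 2).
Proof. by apply: measurable_funX; exact: measurable_S ug. Qed.

Let mV : measurable_fun setT V.
Proof.
have mI : measurable I by exact: measurable_itv.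
rewrite (_ : V = (fun x : E => \int[mu]_r (\1_I r * S (r^-1 *: x) ^+ 2)%:E)%E); last first.
  apply/funext => x; rewrite integral_mkcond; apply: eq_integral => r _.
  by rewrite patchE indicE; case: ifPn => _; rewrite ?mul1r ?mul0r.
apply: (measurable_partial_integral (f := fun z : L * E => (\1_I z.1 * S (z.1^-1 *: z.2) ^+ 2)%:E)).
apply/measurable_EFinP; apply: measurable_funM; first exact: measurable_indic_fst.
by apply: measurable_funX; exact: measurable_S_slab ug.
Qed.

Let dN : d ^+ N <= 2 ^+ N.
Proof. by rewrite lerXn2r// nnegrE ltW// (lt_trans cgt0 cd). Qed.

Let D0 : 0 <= d - c. Proof. by rewrite subr_ge0 ltW. Qed.

(** One factor [d - c] comes from the pointwise bound [radial_sqr_le], the other from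
    [tonelli_scale]. The weight absorbs |x|^2, about whose product with the squared gradient nothing
    is known. *)
Lemma int_sqr_le_cd (k : E -> R) (B : R) : measurable_fun setT k ->
  (forall x, 0 <= k x) -> 0 <= B -> (forall x, k x * `|x| ^+ 2 <= B) ->
  (\int[leb]_x (k x * w x ^+ 2)%:E <=
   (16 * N%:R ^+ 2 * B * 2 ^+ N * (d - c) ^+ 2)%:E * \int[leb]_x (S x ^+ 2)%:E)%E.
Proof.
move=> mk k0 B0 kB.
pose K := 16 * N%:R ^+ 2 * (d - c) * B.
have K0 : 0 <= K by rewrite !mulr_ge0.
apply: (@le_trans _ _ (\int[leb]_x ((cst K x)%:E * V x))%E).
  apply: ae_ge0_le_integral => //.
  - by move=> x _; rewrite lee_fin mulr_ge0// sqr_ge0.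
  - by apply/measurable_EFinP; apply: measurable_funM => //; exact: measurable_funX.
  - by move=> x _; rewrite mule_ge0// V_ge0.
  - by apply: emeasurable_funM; [exact: (@measurable_cst _ _ _ _ _ K%:E)|exact: mV].
  - apply: filterS (radial_identity cgt0 cd ug) => x wE _.
    rewrite /= wE EFinM; apply: le_trans (lee_wpmul2l _ (radial_sqr_le c0 cd ug x)) _.
      by rewrite lee_fin.
    rewrite muleA; apply: lee_wpmul2r; first exact: V_ge0.
    rewrite -EFinM lee_fin /K mulrCA.
    by rewrite ler_wpM2l// !mulr_ge0.
apply: le_trans (@tonelli_scale R N c d cgt0 cd (fun x => S x ^+ 2) (cst K) (cst K) _ _ _ _ _ _) _ => //.
- by move=> x; exact: sqr_ge0.
rewrite -ge0_integralZl//; last 2 first.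
- by move=> x _; rewrite lee_fin mulr_ge0// sqr_ge0.
- by rewrite lee_fin mulr_ge0// exprn_ge0// ltW// (lt_trans cgt0).
rewrite -ge0_integralZl//; last 2 first.
- by move=> x _; rewrite lee_fin sqr_ge0.
- by rewrite lee_fin !mulr_ge0 ?sqr_ge0 ?exprn_ge0.
apply: ge0_le_integral => //.
- move=> x _; rewrite -EFinM lee_fin; apply: mulr_ge0; last by rewrite mulr_ge0// sqr_ge0.
  by rewrite mulr_ge0// exprn_ge0// ltW// (lt_trans cgt0).
- by apply: measurable_funeM; apply/measurable_EFinP; exact: measurable_funM.
- by apply: measurable_funeM; exact/measurable_EFinP.
- move=> x _; rewrite -!EFinM lee_fin mulrA ler_wpM2r ?sqr_ge0// /K.
  rewrite (_ : 16 * _ * _ * _ * _ = (d - c) * 2 ^+ N * (16 * N%:R ^+ 2 * (d - c) * B)); last by ring.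
  by rewrite ler_wpM2r// ler_wpM2l.
- exact/measurable_EFinP.
- by apply/measurable_EFinP; exact: measurable_funM.
Qed.

(** Only one factor [d - c] is gained, so smallness must come from the weight [m]. The doubling
    condition on [m] brings the weight back from r x to x after the substitution in
    [tonelli_scale]. *)
Lemma int_mul_le_cd (eta m : E -> R) (Lam : R) : measurable_fun setT eta ->
  measurable_fun setT m -> (forall x, 0 <= eta x) -> (forall x, 0 <= m x) -> 0 <= Lam ->
  (forall x, eta x * `|x| <= Lam * m x) ->
  (forall r x, 0 < r -> r <= 2 -> m (r *: x) <= 2 * m x) ->
  (\int[leb]_x (eta x * (`|w x| * S x))%:E <=
   (2 * N%:R * Lam * (1 + 2 * 2 ^+ N) * (d - c))%:E * \int[leb]_x (m x * S x ^+ 2)%:E)%E.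
Proof.
move=> me mm e0 m0 L0 em mr.
pose rho x := 2 * N%:R * Lam * m x.
have r0 x : 0 <= rho x by rewrite !mulr_ge0.
have mrho : measurable_fun setT rho by exact: measurable_funM.
have mS := measurable_S ug.
have mmS : measurable_fun setT (fun x => (m x * S x ^+ 2)%:E).
  by apply/measurable_EFinP; exact: measurable_funM.
apply: (@le_trans _ _ (\int[leb]_x ((rho x * ((d - c) * S x ^+ 2))%:E + (rho x)%:E * V x))%E).
  apply: ae_ge0_le_integral => //.
  - by move=> x _; rewrite lee_fin !mulr_ge0// enorm_ge0.
  - apply/measurable_EFinP; apply: measurable_funM => //.
    by apply: measurable_funM => //; exact: measurableT_comp.
  - move=> x _; apply: adde_ge0; last by apply: mule_ge0; [rewrite lee_fin|exact: V_ge0].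
    by rewrite lee_fin mulr_ge0// mulr_ge0// sqr_ge0.
  - apply: emeasurable_funD.
      by apply/measurable_EFinP; apply: measurable_funM => //; exact: measurable_funM.
    by apply: emeasurable_funM => //; exact/measurable_EFinP.
  - apply: filterS (radial_identity cgt0 cd ug) => x wE _.
    rewrite /= wE EFinM; apply: le_trans (lee_wpmul2l _ (radial_mul_le c0 cd ug x)) _.
      by rewrite lee_fin.
    rewrite muleA [in leRHS]EFinM; have := V_ge0 c d g x; move: (V x) => v v0.
    rewrite -ge0_muleDr//; last by rewrite lee_fin mulr_ge0// sqr_ge0.
    apply: lee_wpmul2r; first by rewrite adde_ge0// lee_fin mulr_ge0// sqr_ge0.
    rewrite -EFinM lee_fin /rho mulrCA -mulrA ler_wpM2l ?mulr_ge0//.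
rewrite ge0_integralD//; last 4 first.
- by move=> x _; rewrite lee_fin mulr_ge0// mulr_ge0// sqr_ge0.
- by apply/measurable_EFinP; apply: measurable_funM => //; exact: measurable_funM.
- by move=> x _; apply: mule_ge0; [rewrite lee_fin|exact: V_ge0].
- by apply: emeasurable_funM => //; exact/measurable_EFinP.
(* The first summand carries the gradient at x, the second the dilated one, with Jacobian [d ^+ N]
   and a factor 2 from doubling. *)
apply: (@le_trans _ _ ((2 * N%:R * Lam * (d - c))%:E * \int[leb]_x (m x * S x ^+ 2)%:E +
   ((d - c) * d ^+ N)%:E * ((4 * N%:R * Lam)%:E * \int[leb]_x (m x * S x ^+ 2)%:E)))%E.
  apply: leeD.
    rewrite -ge0_integralZl//; last 2 first.
    - by move=> x _; rewrite lee_fin mulr_ge0// sqr_ge0.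
    - by rewrite lee_fin !mulr_ge0.
    rewrite le_eqVlt; apply/orP; left; apply/eqP; apply: eq_integral => x _.
    by rewrite -EFinM; congr EFin; rewrite /rho; ring.
  apply: le_trans (@tonelli_scale R N c d cgt0 cd (fun x => S x ^+ 2) rho (fun x => 4 * N%:R * Lam * m x) _ _ _ _ _ _) _ => //.
  - exact: measurable_funM.
  - by move=> x; exact: sqr_ge0.
  - move=> r x rI; have r_0 := itv_pos cgt0 rI; rewrite /rho.
    rewrite (_ : 4 * _ * _ * _ = 2 * N%:R * Lam * (2 * m x)); last by ring.
    rewrite ler_wpM2l ?mulr_ge0// mr//; apply: le_trans d2.
    by move: rI; rewrite /= in_itv/= => /andP[].
  rewrite [X in (_ * X <= _)%E](_ : _ = (4 * N%:R * Lam)%:E * \int[leb]_x (m x * S x ^+ 2)%:E)%E//.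
  rewrite -ge0_integralZl//; last 2 first.
  - by move=> x _; rewrite lee_fin mulr_ge0// sqr_ge0.
  - by rewrite lee_fin !mulr_ge0.
  by apply: eq_integral => x _; rewrite -EFinM; congr EFin; ring.
have J0 : (0 <= \int[leb]_x (m x * S x ^+ 2)%:E)%E.
  by apply: integral_ge0 => x _; rewrite lee_fin mulr_ge0// sqr_ge0.
rewrite muleA -ge0_muleDl; last 2 first.
- by rewrite lee_fin !mulr_ge0.
- by rewrite -EFinM lee_fin !mulr_ge0// exprn_ge0// ltW// (lt_trans cgt0).
apply: lee_wpmul2r => //.
rewrite -EFinM -EFinD lee_fin.
rewrite (_ : 2 * N%:R * Lam * _ * _ = 2 * N%:R * Lam * (d - c) + (d - c) * 2 ^+ N * (4 * N%:R * Lam)); last by ring.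
by rewrite lerD2l ler_wpM2r ?mulr_ge0// ler_wpM2l.
Qed.

End cd.
End dilation_estimates.

Section dilation.
Context {R : realType} {N : nat}.
Local Notation E := 'rV[R]_N.
Local Notation leb := (@lebesgue_rV R N).
Variables (u : E -> R) (g : E -> E) (ug : is_weak_gradient u g).
Local Notation S := (fun x : E => enorm (g x)).
Variables (rho : R) (rho1 : `|rho - 1| <= 2^-1).
Local Notation w := (fun x : E => u (rho^-1 *: x) - u x).

Let bounds : 2^-1 <= rho /\ rho <= 2.
Proof. by have := rho1; rewrite ler_norml => /andP[? ?]; split; lra. Qed.

(** Both signs of [rho - 1] are covered by taking [rho, 1] or [1, rho] as the interval of radii. *)
Lemma int_sqr_le (k : E -> R) (B : R) : measurable_fun setT k ->
  (forall x, 0 <= k x) -> 0 <= B -> (forall x, k x * `|x| ^+ 2 <= B) ->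
  (\int[leb]_x (k x * w x ^+ 2)%:E <=
   (16 * N%:R ^+ 2 * B * 2 ^+ N * (rho - 1) ^+ 2)%:E * \int[leb]_x (S x ^+ 2)%:E)%E.
Proof.
move=> mk k0 B0 kB; have [rl rh] := bounds.
have l12 : (1 : R) <= 2 by lra.
have l21 : 2^-1 <= (1 : R) by lra.
have [r1|r1|r1] := ltgtP rho 1.
- have := int_sqr_le_cd ug rl r1 l12 mk k0 B0 kB.
  rewrite (_ : (1 - rho) ^+ 2 = (rho - 1) ^+ 2); last by ring.
  apply: le_trans.
  rewrite le_eqVlt; apply/orP; left; apply/eqP; apply: eq_integral => x _.
  by rewrite invr1 scale1r.
- have := @int_sqr_le_cd R N u g ug 1 rho l21 r1 rh k B mk k0 B0 kB.
  apply: le_trans.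
  rewrite le_eqVlt; apply/orP; left; apply/eqP; apply: eq_integral => x _.
  by rewrite invr1 scale1r -sqrrN opprB.
- rewrite integral0_eq => [|x _].
    by rewrite r1 subrr expr0n mulr0 mul0e.
  by rewrite r1 invr1 scale1r subrr expr0n/= mulr0.
Qed.

Lemma int_mul_le (eta m : E -> R) (Lam : R) : measurable_fun setT eta ->
  measurable_fun setT m -> (forall x, 0 <= eta x) -> (forall x, 0 <= m x) -> 0 <= Lam ->
  (forall x, eta x * `|x| <= Lam * m x) ->
  (forall r x, 0 < r -> r <= 2 -> m (r *: x) <= 2 * m x) ->
  (\int[leb]_x (eta x * (`|w x| * S x))%:E <=
   (2 * N%:R * Lam * (1 + 2 * 2 ^+ N) * `|rho - 1|)%:E * \int[leb]_x (m x * S x ^+ 2)%:E)%E.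
Proof.
move=> me mm e0 m0 L0 em mr; have [rl rh] := bounds.
have l12 : (1 : R) <= 2 by lra.
have l21 : 2^-1 <= (1 : R) by lra.
have [r1|r1|r1] := ltgtP rho 1.
- have := @int_mul_le_cd R N u g ug rho 1 rl r1 l12 eta m Lam me mm e0 m0 L0 em mr.
  rewrite ltr0_norm ?subr_lt0// opprB; apply: le_trans.
  rewrite le_eqVlt; apply/orP; left; apply/eqP; apply: eq_integral => x _.
  by rewrite invr1 scale1r.
- have := @int_mul_le_cd R N u g ug 1 rho l21 r1 rh eta m Lam me mm e0 m0 L0 em mr.
  rewrite gtr0_norm ?subr_gt0//; apply: le_trans.
  rewrite le_eqVlt; apply/orP; left; apply/eqP; apply: eq_integral => x _.
  by rewrite invr1 scale1r distrC.
- rewrite integral0_eq => [|x _].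
    by rewrite r1 subrr normr0 mulr0 mul0e.
  by rewrite r1 invr1 scale1r subrr normr0 mul0r mulr0.
Qed.

End dilation.

(** * Semiconvexity of the potential *)

Section potential.
Context {R : realType}.
Variables (p q : R) (p2 : 2 < p) (pq : p < q).

Let q2 : 2 < q. Proof. exact: lt_trans p2 pq. Qed.

Let p0 : 0 < p. Proof. exact: lt_trans p2. Qed.
Let q0 : 0 < q. Proof. exact: lt_trans q2. Qed.

(* The higher power [q] enters the energy with a good sign, hence absorbs [p]
   up to a quadratic term. *)
Lemma powR_absorb (A B : R) : 0 < B ->
  exists2 K : R, 0 <= K & forall r : R, 0 <= r -> A * r `^ (p - 2) <= B * r `^ (q - 2) + K.
Proof.
move=> B0; have [A0|A0] := leP A 0.
  exists 0 => // r r0; apply: (@le_trans _ _ 0).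
    by rewrite mulr_le0_ge0// powR_ge0.
  by rewrite addr0 mulr_ge0 ?powR_ge0// ltW.
have AB : 0 < A / B by rewrite divr_gt0.
have qp0 : q - p != 0 by rewrite subr_eq0 gt_eqF.
(* The point where A r^(p-2) and B r^(q-2) balance: beyond it the higher power wins, below it the
   lower one is at most its value there. *)
pose r0 := (A / B) `^ (q - p)^-1.
have r0E : r0 `^ (q - p) = A / B by rewrite /r0 -powRrM mulVf// powRr1// ltW.
have r00 : 0 < r0 by rewrite powR_gt0.
have p20 : 0 <= p - 2 by rewrite subr_ge0 ltW.
exists (A * r0 `^ (p - 2)) => [|r rge0]; first by rewrite mulr_ge0 ?powR_ge0// ltW.
have [rr0|rr0] := leP r r0.
  apply: ler_wpDl; first by rewrite mulr_ge0 ?powR_ge0// ltW.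
  by rewrite ler_wpM2l ?(ltW A0)//; apply: ge0_ler_powR; rewrite ?nnegrE// ltW.
apply: ler_wpDr; first by rewrite mulr_ge0 ?powR_ge0// ltW.
have rgt0 : r != 0 by rewrite gt_eqF// (lt_trans r00).
rewrite (_ : q - 2 = (q - p) + (p - 2)); last by ring.
rewrite [r `^ (q - p + (p - 2))]powRD ?rgt0 ?implybT// mulrA ler_wpM2r ?powR_ge0//.
rewrite -ler_pdivrMl// mulrC -r0E; apply: ge0_ler_powR; rewrite ?nnegrE.
- by rewrite subr_ge0 ltW.
- exact: ltW.
- by rewrite ltW// (lt_trans r00).
- exact: ltW.
Qed.

Variable mu : R.

Definition potential (s : R) : R := q^-1 * `|s| `^ q - mu / p * `|s| `^ p.

(** The potential plus a quadratic, as a function of r = |s|. Differentiating for r > 0 only keeps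
    away from the absolute value and from real powers at 0. *)
Definition psi (K r : R) : R := q^-1 * r `^ q - mu / p * r `^ p + K * r ^+ 2.
Definition dpsi (K r : R) : R := r `^ (q - 1) - mu * r `^ (p - 1) + 2 * K * r.
Definition ddpsi (K r : R) : R :=
  (q - 1) * r `^ (q - 2) - mu * (p - 1) * r `^ (p - 2) + 2 * K.

Lemma is_derive_psi (K r : R) : 0 < r -> is_derive r (1 : R) (psi K) (dpsi K r).
Proof.
move=> r0; have dq := is_derive1_powR q r0; have dp := is_derive1_powR p r0.
have d2 : is_derive r (1 : R) (fun r : R => r ^+ 2) (2 * r).
  have := @is_deriveX _ _ id 2 r 1 1 (is_derive_id _ _).
  rewrite (_ : id ^+ 2 = fun r : R => r ^+ 2); last by apply/funext => z; rewrite fctE.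
  by move=> /is_derive_eq; apply; rewrite expr1; exact: mulr1.
apply: (is_derive_eq (is_deriveD (is_deriveB (is_deriveZ q^-1 dq) (is_deriveZ (mu / p) dp)) (is_deriveZ K d2))).
rewrite /dpsi /GRing.scale/= mulKf ?gt_eqF ?(lt_trans _ q2)//.
rewrite mulrA divfK ?gt_eqF ?(lt_trans _ p2)//; ring.
Qed.

Lemma is_derive_dpsi (K r : R) : 0 < r -> is_derive r (1 : R) (dpsi K) (ddpsi K r).
Proof.
move=> r0; have dq := is_derive1_powR (q - 1) r0; have dp := is_derive1_powR (p - 1) r0.
apply: (is_derive_eq (is_deriveD (is_deriveB dq (is_deriveZ mu dp)) (is_deriveZ (2 * K) (is_derive_id r (1 : R))))).
rewrite /ddpsi /GRing.scale/= mulr1 (_ : q - 1 - 1 = q - 2); last by ring.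
rewrite (_ : p - 1 - 1 = p - 2); last by ring.
by rewrite mulrA.
Qed.

Lemma psi0 (K : R) : psi K 0 = 0.
Proof.
rewrite /psi !powR0 ?gt_eqF ?(lt_trans _ q2) ?(lt_trans _ p2)//.
by rewrite expr0n !mulr0 subr0 addr0.
Qed.

Lemma psi_continuous_gt0 (K r : R) : 0 < r -> {for r, continuous (psi K)}.
Proof.
move=> r0; apply/differentiable_continuous/derivable1_diffP.
by have [] := is_derive_psi K r0.
Qed.

(** Serves the endpoint r = 0 of the convexity criterion, which the derivative formulas do not
    reach. *)
Lemma psi_cvg_right (K r : R) : 0 <= r -> psi K @ r^'+ --> psi K r.
Proof.
rewrite le_eqVlt => /predU1P[<-|r0]; last exact/cvg_at_right_filter/psi_continuous_gt0.
rewrite psi0 [X in _ --> X](_ : 0 = q^-1 * 0 - mu / p * 0 + K * 0 ^+ 2 :> R); last by rewrite expr0n/=; ring.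
apply: cvgD; last first.
  by apply: cvgMl_tmp; apply/cvg_at_right_filter; exact: exprn_continuous.
by apply: cvgB; apply: cvgMl_tmp; exact: powR_cvg0.
Qed.

Lemma psi_convex_ge0 (K : R) : (forall r : R, 0 <= r -> 0 <= ddpsi K r) ->
  forall a b th : R, 0 <= a -> 0 <= b -> 0 <= th -> th <= 1 ->
  psi K ((1 - th) * a + th * b) <= (1 - th) * psi K a + th * psi K b.
Proof.
move=> H.
have key (a b : R) (t : {i01 R}) : 0 <= a -> a < b ->
    psi K (conv t (a : R^o) (b : R^o)) <= conv t (psi K a : R^o) (psi K b : R^o).
  move=> a0 ab; have b0 := le_lt_trans a0 ab.
  have gt0 x : x \in `]a, b[ -> 0 < x.
    by rewrite in_itv/= => /andP[ax _]; exact: le_lt_trans ax.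
  have dE x : a < x < b -> 'D_1 (psi K) x = dpsi K x.
    by move=> /andP[ax _]; have [] := is_derive_psi K (le_lt_trans a0 ax).
  have ddE x : a < x < b -> is_derive x (1 : R) ('D_1 (psi K)) (ddpsi K x).
    move=> /andP[ax xb]; apply: near_eq_is_derive (is_derive_dpsi K (le_lt_trans a0 ax)).
    have : x \in `]a, b[ by rewrite in_itv/= ax.
    move=> /near_in_itvoo; apply: filterS => y; rewrite in_itv/= => yab.
    by rewrite dE.
  apply: second_derivative_convex.
  - by move=> x xab; have [_ ->] := ddE x xab; apply: H; case/andP: xab => ax _; rewrite ltW// (le_lt_trans a0).
  - exact/cvg_at_left_filter/psi_continuous_gt0.
  - exact: psi_cvg_right.
  - by move=> x /gt0 x0; have [] := is_derive_psi K x0.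
  - by move=> x; rewrite in_itv/= => xab; have [] := ddE x xab.
  - exact: ltW.
move=> a b th a0 b0 th0 th1.
have [ab|ba|->] := ltgtP a b.
- have t0 : 0 <= 1 - th by rewrite subr_ge0.
  have t1 : 1 - th <= 1 by rewrite gerBl.
  have := key a b (Itv01 t0 t1) a0 ab; rewrite !convRE/= /unstable.onem.
  by rewrite opprB addrCA subrr addr0.
- have := key b a (Itv01 th0 th1) b0 ba; rewrite !convRE/= /unstable.onem.
  by rewrite addrC [leRHS]addrC.
- by rewrite -!mulrDl subrK !mul1r.
Qed.

(** With [K1] the function psi is convex on the half-line, with [K2] it is nonnegative. Together
    with psi(0) = 0 this makes it nondecreasing, hence psi(|s|) is convex on the whole line. The
    error is linear in [th], so that it survives as one term of the first variation. *)
Lemma potential_semiconvex : exists2 K : R, 0 <= K &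
  forall a b th, 0 <= th -> th <= 1 ->
  potential ((1 - th) * a + th * b) <=
    (1 - th) * potential a + th * potential b + K * th * (b - a) ^+ 2.
Proof.
have q1 : 0 < q - 1 by rewrite subr_gt0 (lt_trans _ q2)// ltr1n.
have qi : 0 < q^-1 by rewrite invr_gt0 (lt_trans _ q2).
have [K1 K10 H1] := powR_absorb (mu * (p - 1)) q1.
have [K2 K20 H2] := powR_absorb (mu / p) qi.
pose K := K1 + K2.
have K0 : 0 <= K by rewrite addr_ge0.
have dd0 r : 0 <= r -> 0 <= ddpsi K r.
  by move=> r0; have := H1 r r0; rewrite /ddpsi /K; lra.
have psi_ge0 r : 0 <= r -> 0 <= psi K r.
  move=> r0; rewrite /psi.
  have e (s : R) : 2 < s -> r `^ s = r `^ (s - 2) * r ^+ 2.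
    move=> s2; have [->|rn0] := eqVneq r 0.
      by rewrite expr0n mulr0 powR0// gt_eqF// (lt_trans _ s2).
    by rewrite -powR_mulrn// -powRD ?rn0 ?implybT// subrK.
  rewrite (e q q2) (e p p2).
  rewrite (_ : _ + _ = (q^-1 * r `^ (q - 2) - mu / p * r `^ (p - 2) + K) * r ^+ 2); last by ring.
  by rewrite mulr_ge0 ?sqr_ge0//; have := H2 r r0; rewrite /K; lra.
(* Convexity between 0 and y gives psi(x) <= (x / y) psi(y), and psi(y) >= 0. *)
have mono x y : 0 <= x -> x <= y -> psi K x <= psi K y.
  move=> x0 xy; have [y0|y0] := eqVneq y 0.
    by rewrite y0 in xy *; rewrite (_ : x = 0)//; apply/eqP; rewrite eq_le xy.
  have ygt0 : 0 < y by rewrite lt_neqAle eq_sym y0 (le_trans x0).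
  have t0 : 0 <= x / y by rewrite divr_ge0// ltW.
  have t1 : x / y <= 1 by rewrite ler_pdivrMr// mul1r.
  have := @psi_convex_ge0 K dd0 0 y (x / y) (lexx _) (ltW ygt0) t0 t1.
  rewrite mulr0 add0r divfK// psi0 mulr0 add0r => /le_trans; apply.
  by rewrite ler_piMl// psi_ge0// ltW.
have potE s : potential s = psi K `|s| - K * s ^+ 2.
  by rewrite /potential /psi real_normK ?num_real// addrK.
exists K => // a b th th0 th1; rewrite !potE.
have th1' : 0 <= 1 - th by rewrite subr_ge0.
have h1 : psi K `|(1 - th) * a + th * b| <= (1 - th) * psi K `|a| + th * psi K `|b|.
  apply: le_trans (psi_convex_ge0 dd0 (normr_ge0 a) (normr_ge0 b) th0 th1).
  apply: mono => //; apply: le_trans (ler_normD _ _) _.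
  by rewrite !normrM (ger0_norm th0) (ger0_norm th1').
(* Subtracting K s^2 leaves exactly K th (1 - th) (b - a)^2, which is below the claimed error by
   this amount. *)
have h2 : 0 <= K * th ^+ 2 * (b - a) ^+ 2.
  by apply: mulr_ge0; [apply: mulr_ge0 => //|]; exact: sqr_ge0.
rewrite -subr_ge0.
rewrite (_ : _ - _ = ((1 - th) * psi K `|a| + th * psi K `|b| - psi K `|(1 - th) * a + th * b|) + K * th ^+ 2 * (b - a) ^+ 2); last by ring.
by apply: addr_ge0 => //; rewrite subr_ge0.
Qed.

End potential.

(** * Inner variations of the energy *)

(** Quotients from the right suffice to bound a derivative known to exist. It serves twice: for the
    energy in t, and for the scaling factor in r - 1, whose admissible range explains 1/2. *)
Lemma derive_le_of_upper_bound {R : realType} (f : R -> R) (d0 a b : R) :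
  is_derive (0 : R) (1 : R) f d0 ->
  (forall t, 0 < t -> t <= 2^-1 -> f t <= f 0 + t * a + t ^+ 2 * b) -> d0 <= a.
Proof.
move=> [df dE] H.
have c1 : (fun h : R => h^-1 *: ((f \o shift 0) (h *: (1 : R)) - f 0)) @ 0^'+ --> d0.
  by apply: cvg_dnbhs_at_right; rewrite -dE; exact: df.
have c2 : (fun h : R => a + h * b) @ 0^'+ --> a.
  rewrite -[X in _ --> X]addr0 -[X in _ --> _ + X](mul0r b); apply: cvgD; first exact: cvg_cst.
  by apply: cvgMr_tmp; apply: cvg_at_right_filter; exact: cvg_id.
apply: (ler_cvg_to c1 c2); near=> h.
have h0 : 0 < h by near: h; exact: nbhs_right_gt.
have h1 : h <= 2^-1 by near: h; apply: nbhs_right_le; rewrite invr_gt0.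
have hE : h *: (1 : R) = h by exact: mulr1.
rewrite /= hE addr0 /GRing.scale/= ler_pdivrMl//.
have := H h h0 h1; rewrite expr2 => Hh; lra.
Unshelve. all: by end_near.
Qed.

Section Lfun_power.
Context d (T : measurableType d) {R : realType} (mu : {measure set T -> \bar R}).

Lemma LfunP_integrable (f : T -> R) (r : R) : 1 <= r ->
  (f \in Lfun mu r%:E) <->
  (measurable_fun setT f /\ mu.-integrable setT (fun x => (`|f x| `^ r)%:E)).
Proof.
move=> r1; split=> [fL|[mf fi]].
  split; last exact: Lfun_integrable.
  by move: fL; rewrite inE => /andP[/[!inE]/= mf _].
rewrite inE; apply/andP; split; rewrite inE//=.
rewrite /finite_norm unlock poweR_lty//.
have /integrableP[_] := fi; apply: le_lt_trans.
rewrite le_eqVlt; apply/orP; left; apply/eqP; apply: eq_integral => x _.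
by rewrite [RHS]gee0_abs// lee_fin powR_ge0.
Qed.

Lemma Lfun2P (f : T -> R) :
  (f \in Lfun mu 2%:E) <->
  (measurable_fun setT f /\ mu.-integrable setT (fun x => (f x ^+ 2)%:E)).
Proof.
rewrite LfunP_integrable ?ler1n//.
have e : (fun x => (`|f x| `^ 2)%:E) = (fun x => (f x ^+ 2)%:E).
  by apply/funext => x; rewrite (powR_mulrn 2)// real_normK// num_real.
by rewrite e.
Qed.

Lemma integrable_le (f g : T -> R) : measurable_fun setT f ->
  mu.-integrable setT (fun x => (g x)%:E) -> (forall x, `|f x| <= g x) ->
  mu.-integrable setT (fun x => (f x)%:E).
Proof.
move=> mf ig fg; apply: (le_integrable _ _ _ ig) => //; first exact/measurable_EFinP.
by move=> x _; rewrite lee_fin (le_trans (fg x))// ler_norm.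
Qed.

Lemma Lfun_le (f g : T -> R) (r : R) : 1 <= r -> measurable_fun setT f ->
  g \in Lfun mu r%:E -> (forall x, `|f x| <= `|g x|) -> f \in Lfun mu r%:E.
Proof.
move=> r1 mf /(LfunP_integrable _ r1)[mg ig] fg; apply/(LfunP_integrable _ r1).
split=> //; apply: (integrable_le _ ig).
  by apply: (measurableT_comp (measurable_powR r)); exact: measurableT_comp.
move=> x; rewrite ger0_norm ?powR_ge0//; apply: ge0_ler_powR; rewrite ?nnegrE//.
by rewrite (le_trans _ r1).
Qed.

Lemma LfunD (f g : T -> R) (r : R) : 1 <= r ->
  f \in Lfun mu r%:E -> g \in Lfun mu r%:E -> (fun x => f x + g x) \in Lfun mu r%:E.
Proof. by move=> r1 fL gL; have [_] := @Lfun_addr_closed _ _ _ mu r%:E r1; apply. Qed.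

Lemma LfunZ (f : T -> R) (a r : R) : 1 <= r ->
  f \in Lfun mu r%:E -> (fun x => a * f x) \in Lfun mu r%:E.
Proof.
move=> r1 /(@Lfun_scale _ _ _ mu f a r r1).
by rewrite (_ : a \o* f = (fun x => a * f x))//; apply/funext => x /=; rewrite mulrC.
Qed.

End Lfun_power.

(** * Functions of finite energy and the operations that preserve them *)

Section energy_space.
Context {R : realType} {N : nat}.
Local Notation E := 'rV[R]_N.
Local Notation leb := (@lebesgue_rV R N).
Implicit Types (u v : E -> R) (g h : E -> E).

(** Since [wgrad] is chosen by [get], a computed gradient agrees with it only almost everywhere;
    this is enough under the integral. *)
Lemma wgrad_ae v h : is_weak_gradient v h ->
  is_weak_gradient v (wgrad v) /\ {ae leb, forall x, wgrad v x = h x}.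
Proof.
move=> vh; have vw : is_weak_gradient v (wgrad v) by apply: (@getPex _ (is_weak_gradient v)); exists h.
by split=> //; exact: weak_gradient_unique vw vh.
Qed.

Lemma measurable_weak_function v h : is_weak_gradient v h -> measurable_fun setT v.
Proof. by move=> [[]]. Qed.

Variables (p q mu : R) (p2 : 2 < p) (pq : p < q) (qc : q < crit_exp R N).

Let p1 : 1 <= p. Proof. by have := p2; lra. Qed.
Let q1 : 1 <= q. Proof. by have := p2; have := pq; lra. Qed.
Let c1 : 1 <= crit_exp R N. Proof. by have := p2; have := pq; have := qc; lra. Qed.

Local Notation pot := (potential p q mu).

Lemma measurable_potential d (T : measurableType d) (f : T -> R) :
  measurable_fun setT f -> measurable_fun setT (fun x => pot (f x)).
Proof.
move=> mf; apply: measurable_funB; apply: measurable_funM => //.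
  by apply: (measurableT_comp (measurable_powR q)); exact: measurableT_comp.
by apply: (measurableT_comp (measurable_powR p)); exact: measurableT_comp.
Qed.

(** [Dspace] with the weak gradient as an explicit argument in place of [wgrad], so that gradients
    of dilates, sums and cut-off functions can be handled by formulas. *)
Definition finite_energy v h := [/\ is_weak_gradient v h,
  forall i, (fun x => h x ord0 i) \in Lfun leb 2%:E,
  v \in Lfun leb (crit_exp R N)%:E, v \in Lfun leb q%:E & v \in Lfun leb p%:E].

Lemma Dspace_finite_energy v : Dspace p q v -> finite_energy v (wgrad v).
Proof. by move=> [[? ? ?] ? ?]; split. Qed.

Lemma finite_energy_Dspace v h : finite_energy v h -> Dspace p q v.
Proof.
move=> [vh hL vc vq vp]; have [vw vae] := wgrad_ae vh.
split=> //; split=> // i; apply/Lfun2P.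
have /Lfun2P[mh ih] := hL i.
have mw : measurable_fun setT (fun x => wgrad v x ord0 i) by exact: measurable_weak_gradient vw i.
split=> //; apply/integrableP; split; first by apply/measurable_EFinP; exact: measurable_funX.
have /integrableP[_] := ih; apply: le_lt_trans.
rewrite le_eqVlt; apply/orP; left; apply/eqP; apply: ge0_ae_eq_integral => //.
- by apply: measurableT_comp => //; apply/measurable_EFinP; exact: measurable_funX.
- by apply: measurableT_comp => //; apply/measurable_EFinP; exact: measurable_funX.
- by apply: filterS vae => x -> _.
Qed.

Lemma integrable_enorm_sqr v h : finite_energy v h ->
  leb.-integrable setT (fun x => (enorm (h x) ^+ 2)%:E).
Proof.
move=> [_ hL _ _ _].
have [+ _] := @Rintegral_sum _ _ R leb _ (index_enum 'I_N) (fun i x => h x ord0 i ^+ 2) (fun i => ((Lfun2P _ _).1 (hL i)).2).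
by apply: eq_integrable => // x _ /=; rewrite enorm_sqr.
Qed.

Lemma integrable_potential v h : finite_energy v h ->
  leb.-integrable setT (fun x => (pot (v x))%:E).
Proof.
move=> [_ _ _ vq vp].
have iq := integrableZl measurableT q^-1 (Lfun_integrable q1 vq).
have ip := integrableZl measurableT (mu / p) (Lfun_integrable p1 vp).
by have := integrableB measurableT iq ip; exact: eq_integrable.
Qed.

Definition energy_density v h x := 2^-1 * enorm (h x) ^+ 2 + pot (v x).

Lemma integrable_energy_density v h : finite_energy v h ->
  leb.-integrable setT (EFin \o energy_density v h).
Proof.
move=> vh; have := integrableD measurableT (integrableZl measurableT 2^-1 (integrable_enorm_sqr vh)) (integrable_potential vh).
exact: eq_integrable.
Qed.

Lemma energyE v h : finite_energy v h ->
  energy mu p q v = \int[leb]_x energy_density v h x.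
Proof.
move=> vh; have [vw vae] : is_weak_gradient v (wgrad v) /\ {ae leb, forall x, wgrad v x = h x}.
  by case: vh => vh _ _ _ _; exact: wgrad_ae.
rewrite (_ : energy mu p q v = \int[leb]_x energy_density v (wgrad v) x); last first.
  by apply: eq_Rintegral => x _; rewrite /energy_density /potential; ring.
have mv := measurable_weak_function vw.
have m g : is_weak_gradient v g -> measurable_fun setT (energy_density v g).
  move=> vg; apply: measurable_funD; last exact: measurable_potential.
  apply: measurable_funM => //; apply: measurable_funX; exact: measurable_S vg.
congr fine; apply: ae_eq_integral => //.
- by apply/measurable_EFinP; exact: m.
- by apply/measurable_EFinP; apply: m; case: vh.
- by apply: filterS vae => x e _; rewrite /energy_density e.
Qed.

Lemma finite_energyD u g v h t : finite_energy u g -> finite_energy v h ->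
  finite_energy (fun x => u x + t * v x) (fun x => g x + t *: h x).
Proof.
move=> [ug gL uc uq up] [vh hL vc vq vp]; split.
- exact: weak_gradientD.
- move=> i; rewrite (_ : (fun _ => _) = (fun x => g x ord0 i + t * h x ord0 i)).
    by apply: LfunD => //; [rewrite ler1n|apply: LfunZ => //; rewrite ler1n].
  by apply/funext => x; rewrite !mxE.
- by apply: LfunD => //; exact: LfunZ.
- by apply: LfunD => //; exact: LfunZ.
- by apply: LfunD => //; exact: LfunZ.
Qed.

Lemma Lfun_scaling (f : E -> R) (r c : R) : 1 <= r -> 0 < c ->
  f \in Lfun leb r%:E -> (fun x => f (c *: x)) \in Lfun leb r%:E.
Proof.
move=> r1 c0 /(LfunP_integrable _ _ r1)[mf fi]; apply/(LfunP_integrable _ _ r1).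
by split; [exact: measurable_fun_scale|exact: (integrable_scale c0 fi)].
Qed.

Lemma finite_energy_scale u g c : 0 < c -> finite_energy u g ->
  finite_energy (fun x => u (c *: x)) (fun x => c *: g (c *: x)).
Proof.
move=> c0 [ug gL uc uq up]; split.
- exact: weak_gradient_scale.
- move=> i; rewrite (_ : (fun _ => _) = (fun x => c * g (c *: x) ord0 i)).
    by apply: LfunZ; [rewrite ler1n|apply: (Lfun_scaling _ c0 (gL i)); rewrite ler1n].
  by apply/funext => x; rewrite !mxE.
- exact: Lfun_scaling.
- exact: Lfun_scaling.
- exact: Lfun_scaling.
Qed.

(** The integrability of u grad chi is left as a hypothesis: for the difference of dilates it is
    supplied by [int_sqr_le]. *)
Lemma finite_energyM u g (chi : E -> R) : smooth chi -> (forall x, 0 <= chi x) ->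
  (forall x, chi x <= 1) ->
  (forall i, leb.-integrable setT (fun x => ((u x * pderive i chi x) ^+ 2)%:E)) ->
  finite_energy u g ->
  finite_energy (fun x => chi x * u x) (fun x => chi x *: g x + u x *: grad chi x).
Proof.
move=> schi chi0 chi1 iu [ug gL uc uq up].
have mchi := continuous_measurable_rV (smooth_continuous schi).
have mu' := measurable_weak_function ug.
have mm : measurable_fun setT (fun x => chi x * u x) by exact: measurable_funM.
have le (f : E -> R) x : `|chi x * f x| <= `|f x|.
  by rewrite normrM ler_piMl// ger0_norm.
split.
- exact: weak_gradientM.
- move=> i; rewrite (_ : (fun _ => _) = (fun x => chi x * g x ord0 i + u x * pderive i chi x)); last first.
    by apply/funext => x; rewrite !mxE.
  apply: LfunD; first by rewrite ler1n.
    apply: (Lfun_le _ _ (gL i)); first by rewrite ler1n.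
      by apply: measurable_funM => //; exact: measurable_weak_gradient ug i.
    exact: (le (fun x => g x ord0 i)).
  apply/Lfun2P; split => //; apply: measurable_funM => //.
  by apply: continuous_measurable_rV; apply: smooth_continuous; exact: smooth_pderive.
- exact: (Lfun_le c1 mm uc (le u)).
- exact: (Lfun_le q1 mm uq (le u)).
- exact: (Lfun_le p1 mm up (le u)).
Qed.

End energy_space.

Lemma continuous_sum_norm {R : realType} {T : topologicalType} (J : Type) (s : seq J)
    (F : J -> T -> R) : (forall j, continuous (F j)) ->
  continuous (fun x => \sum_(j <- s) `|F j x|).
Proof.
move=> cF; elim: s => [|j s IH] x.
  by under eq_fun do rewrite big_nil; exact: cst_continuous.
under eq_fun do rewrite big_cons.
apply: (@continuousD _ _ _ (fun x => `|F j x|)); last exact: IH.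
by apply: (@continuous_comp _ _ _ (F j) (fun r : R => `|r|)); [exact: cF|exact: norm_continuous].
Qed.

Section inner_variation.
Context {R : realType} {N : nat}.
Local Notation E := 'rV[R]_N.
Local Notation leb := (@lebesgue_rV R N).
Variables (p q mu : R) (p2 : 2 < p) (pq : p < q) (qc : q < crit_exp R N).
Variables (u : E -> R) (g : E -> E) (ug : finite_energy p q u g).
Variables (chi : E -> R) (M : R) (tchi : tame chi) (schi : supp_in M chi).
Variables (chi0 : forall x, 0 <= chi x) (chi1 : forall x, chi x <= 1).
Variables (rho : R) (rho1 : `|rho - 1| <= 2^-1).

Let rho0 : 0 < rho. Proof. by have := rho1; rewrite ler_norml => /andP[? ?]; lra. Qed.
Let rhoV0 : 0 < rho^-1. Proof. by rewrite invr_gt0. Qed.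

Local Notation pot := (potential p q mu).

Definition dil (x : E) : R := u (rho^-1 *: x).
Definition dilg (x : E) : E := rho^-1 *: g (rho^-1 *: x).
(** The form u + t v with t = -1 matches [finite_energyD]. *)
Definition dilw (x : E) : R := dil x + (-1) * u x.
Definition dilwg (x : E) : E := dilg x + (-1) *: g x.
Definition varv (x : E) : R := chi x * dilw x.
Definition varh (x : E) : E := chi x *: dilwg x + dilw x *: grad chi x.
(** The l1 norm of the gradient of the cutoff. It bounds the pairing with [g] coordinate by
    coordinate and scales simply under dilation. *)
Definition eta (x : E) : R := \sum_i `|pderive i chi x|.

Let wg : is_weak_gradient u g. Proof. by case: ug. Qed.

Lemma finite_energy_dil : finite_energy p q dil dilg.
Proof. exact: finite_energy_scale. Qed.

Lemma finite_energy_dilw : finite_energy p q dilw dilwg.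
Proof. exact: finite_energyD finite_energy_dil ug. Qed.

Lemma dilwE x : dilw x = u (rho^-1 *: x) - u x.
Proof. by rewrite /dilw mulN1r. Qed.

Lemma measurable_dilw : measurable_fun setT dilw.
Proof. by apply: measurable_weak_function (dilwg) _; case: finite_energy_dilw. Qed.

Lemma norm_continuous_rV : continuous (fun x : E => `|x|).
Proof. exact: norm_continuous. Qed.

(** Compact support makes k |x|^2 bounded, so the radial estimate reduces the claim to the square
    integrability of the gradient. *)
Lemma integrable_cutoff_sqr (k : E -> R) : continuous k -> supp_in M k ->
  (forall x, 0 <= k x) -> leb.-integrable setT (fun x => (k x * dilw x ^+ 2)%:E).
Proof.
move=> ck sk k0; have mk := continuous_measurable_rV ck.
have [B B0 HB] : exists2 B, 0 < B & forall x, `|k x * `|x| ^+ 2| <= B.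
  apply: (@supp_in_bounded R N M); last by apply: supp_inMr.
  move=> x; apply: (@continuousM _ _ k (fun x : E => `|x| ^+ 2)); first exact: ck.
  apply: (@continuous_comp _ _ _ (fun x : E => `|x|) (fun r : R => r ^+ 2)); first exact: norm_continuous_rV.
  exact: exprn_continuous.
have kB x : k x * `|x| ^+ 2 <= B by exact: le_trans (ler_norm _) (HB x).
apply/integrableP; split.
  by apply/measurable_EFinP; apply: measurable_funM => //; apply: measurable_funX; exact: measurable_dilw.
have := int_sqr_le wg rho1 mk k0 (ltW B0) kB.
rewrite (_ : (\int[leb]_x (k x * (u (rho^-1 *: x) - u x) ^+ 2)%:E = \int[leb]_x `|(k x * dilw x ^+ 2)%:E|)%E).
  move=> /le_lt_trans; apply.
  apply: lte_mul_pinfty => //; last exact: (integrable_lty measurableT (integrable_enorm_sqr ug)).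
  rewrite lee_fin; apply: mulr_ge0; last exact: sqr_ge0.
  by rewrite !mulr_ge0 ?exprn_ge0 ?ler0n ?(ltW B0).
by apply: eq_integral => x _; rewrite dilwE [RHS]gee0_abs// lee_fin mulr_ge0// sqr_ge0.
Qed.

Lemma finite_energy_varv : finite_energy p q varv varh.
Proof.
apply: finite_energyM => //; [exact: tame_smooth| |exact: finite_energy_dilw].
move=> i; have td := tame_pderive i tchi.
have := @integrable_cutoff_sqr (fun x => pderive i chi x * pderive i chi x).
move=> /(_ (tame_continuous (tame_mul td td)) (supp_inMl _ (supp_in_pderive i schi))).
have h x : 0 <= pderive i chi x * pderive i chi x by rewrite -expr2 sqr_ge0.
move=> /(_ h); apply: eq_integrable => // x _; congr EFin; ring.
Qed.

Lemma continuous_eta : continuous eta.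
Proof. by apply: continuous_sum_norm => i; apply: tame_continuous; exact: tame_pderive. Qed.

Lemma eta_ge0 x : 0 <= eta x.
Proof. by apply: sumr_ge0. Qed.

Lemma supp_eta : supp_in M eta.
Proof.
by move=> x xM; rewrite /eta big1// => i _; rewrite (supp_in_pderive i schi)// normr0.
Qed.

Variable K : R.

(* Upper bound for the first variation along [varv]: since [u + t * varv] is
   pointwise a convex combination of [u] and its dilate, only the semiconvexity
   of the potential is needed, not its derivative. *)
Definition variation_bound (x : E) : R :=
  chi x * (energy_density p q mu dil dilg x - energy_density p q mu u g x) +
  eta x * (`|dilw x| * enorm (g x)) + K * (chi x * dilw x ^+ 2).

Lemma measurable_chi : measurable_fun setT chi.
Proof. by apply: continuous_measurable_rV; exact: tame_continuous. Qed.

Lemma integrable_chiM (f : E -> R) : leb.-integrable setT (EFin \o f) ->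
  leb.-integrable setT (EFin \o (fun x => chi x * f x)).
Proof.
move=> fi; apply: (le_integrable _ _ _ fi) => //.
  apply/measurable_EFinP; apply: measurable_funM; first exact: measurable_chi.
  by apply/measurable_EFinP; exact: measurable_int fi.
by move=> x _; rewrite lee_fin normrM ler_piMl// ger0_norm.
Qed.

Lemma integrable_eta_mul :
  leb.-integrable setT (EFin \o (fun x => eta x * (`|dilw x| * enorm (g x)))).
Proof.
have ce := continuous_eta.
have i1 : leb.-integrable setT (fun x => ((eta x * eta x) * dilw x ^+ 2)%:E).
  apply: integrable_cutoff_sqr.
  - by move=> x; apply: (@continuousM _ _ eta eta); exact: ce.
  - by apply: supp_inMl; exact: supp_eta.
  - by move=> x; rewrite mulr_ge0// eta_ge0.
have i2 := integrable_enorm_sqr ug.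
have i3 := integrableD measurableT i1 i2.
apply: (integrable_le _ i3).
  apply: measurable_funM; first exact: continuous_measurable_rV.
  apply: measurable_funM; first by apply: measurableT_comp => //; exact: measurable_dilw.
  exact: measurable_S wg.
move=> x; rewrite ger0_norm; last by rewrite !mulr_ge0 ?eta_ge0 ?enorm_ge0.
rewrite -(real_normK (num_real (dilw x))) -subr_ge0.
set a := eta x; set b := `|dilw x|; set c := enorm (g x).
(* A weak form of Young's inequality, a b c <= (a b)^2 + c^2, written as a sum of squares. *)
rewrite (_ : _ - _ = 2^-1 * ((a * b - c) ^+ 2 + (a * b) ^+ 2 + c ^+ 2)); last by field.
by rewrite mulr_ge0// !addr_ge0// sqr_ge0.
Qed.

Lemma integrable_density_diff : leb.-integrable setT
  (EFin \o (fun x => energy_density p q mu dil dilg x - energy_density p q mu u g x)).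
Proof.
by have := integrableB measurableT (integrable_energy_density mu p2 pq finite_energy_dil)
  (integrable_energy_density mu p2 pq ug); exact: eq_integrable.
Qed.

Lemma integrable_chi_sqr : leb.-integrable setT (EFin \o (fun x => chi x * dilw x ^+ 2)).
Proof. by apply: integrable_cutoff_sqr => //; exact: tame_continuous. Qed.

Lemma integrable_variation_bound : leb.-integrable setT (EFin \o variation_bound).
Proof.
have i1 := integrable_chiM integrable_density_diff.
have i3 := integrableZl measurableT K integrable_chi_sqr.
by have := integrableD measurableT (integrableD measurableT i1 integrable_eta_mul) i3; exact: eq_integrable.
Qed.

Hypothesis HK : forall a b th, 0 <= th -> th <= 1 ->
  pot ((1 - th) * a + th * b) <= (1 - th) * pot a + th * pot b + K * th * (b - a) ^+ 2.

Lemma energy_density_variation_le t x : 0 <= t -> t <= 1 ->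
  energy_density p q mu (fun x => u x + t * varv x) (fun x => g x + t *: varh x) x <=
  energy_density p q mu u g x + t * variation_bound x + t ^+ 2 * (2^-1 * enorm (varh x) ^+ 2).
Proof.
move=> t0 t1.
have th0 : 0 <= t * chi x by rewrite mulr_ge0.
have th1 : t * chi x <= 1 by rewrite mulr_ile1.
have hpot := HK (u x) (dil x) th0 th1.
rewrite (_ : (1 - t * chi x) * u x + t * chi x * dil x = u x + t * varv x) in hpot; last first.
  by rewrite /varv /dilw; ring.
(* Convexity of the square, a (b - a) <= b^2 / 2 - a^2 / 2, turns the first variation of the
   gradient term into a difference of densities; the gradient of [chi] leaves the [eta] term. *)
have hgrad : \sum_i g x ord0 i * varh x ord0 i <=
    chi x * (2^-1 * enorm (dilg x) ^+ 2 - 2^-1 * enorm (g x) ^+ 2) +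
    eta x * (`|dilw x| * enorm (g x)).
  rewrite !enorm_sqr !mulr_sumr -sumrB mulr_sumr /eta mulr_suml -big_split/=.
  apply: ler_sum => i _; rewrite !mxE.
  set a := g x ord0 i; set b := rho^-1 * _; set D := pderive i chi x.
  have h1 : dilw x * D * a <= `|D| * (`|dilw x| * enorm (g x)).
    apply: le_trans (ler_norm _) _; rewrite !normrM (mulrC `|dilw x|) -mulrA.
    by rewrite ler_wpM2l// ler_wpM2l// coord_le_enorm.
  have h2 : 0 <= chi x * (2^-1 * (a - b) ^+ 2).
    by apply: mulr_ge0 => //; apply: mulr_ge0; rewrite ?sqr_ge0.
  rewrite (_ : a * _ = chi x * (2^-1 * b ^+ 2 - 2^-1 * a ^+ 2) - chi x * (2^-1 * (a - b) ^+ 2) + dilw x * D * a); last by field.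
  by rewrite lerD// gerBl.
(* The gradient part is expanded exactly, which is where the t^2 term comes from. *)
have eE : enorm (g x + t *: varh x) ^+ 2 = enorm (g x) ^+ 2 +
    t * (2 * \sum_i g x ord0 i * varh x ord0 i) + t ^+ 2 * enorm (varh x) ^+ 2.
  rewrite !enorm_sqr !mulr_sumr -!big_split/=; apply: eq_bigr => i _.
  by rewrite !mxE; ring.
rewrite /energy_density eE /variation_bound /energy_density /=.
have := ler_wpM2l t0 hgrad.
move: hpot; rewrite (_ : dil x - u x = dilw x); last by rewrite dilwE.
move: (\sum_i _) (enorm _ ^+ 2) (enorm _ ^+ 2) (enorm (varh x) ^+ 2) => s1 s2 s3 s4.
move: (pot _) (pot _) (pot _) => a1 a2 a3 h1 h2.
nra.
Qed.

Lemma inner_variation_ge0 : (forall v, Dspace p q v ->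
    is_derive (0 : R) (1 : R) (fun t : R => energy mu p q (fun x => u x + t * v x)) 0) ->
  0 <= \int[leb]_x variation_bound x.
Proof.
move=> /(_ _ (finite_energy_Dspace finite_energy_varv)) D.
apply: (derive_le_of_upper_bound (b := \int[leb]_x (2^-1 * enorm (varh x) ^+ 2)) D) => t t0 t1.
have fe s := finite_energyD p2 pq qc s ug finite_energy_varv.
rewrite !(energyE mu (fe _)).
have -> : \int[leb]_x energy_density p q mu (fun x => u x + 0 * varv x) (fun x => g x + 0 *: varh x) x =
  \int[leb]_x energy_density p q mu u g x.
  by apply: eq_Rintegral => x _; rewrite /energy_density scale0r addr0 mul0r addr0.
have i1 := integrable_energy_density mu p2 pq ug.
have i2 := integrable_variation_bound.
have i3 := integrableZl measurableT 2^-1 (integrable_enorm_sqr finite_energy_varv).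
rewrite -!RintegralZl// -!RintegralD//; last 3 first.
- exact: (integrableD measurableT i1 (integrableZl measurableT t i2)).
- exact: (integrableZl measurableT (t ^+ 2) i3).
- exact: (integrableZl measurableT t i2).
apply: le_Rintegral => //.
- exact: integrable_energy_density (fe t).
- exact: (integrableD measurableT (integrableD measurableT i1 (integrableZl measurableT t i2)) (integrableZl measurableT (t ^+ 2) i3)).
- by move=> x _; apply: energy_density_variation_le; rewrite ?(ltW t0)//; lra.
Qed.

End inner_variation.

(** * The Pohozaev and Nehari identities *)

(** Dominated convergence for dilated weights: [kappa] is their value at the origin, positive for
    the cutoff and 0 for the error weight. *)
Lemma cvg_Rintegral_scaled d (T : measurableType d) {R : realType}
    (mu : {measure set T -> \bar R}) (phi : nat -> T -> R) (f : T -> R) (kappa : R) :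
  (forall n, measurable_fun setT (phi n)) -> (forall n x, `|phi n x| <= 1) ->
  (forall x, phi n x @[n --> \oo] --> kappa) ->
  mu.-integrable setT (EFin \o f) ->
  (fun n => \int[mu]_x (phi n x * f x)) @ \oo --> kappa * \int[mu]_x f x.
Proof.
move=> mphi phi1 cphi fi.
have mf : measurable_fun setT f by apply/measurable_EFinP; exact: measurable_int fi.
have iabs := integrable_abse fi.
have [|||||_ _ cv] := @dominated_convergence _ _ R mu setT measurableT
    (fun n x => (phi n x * f x)%:E) (fun x => (kappa * f x)%:E) (fun x => `|(f x)%:E|%E).
- by move=> n; apply/measurable_EFinP; exact: measurable_funM.
- by apply/measurable_EFinP; exact: measurable_funM.
- apply: aeW => x _; apply: cvg_EFin; first exact: nearW.
  have c : (fun n => phi n x * f x) @ \oo --> kappa * f x by apply: cvgMr_tmp; exact: cphi.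
  exact: c.
- exact: iabs.
- by apply: aeW => x n _; rewrite lee_fin normrM ler_piMl.
rewrite -RintegralZl//; apply: fine_cvg.
rewrite /Rintegral fineK//; apply: integrable_fin_num => //.
exact: (integrableZl measurableT kappa fi).
Qed.

Lemma Rintegral_le_scaled d (T : measurableType d) {R : realType}
    (mu : {measure set T -> \bar R}) (f h : T -> R) (c : R) :
  mu.-integrable setT (EFin \o f) -> mu.-integrable setT (EFin \o h) ->
  (\int[mu]_x (f x)%:E <= c%:E * \int[mu]_x (h x)%:E)%E ->
  \int[mu]_x f x <= c * \int[mu]_x h x.
Proof.
move=> fi hi; rewrite /Rintegral -lee_fin EFinM !fineK//; exact: integrable_fin_num.
Qed.

(** * Dilated cutoffs and the weight that controls their errors *)

Section cutoff.
Context {R : realType} {N : nat}.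
Local Notation E := 'rV[R]_N.
Variables (beta : E -> R) (M : R) (tbeta : tame beta) (sbeta : supp_in M beta).

(** A common majorant, up to constants, of the radial variation of [beta] and of |z| times the size
    of its gradient. It vanishes at 0, so its dilates tend to 0 pointwise, and it satisfies the
    doubling bound asked by [int_mul_le]. *)
Definition trunc (x : E) : R := Order.min 1 `|x|.

Lemma trunc_ge0 x : 0 <= trunc x.
Proof. by rewrite le_min ler01 normr_ge0. Qed.

Lemma trunc_le1 x : trunc x <= 1.
Proof. by rewrite ge_min lexx. Qed.

Lemma trunc_scale (r : R) x : 0 <= r -> r <= 2 -> trunc (r *: x) <= 2 * trunc x.
Proof.
move=> r0 r2; rewrite /trunc normrZ ger0_norm// minr_pMr// le_min !ge_min mulr1.
by rewrite ler1n/= ler_wpM2r ?orbT.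
Qed.

Lemma measurable_trunc : measurable_fun setT trunc.
Proof.
by apply: measurable_minr => //; exact: measurable_norm_rV.
Qed.

(** [C1] handles |z| <= 1, where the weight is |z|, and [C2] handles the rest, where it is 1. *)
Lemma eta_beta_le : exists2 Lam : R, 0 <= Lam &
  forall z, eta beta z * `|z| <= Lam * trunc z.
Proof.
have ce := continuous_eta tbeta; have se := supp_eta sbeta.
have [C1 C10 H1] := supp_in_bounded ce se.
have [C2 C20 H2] : exists2 C, 0 < C & forall z, `|eta beta z * `|z| | <= C.
  apply: (@supp_in_bounded R N M (fun z => eta beta z * `|z|)); last exact: supp_inMr.
  move=> x; apply: (@continuousM _ _ (eta beta) (fun x : E => `|x|)); first exact: ce.
  exact: norm_continuous.
exists (C1 + C2); first by rewrite addr_ge0 ?ltW.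
move=> z; rewrite /trunc /Order.min; case: ifPn => _.
  rewrite mulr1; apply: le_trans (ler_norm _) _; apply: le_trans (H2 z) _.
  by rewrite lerDr ltW.
rewrite ler_wpM2r//; apply: le_trans (ler_norm _) _; apply: le_trans (H1 z) _.
by rewrite lerDl ltW.
Qed.

(** The mean value theorem along the ray through z. One factor 2 bounds 1 / s in passing from |z| to
    |s z|, the other is the doubling of [trunc]. *)
Lemma beta_radial_lipschitz Lam : (forall z, eta beta z * `|z| <= Lam * trunc z) -> 0 <= Lam ->
  forall rho z, `|rho - 1| <= 2^-1 ->
  `|beta (rho *: z) - beta z| <= 4 * Lam * `|rho - 1| * trunc z.
Proof.
move=> HL L0.
pose f (z : E) (s : R) := beta (s *: z).
pose df (z : E) (s : R) := \sum_i z ord0 i * pderive i beta (s *: z).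
have fD z s : is_derive s (1 : R) (f z) (df z s) by exact: is_derive_radial.
have dfle z s : 2^-1 <= s -> s <= 2 -> `|df z s| <= 4 * Lam * trunc z.
  move=> s1 s2; have s0 : 0 < s by rewrite (lt_le_trans _ s1)// invr_gt0.
  apply: le_trans (ler_norm_sum _ _ _) _.
  apply: (@le_trans _ _ (2 * (eta beta (s *: z) * `|s *: z|))).
    rewrite normrZ gtr0_norm// /eta mulr_suml mulr_sumr; apply: ler_sum => i _.
    rewrite normrM mulrCA; set D := `|pderive i beta _|.
    have D0 : 0 <= D by exact: normr_ge0.
    have h : `|z ord0 i| <= 2 * s * `|z|.
      apply: (le_trans (coord_le_norm z i)); rewrite ler_peMl//.
      by move: s1; rewrite -(ler_pM2l (ltr0n R 2))// divff.
    by rewrite mulrC ler_wpM2l// mulrA.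
  apply: (@le_trans _ _ (2 * (Lam * trunc (s *: z)))); first by rewrite ler_wpM2l.
  have := trunc_scale z (ltW s0) s2 => h.
  apply: (@le_trans _ _ (2 * (Lam * (2 * trunc z)))).
    by rewrite ler_wpM2l// ler_wpM2l.
  by rewrite le_eqVlt; apply/orP; left; apply/eqP; ring.
move=> rho z r1; have [ra rb] : 2^-1 <= rho /\ rho <= 2.
  by move: r1; rewrite ler_norml => /andP[? ?]; split; lra.
have mvt a b : a < b -> 2^-1 <= a -> b <= 2 -> `|f z b - f z a| <= 4 * Lam * trunc z * (b - a).
  move=> ab a2 b2; have [|s] := @MVT R (f z) (df z) a b ab (fun s _ => fD z s).
    apply: continuous_subspaceT => s; apply: continuous_at_radial; exact: tame_continuous.
  rewrite in_itv/= => /andP[as_ sb] ->; rewrite normrM (gtr0_norm (_ : 0 < b - a)) ?subr_gt0//.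
  by rewrite ler_wpM2r ?subr_ge0 ?(ltW ab)// dfle// ?(le_trans a2) ?(le_trans _ b2)// ltW.
have f1 : f z 1 = beta z by rewrite /f scale1r.
rewrite -f1 -/(f z rho) (_ : 4 * _ * _ * _ = 4 * Lam * trunc z * `|rho - 1|); last by ring.
have [h|h|->] := ltgtP rho 1.
- rewrite distrC [`|rho - 1|]ltr0_norm ?subr_lt0// opprB; apply: mvt => //; lra.
- rewrite [`|rho - 1|]gtr0_norm ?subr_gt0//; apply: mvt => //; lra.
- by rewrite !subrr !normr0 mulr0.
Qed.

(** The factor [eps] compensates |x| = |eps x| / eps, so that the constant [Lam] of [beta] serves
    for all dilated cutoffs. *)
Lemma eta_scale (eps : R) x : 0 < eps ->
  eta (fun y => beta (eps *: y)) x = eps * eta beta (eps *: x).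
Proof.
move=> e0; rewrite /eta mulr_sumr; apply: eq_bigr => i _.
by rewrite pderive_scale; [rewrite normrM gtr0_norm|exact: tame_smooth].
Qed.

End cutoff.

Lemma integrable_mul_le1 d (T : measurableType d) {R : realType}
    (mu : {measure set T -> \bar R}) (phi f : T -> R) :
  measurable_fun setT phi -> (forall x, `|phi x| <= 1) ->
  mu.-integrable setT (EFin \o f) -> mu.-integrable setT (EFin \o (fun x => phi x * f x)).
Proof.
move=> mphi phi1 fi; apply: (le_integrable _ _ _ fi) => //.
  apply/measurable_EFinP; apply: measurable_funM => //.
  by apply/measurable_EFinP; exact: measurable_int fi.
by move=> x _; rewrite lee_fin normrM ler_piMl.
Qed.

Section pohozaev.
Context {R : realType} {N : nat}.
Local Notation E := 'rV[R]_N.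
Local Notation leb := (@lebesgue_rV R N).
Variables (p q mu : R) (p2 : 2 < p) (pq : p < q) (qc : q < crit_exp R N).
Variables (u : E -> R) (g : E -> E) (ug : finite_energy p q u g).
Hypothesis crit : forall v, Dspace p q v ->
  is_derive (0 : R) (1 : R) (fun t : R => energy mu p q (fun x => u x + t * v x)) 0.

Local Notation pot := (potential p q mu).
Local Notation a := (fun x : E => 2^-1 * enorm (g x) ^+ 2).
Local Notation b := (fun x : E => pot (u x)).

Variables (beta : E -> R) (M : R) (tbeta : tame beta) (sbeta : supp_in M beta).
Variables (beta0 : forall x, 0 <= beta x) (beta1 : forall x, beta x <= 1).

Let wg : is_weak_gradient u g. Proof. by case: ug. Qed.
Let ia : leb.-integrable setT (EFin \o a).
Proof. exact: (integrableZl measurableT 2^-1 (integrable_enorm_sqr ug)). Qed.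
Let ib : leb.-integrable setT (EFin \o b).
Proof. exact: integrable_potential ug. Qed.
Let iab : leb.-integrable setT (EFin \o (fun x => a x + `|b x|)).
Proof. by have := integrableD measurableT ia (integrable_abse ib); exact: eq_integrable. Qed.
Let mbeta (eps : R) : measurable_fun setT (fun x : E => beta (eps *: x)).
Proof. by apply: measurable_fun_scale; apply: continuous_measurable_rV; exact: tame_continuous. Qed.
Let nbeta x : `|beta x| <= 1. Proof. by rewrite ger0_norm. Qed.
Let mtrunc (eps : R) : measurable_fun setT (fun x : E => trunc (eps *: x)).
Proof. by apply: measurable_fun_scale; exact: measurable_trunc. Qed.
Let ntrunc (x : E) : `|trunc x| <= 1. Proof. by rewrite ger0_norm ?trunc_ge0 ?trunc_le1. Qed.

Definition cut_int (f : E -> R) (eps : R) := \int[leb]_x (beta (eps *: x) * f x).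
(** A single quantity for all errors that are linear in r - 1; the absolute value is there because
    the potential may change sign. *)
Definition cut_err (eps : R) := \int[leb]_x (trunc (eps *: x) * (a x + `|b x|)).

Lemma half_enorm_sqr_ge0 x : 0 <= a x.
Proof. by rewrite mulr_ge0// sqr_ge0. Qed.

Lemma cut_err_ge eps : \int[leb]_x (trunc (eps *: x) * enorm (g x) ^+ 2) <= 2 * cut_err eps.
Proof.
rewrite -RintegralZl//; last exact: integrable_mul_le1.
apply: le_Rintegral => //.
- exact: integrable_mul_le1 (integrable_enorm_sqr ug).
- exact: (integrableZl measurableT 2 (integrable_mul_le1 (mtrunc eps) _ iab)).
- move=> x _; rewrite [leRHS]mulrCA ler_wpM2l ?trunc_ge0//.
  by rewrite mulrDr mulVKf// lerDl mulr_ge0.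
Qed.

Section eps.
Variables (Lam K : R) (Lam0 : 0 <= Lam) (K0 : 0 <= K).
Hypothesis HLam : forall z, eta beta z * `|z| <= Lam * trunc z.
Hypothesis HK : forall a b th, 0 <= th -> th <= 1 ->
  pot ((1 - th) * a + th * b) <= (1 - th) * pot a + th * pot b + K * th * (b - a) ^+ 2.
Variables (eps : R) (eps0 : 0 < eps).
Local Notation chi := (fun x : E => beta (eps *: x)).

Let tchi : tame chi. Proof. exact: tame_scale. Qed.
Let schi : supp_in (M / eps) chi. Proof. exact: supp_in_scale. Qed.
Let chi0 x : 0 <= chi x. Proof. exact: beta0. Qed.
Let chi1 x : chi x <= 1. Proof. exact: beta1. Qed.

(** [int_mul_le] with the weight trunc(eps x). The constant doubles because [cut_err] contains half
    of the squared gradient. *)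
Lemma cut_eta_term rho : `|rho - 1| <= 2^-1 ->
  \int[leb]_x (eta chi x * (`|dilw u rho x| * enorm (g x))) <=
  4 * N%:R * Lam * (1 + 2 * 2 ^+ N) * `|rho - 1| * cut_err eps.
Proof.
move=> r1; have mm := mtrunc eps.
have me : measurable_fun setT (eta chi) by apply: continuous_measurable_rV; exact: continuous_eta.
have h1 x : eta chi x * `|x| <= Lam * trunc (eps *: x).
  by rewrite (eta_scale tbeta)// mulrAC mulrC mulrA; apply: le_trans (HLam _); rewrite normrZ gtr0_norm// mulrA [_ * eps]mulrC.
have h2 (r : R) (x : E) : 0 < r -> r <= 2 -> trunc (eps *: (r *: x)) <= 2 * trunc (eps *: x).
  by move=> r0 r2; rewrite scalerA mulrC -scalerA; apply: trunc_scale => //; exact: ltW.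
have := int_mul_le wg r1 me mm (eta_ge0 chi) (fun x => trunc_ge0 _) Lam0 h1 h2.
have -> : (\int[leb]_x (eta chi x * (`|u (rho^-1 *: x) - u x| * enorm (g x)))%:E =
  \int[leb]_x (eta chi x * (`|dilw u rho x| * enorm (g x)))%:E)%E.
  by apply: eq_integral => x _; rewrite dilwE.
move=> /(Rintegral_le_scaled (integrable_eta_mul p2 pq qc ug tchi schi r1) (integrable_mul_le1 mm (fun x => ntrunc _) (integrable_enorm_sqr ug))).
move=> /le_trans; apply.
rewrite (_ : 4 * _ * _ * _ * _ * _ = 2 * N%:R * Lam * (1 + 2 * 2 ^+ N) * `|rho - 1| * (2 * cut_err eps)); last by ring.
by rewrite ler_wpM2l ?cut_err_ge// !mulr_ge0// addr_ge0// mulr_ge0// exprn_ge0.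
Qed.

(** [C] depends on [eps] through the bound on chi |x|^2. This is harmless, since [rho] tends to 1
    while [eps] is fixed. *)
Lemma cut_sqr_term : exists C : R, forall rho, `|rho - 1| <= 2^-1 ->
  \int[leb]_x (chi x * dilw u rho x ^+ 2) <= (rho - 1) ^+ 2 * C.
Proof.
have [B B0 HB] : exists2 B, 0 < B & forall x, `|chi x * `|x| ^+ 2| <= B.
  apply: (@supp_in_bounded R N (M / eps) (fun x => chi x * `|x| ^+ 2)); last exact: supp_inMr.
  move=> x; apply: (@continuousM _ _ chi (fun x : E => `|x| ^+ 2)); first exact: tame_continuous.
  apply: (@continuous_comp _ _ _ (fun x : E => `|x|) (fun r : R => r ^+ 2)); first exact: norm_continuous.
  exact: exprn_continuous.
exists (16 * N%:R ^+ 2 * B * 2 ^+ N * \int[leb]_x enorm (g x) ^+ 2) => rho r1.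
have := int_sqr_le wg r1 (mbeta eps) chi0 (ltW B0) (fun x => le_trans (ler_norm _) (HB x)).
have -> : (\int[leb]_x (chi x * (u (rho^-1 *: x) - u x) ^+ 2)%:E =
  \int[leb]_x (chi x * dilw u rho x ^+ 2)%:E)%E.
  by apply: eq_integral => x _; rewrite dilwE.
move=> /(Rintegral_le_scaled (integrable_chi_sqr p2 pq qc ug tchi schi chi0 r1) (integrable_enorm_sqr ug)).
by move=> /le_trans; apply; rewrite le_eqVlt; apply/orP; left; apply/eqP; ring.
Qed.

(** The substitution x = rho y moves the dilation from [u] to the cutoff, with Jacobian rho^N and
    rho^-2 on the gradient part. Replacing chi(rho y) by chi(y) costs the radial Lipschitz bound; 16
    is its 4 times the bound 4 for rho^-2. *)
Lemma cut_density_term rho : `|rho - 1| <= 2^-1 ->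
  \int[leb]_x (chi x * (energy_density p q mu (dil u rho) (dilg g rho) x - energy_density p q mu u g x)) <=
  (rho ^+ N * rho ^- 2 - 1) * cut_int a eps + (rho ^+ N - 1) * cut_int b eps +
  2 ^+ N * 16 * Lam * `|rho - 1| * cut_err eps.
Proof.
move=> r1; have [ra rb] : 2^-1 <= rho /\ rho <= 2.
  by move: r1; rewrite ler_norml => /andP[? ?]; split; lra.
have rho0 : 0 < rho by rewrite (lt_le_trans _ ra)// invr_gt0.
have rhoV0 : 0 < rho^-1 by rewrite invr_gt0.
have rV4 : rho ^- 2 <= 4.
  rewrite -[leRHS]invrK lef_pV2 ?posrE ?invr_gt0 ?exprn_gt0//.
  by rewrite (_ : 4^-1 = 2^-1 ^+ 2); [rewrite lerXn2r// nnegrE ?invr_ge0// ltW|field].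
have rV0 : 0 <= rho ^- 2 by rewrite invr_ge0 exprn_ge0// ltW.
pose F y := rho ^- 2 * a y + b y.
have iF : leb.-integrable setT (EFin \o F).
  by have := integrableD measurableT (integrableZl measurableT (rho ^- 2) ia) ib; exact: eq_integrable.
have mcr : measurable_fun setT (fun y : E => chi (rho *: y)).
  exact: (measurable_fun_scale (f := chi) rho).
have icF : leb.-integrable setT (EFin \o (fun y => chi (rho *: y) * F y)).
  by apply: integrable_mul_le1.
have edE x : energy_density p q mu (dil u rho) (dilg g rho) x = F (rho^-1 *: x).
  rewrite /energy_density /F /dil /dilg /= enorm_sqr; congr (_ + _).
  rewrite mulrCA; congr (_ * _); rewrite enorm_sqr mulr_sumr; apply: eq_bigr => i _.
  by rewrite mxE exprMn exprVn.
have ied1 : leb.-integrable setT (EFin \o (fun x => chi x * F (rho^-1 *: x))).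
  apply: integrable_mul_le1 => //.
  exact: (integrable_scale (f := EFin \o F) rhoV0 iF).
have iF1 : leb.-integrable setT (EFin \o (fun x => a x + b x)).
  by have := integrableD measurableT ia ib; exact: eq_integrable.
have ied2 : leb.-integrable setT (EFin \o (fun x => chi x * (a x + b x))).
  exact: integrable_mul_le1.
have -> : \int[leb]_x (chi x * (energy_density p q mu (dil u rho) (dilg g rho) x - energy_density p q mu u g x)) =
    \int[leb]_x (chi x * F (rho^-1 *: x)) - \int[leb]_x (chi x * (a x + b x)).
  by rewrite -RintegralB//; apply: eq_Rintegral => x _; rewrite edE mulrBr.
have -> : \int[leb]_x (chi x * F (rho^-1 *: x)) = rho ^+ N * \int[leb]_y (chi (rho *: y) * F y).
  have := Rintegral_scale rhoV0 icF; rewrite invrK => <-.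
  by apply: eq_Rintegral => x _; rewrite [rho *: _]scalerA mulfV ?gt_eqF// scale1r.
pose dchi y := chi (rho *: y) - chi y.
have mdchi : measurable_fun setT dchi by exact: measurable_funB.
have dchi_le y : `|dchi y| <= 4 * Lam * `|rho - 1| * trunc (eps *: y).
  rewrite /dchi (_ : eps *: (rho *: y) = rho *: (eps *: y)); last by rewrite !scalerA mulrC.
  exact: (beta_radial_lipschitz tbeta HLam Lam0).
have ica : leb.-integrable setT (EFin \o (fun y => chi y * a y)) by exact: integrable_mul_le1.
have icb : leb.-integrable setT (EFin \o (fun y => chi y * b y)) by exact: integrable_mul_le1.
have icF2 : leb.-integrable setT (EFin \o (fun y => chi y * F y)) by exact: integrable_mul_le1.
have idF : leb.-integrable setT (EFin \o (fun y => dchi y * F y)).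
  have := integrableB measurableT icF icF2; apply: eq_integrable => // y _.
  by rewrite /= -EFinB /dchi mulrBl.
have -> : \int[leb]_y (chi (rho *: y) * F y) =
    rho ^- 2 * cut_int a eps + cut_int b eps + \int[leb]_y (dchi y * F y).
  have -> : rho ^- 2 * cut_int a eps + cut_int b eps = \int[leb]_y (chi y * F y).
    rewrite /cut_int -RintegralZl// -RintegralD//; last exact: (integrableZl measurableT (rho ^- 2) ica).
    by apply: eq_Rintegral => y _; rewrite /F; ring.
  rewrite -RintegralD//; apply: eq_Rintegral => y _; rewrite /dchi; ring.
have -> : \int[leb]_x (chi x * (a x + b x)) = cut_int a eps + cut_int b eps.
  by rewrite /cut_int -RintegralD//; apply: eq_Rintegral => y _; ring.
have ierr : leb.-integrable setT (EFin \o (fun x => trunc (eps *: x) * (a x + `|b x|))).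
  exact: integrable_mul_le1.
have hd : \int[leb]_y (dchi y * F y) <= 16 * Lam * `|rho - 1| * cut_err eps.
  rewrite /cut_err -RintegralZl//; apply: le_Rintegral => //.
    exact: (integrableZl measurableT (16 * Lam * `|rho - 1|) ierr).
  move=> y _; apply: le_trans (ler_norm _) _; rewrite normrM.
  rewrite (_ : 16 * Lam * _ * _ = (4 * Lam * `|rho - 1| * trunc (eps *: y)) * (4 * (a y + `|b y|))); last by ring.
  apply: ler_pM => //; apply: le_trans (ler_normD _ _) _; rewrite mulrDr; apply: lerD.
    by rewrite ger0_norm; [rewrite ler_wpM2r ?half_enorm_sqr_ge0|rewrite mulr_ge0 ?half_enorm_sqr_ge0].
  by rewrite ler_peMl// ler1n.
have err0 : 0 <= 16 * Lam * `|rho - 1| * cut_err eps.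
  rewrite !mulr_ge0//; apply: Rintegral_ge0 => x _.
  by rewrite mulr_ge0 ?trunc_ge0// addr_ge0 ?half_enorm_sqr_ge0.
have hN : rho ^+ N <= 2 ^+ N by rewrite lerXn2r// nnegrE ltW.
have hN0 : 0 <= rho ^+ N by rewrite exprn_ge0// ltW.
have := ler_wpM2l hN0 hd; have := ler_wpM2r err0 hN.
move: (\int[leb]_y (dchi y * F y)) (cut_int _ _) (cut_int _ _) (cut_err _) => X A B D.
set r := rho ^+ N; set r2 := rho ^- 2; set T := 2 ^+ N => h1 h2.
rewrite -subr_ge0.
rewrite (_ : _ - _ = (T * (16 * Lam * `|rho - 1| * D) - r * (16 * Lam * `|rho - 1| * D)) + (r * (16 * Lam * `|rho - 1| * D) - r * X)); last by ring.
by rewrite addr_ge0// subr_ge0.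
Qed.

End eps.
End pohozaev.

(** The Pohozaev coefficients arise here: under dilation the gradient integral has degree N - 2, the
    potential integral degree N. *)
Lemma is_derive_scale_factor {R : realType} (n : nat) (A B : R) :
  is_derive (1 : R) (1 : R)
    (fun r : R => (r ^+ n * r ^- 2 - 1) * A + (r ^+ n - 1) * B)
    ((n%:R - 2) * A + n%:R * B).
Proof.
have dX k : is_derive (1 : R) (1 : R) (fun r : R => r ^+ k) k%:R.
  have := @is_deriveX _ _ id k (1 : R) 1 1 (is_derive_id _ _).
  rewrite (_ : id ^+ k = fun r : R => r ^+ k); last by apply/funext => z; rewrite fctE.
  by move=> /is_derive_eq; apply; rewrite expr1n mulr1; exact: mulr1.
have dV : is_derive (1 : R) (1 : R) (fun r : R => r ^- 2) (- 2).
  have n0 : (1 : R) ^+ 2 != 0 by rewrite expr1n oner_neq0.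
  have h := @is_deriveV R (fun r : R => r ^+ 2) 1 2 1 n0 (dX 2%N).
  by apply: (is_derive_eq h); rewrite !expr1n invr1 scaleN1r.
apply: (is_derive_eq (is_deriveD
  (is_deriveM (is_deriveB (is_deriveM (dX n) dV) (is_derive_cst (1 : R) _ _)) (is_derive_cst A _ _))
  (is_deriveM (is_deriveB (dX n) (is_derive_cst (1 : R) _ _)) (is_derive_cst B _ _)))).
rewrite /GRing.scale/= !fctE !expr1n invr1; ring.
Qed.

Section pohozaev_identity.
Context {R : realType} {N : nat}.
Local Notation E := 'rV[R]_N.
Local Notation leb := (@lebesgue_rV R N).
Variables (p q mu : R) (p2 : 2 < p) (pq : p < q) (qc : q < crit_exp R N).
Variables (u : E -> R) (g : E -> E) (ug : finite_energy p q u g).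
Hypothesis crit : forall v, Dspace p q v ->
  is_derive (0 : R) (1 : R) (fun t : R => energy mu p q (fun x => u x + t * v x)) 0.

Local Notation pot := (potential p q mu).
Local Notation a := (fun x : E => 2^-1 * enorm (g x) ^+ 2).
Local Notation b := (fun x : E => pot (u x)).

Section cut.
Variables (beta : E -> R) (M : R) (tbeta : tame beta) (sbeta : supp_in M beta).
Variables (beta0 : forall x, 0 <= beta x) (beta1 : forall x, beta x <= 1).
Local Notation A := (cut_int beta a).
Local Notation B := (cut_int beta b).
Local Notation err := (cut_err p q mu u g).

(** [C] is fixed before [eps], whereas the quadratic constant [Ce] is chosen after it and disappears
    with [rho] tending to 1. *)
Lemma pohozaev_cutoff : exists C : R, forall eps, 0 < eps ->
  `|(N%:R - 2) * A eps + N%:R * B eps| <= C * err eps.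
Proof.
have [K K0 HK] := potential_semiconvex p2 pq mu.
have [Lam Lam0 HLam] := eta_beta_le tbeta sbeta.
pose C := 2 ^+ N * 16 * Lam + 4 * N%:R * Lam * (1 + 2 * 2 ^+ N).
exists C => eps eps0.
pose chi (x : E) := beta (eps *: x).
have tchi : tame chi by exact: tame_scale.
have schi : supp_in (M / eps) chi by exact: supp_in_scale.
have chi0 x : 0 <= chi x by exact: beta0.
have chi1 x : chi x <= 1 by exact: beta1.
have [Ce HCe] := cut_sqr_term p2 pq qc ug tbeta sbeta beta0 eps0.
pose F (r : R) := (r ^+ N * r ^- 2 - 1) * A eps + (r ^+ N - 1) * B eps.
have main rho : `|rho - 1| <= 2^-1 ->
    - F rho <= `|rho - 1| * (C * err eps) + (rho - 1) ^+ 2 * (K * Ce).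
  move=> r1.
  have := inner_variation_ge0 p2 pq qc ug tchi schi chi0 chi1 r1 HK crit.
  have i1 := integrable_chiM tchi chi0 chi1 (integrable_density_diff mu p2 pq qc ug r1).
  have i2 := integrable_eta_mul p2 pq qc ug tchi schi r1.
  have i3 := integrable_chi_sqr p2 pq qc ug tchi schi chi0 r1.
  rewrite /variation_bound RintegralD//; last 2 first.
  - exact: (integrableD measurableT i1 i2).
  - exact: (integrableZl measurableT K i3).
  rewrite RintegralD// RintegralZl// => h.
  have e1 := cut_density_term mu p2 pq ug tbeta beta0 beta1 Lam0 HLam eps r1.
  have e2 := cut_eta_term mu p2 pq qc ug tbeta sbeta Lam0 HLam eps0 r1.
  have e3 := ler_wpM2l K0 (HCe rho r1).
  rewrite /chi in h; rewrite /F /C.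
  have e := le_trans h (lerD (lerD e1 e2) e3); rewrite -subr_ge0.
  apply: le_trans e _; rewrite le_eqVlt; apply/orP; left; apply/eqP; ring.
have D := is_derive_scale_factor N (A eps) (B eps).
set d0 := (N%:R - 2) * A eps + N%:R * B eps.
(* The one-sided argument is run with rho = 1 + s t for s = 1 and s = -1; the two signs together
   bound the absolute value. *)
have side (s : R) : `|s| = 1 -> - (s * d0) <= C * err eps.
  move=> s1.
  have Ds : is_derive (0 : R) (1 : R) (fun t : R => - F (s * t + 1)) (- (d0 * s)).
    apply: is_deriveN; apply: (@is_derive1_comp _ F (fun t => s * t + 1)); last exact: is_derive_affine.
    by rewrite mulr0 add0r.
  rewrite [s * _]mulrC; apply: (derive_le_of_upper_bound (b := K * Ce) Ds) => t t0 t1.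
  have := main (s * t + 1); rewrite addrK normrM s1 mul1r gtr0_norm// => /(_ t1).
  rewrite exprMn -[s ^+ 2]real_normK ?num_real// s1 expr1n mul1r.
  have -> : F (s * 0 + 1) = 0 by rewrite /F mulr0 add0r !expr1n invr1; ring.
  by rewrite oppr0 add0r.
rewrite ler_norml; apply/andP; split.
  by have := side 1 (normr1 _); rewrite mul1r lerNl.
by have := side (-1); rewrite normrN normr1 mulN1r opprK; exact.
Qed.

End cut.

Lemma pohozaev : (N%:R - 2) * \int[leb]_x a x + N%:R * \int[leb]_x b x = 0.
Proof.
pose beta : E -> R := bump (fun _ => -1) (fun _ => 1) 0.
have tbeta : tame beta by exact: tame_bump.
have sbeta := @supp_bump R N (fun _ => -1) (fun _ => 1) 0%N.
have beta0 x : 0 <= beta x by exact: bump_ge0.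
have beta1 x : beta x <= 1 by exact: bump_le1.
(* The limit carries the factor [beta 0], a positive power of 1/e rather than 1, which is divided
   out at the end. *)
have kpos : 0 < beta 0.
  rewrite /beta /bump; apply: prodr_gt0 => i _; rewrite mxE !mulr0.
  by apply: mulr_gt0; rewrite /flat ifT ?mulr_gt0 ?expR_gt0 ?exprn_gt0 ?invr_gt0//; lra.
have [C HC] := pohozaev_cutoff tbeta sbeta beta0 beta1.
pose e (n : nat) : R := n.+1%:R^-1.
have e0 n : 0 < e n by rewrite invr_gt0 ltr0n.
have ce : e @ \oo --> (0 : R) by exact: (@cvg_harmonic R).
have cs (f : E -> R) : continuous f -> forall x, f (e n *: x) @[n --> \oo] --> f 0.
  move=> cf x; rewrite -[X in _ --> f X](scale0r x).
  apply: (@continuous_cvg _ _ _ _ _ (fun n => e n *: x) f); first exact: cf.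
  by apply: cvgZr_tmp.
have ia : leb.-integrable setT (EFin \o a).
  exact: (integrableZl measurableT 2^-1 (integrable_enorm_sqr ug)).
have ib : leb.-integrable setT (EFin \o b) by exact: integrable_potential ug.
have iab : leb.-integrable setT (EFin \o (fun x => a x + `|b x|)).
  by have := integrableD measurableT ia (integrable_abse ib); exact: eq_integrable.
have mb n : measurable_fun setT (fun x : E => beta (e n *: x)).
  by apply: measurable_fun_scale; apply: continuous_measurable_rV; exact: tame_continuous.
have nb n (x : E) : `|beta (e n *: x)| <= 1 by rewrite ger0_norm.
have cA := cvg_Rintegral_scaled mb nb (cs _ (tame_continuous tbeta)) ia.
have cB := cvg_Rintegral_scaled mb nb (cs _ (tame_continuous tbeta)) ib.
have ctr : continuous (@trunc R N).
  move=> x; apply: (@continuous_min _ _ (fun=> 1) (fun x : E => `|x|)); first exact: cst_continuous.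
  exact: norm_continuous.
have t0 : @trunc R N 0 = 0 by rewrite /trunc normr0 min_r.
have mt n : measurable_fun setT (fun x : E => trunc (e n *: x)).
  by apply: measurable_fun_scale; exact: measurable_trunc.
have nt n (x : E) : `|trunc (e n *: x)| <= 1 by rewrite ger0_norm ?trunc_ge0 ?trunc_le1.
have cE := cvg_Rintegral_scaled mt nt (cs _ ctr) iab.
rewrite t0 mul0r in cE.
have c1 : (fun n => `|(N%:R - 2) * cut_int beta a (e n) + N%:R * cut_int beta b (e n)|) @ \oo -->
   `|(N%:R - 2) * (beta 0 * \int[leb]_x a x) + N%:R * (beta 0 * \int[leb]_x b x)|.
  by apply: cvg_norm; apply: cvgD; apply: cvgMl_tmp.
have c2 : (fun n => C * cut_err p q mu u g (e n)) @ \oo --> (0 : R).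
  by rewrite -[X in _ --> X](mulr0 C); apply: cvgMl_tmp.
have : `|(N%:R - 2) * (beta 0 * \int[leb]_x a x) + N%:R * (beta 0 * \int[leb]_x b x)| <= 0.
  by apply: (ler_cvg_to c1 c2); apply: nearW => n; exact: HC.
rewrite normr_le0 (_ : _ + _ = beta 0 * ((N%:R - 2) * \int[leb]_x a x + N%:R * \int[leb]_x b x)); last by ring.
by rewrite mulf_eq0 (gt_eqF kpos)/= => /eqP.
Qed.

End pohozaev_identity.

(** * Homotheties and the Nehari identity *)

Section nehari.
Context {R : realType} {N : nat}.
Local Notation E := 'rV[R]_N.
Local Notation leb := (@lebesgue_rV R N).
Variables (p q mu : R) (p2 : 2 < p) (pq : p < q) (qc : q < crit_exp R N).
Variables (u : E -> R) (g : E -> E) (ug : finite_energy p q u g).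
Local Notation G2 := (\int[leb]_x enorm (g x) ^+ 2).
Local Notation Cq := (\int[leb]_x `|u x| `^ q).
Local Notation Cp := (\int[leb]_x `|u x| `^ p).

Let p0 : 0 < p. Proof. exact: lt_trans p2. Qed.
Let q0 : 0 < q. Proof. exact: lt_trans p0 pq. Qed.

Let iq : leb.-integrable setT (EFin \o (fun x => `|u x| `^ q)).
Proof. by case: ug => _ _ _ uq _; apply: (Lfun_integrable _ uq); have := p2; have := pq; lra. Qed.
Let ip : leb.-integrable setT (EFin \o (fun x => `|u x| `^ p)).
Proof. by case: ug => _ _ _ _ up; apply: (Lfun_integrable _ up); have := p2; lra. Qed.
Let i2 := integrable_enorm_sqr ug.

Lemma integral_potential : \int[leb]_x potential p q mu (u x) = q^-1 * Cq - mu / p * Cp.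
Proof.
rewrite -!RintegralZl// -RintegralB//.
- exact: (integrableZl measurableT q^-1 iq).
- exact: (integrableZl measurableT (mu / p) ip).
Qed.

Lemma energy_homothety s : 0 < s ->
  \int[leb]_x (2^-1 * enorm (s *: g x) ^+ 2 + potential p q mu (s * u x)) =
  2^-1 * s ^+ 2 * G2 + q^-1 * s `^ q * Cq - mu / p * s `^ p * Cp.
Proof.
move=> s0; rewrite -!RintegralZl// -RintegralD//; last 2 first.
- exact: (integrableZl measurableT (2^-1 * s ^+ 2) i2).
- exact: (integrableZl measurableT (q^-1 * s `^ q) iq).
rewrite -RintegralB//; last 2 first.
- exact: (integrableD measurableT (integrableZl measurableT (2^-1 * s ^+ 2) i2) (integrableZl measurableT (q^-1 * s `^ q) iq)).
- exact: (integrableZl measurableT (mu / p * s `^ p) ip).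
apply: eq_Rintegral => x _; rewrite /potential normrM gtr0_norm// !powRM ?(ltW s0)//.
rewrite (_ : enorm (s *: g x) ^+ 2 = s ^+ 2 * enorm (g x) ^+ 2); first by ring.
by rewrite !enorm_sqr mulr_sumr; apply: eq_bigr => i _; rewrite mxE exprMn.
Qed.

(** Along the ray (1 + t) u the energy is an explicit combination of powers of 1 + t, so no
    differentiation under the integral is involved; uniqueness of the derivative gives the
    identity. *)
Lemma nehari : (forall v, Dspace p q v ->
    is_derive (0 : R) (1 : R) (fun t : R => energy mu p q (fun x => u x + t * v x)) 0) ->
  G2 + Cq - mu * Cp = 0.
Proof.
move=> /(_ _ (finite_energy_Dspace ug)) D.
pose F (s : R) := 2^-1 * s ^+ 2 * G2 + q^-1 * s `^ q * Cq - mu / p * s `^ p * Cp.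
have DF : is_derive (0 : R) (1 : R) (fun t : R => F (1 * t + 1)) ((G2 + Cq - mu * Cp) * 1).
  apply: (@is_derive1_comp R F (fun t : R => 1 * t + 1) 0 (G2 + Cq - mu * Cp) 1 _ (is_derive_affine 1 1 0)).
  have -> : 1 * 0 + 1 = 1 :> R by rewrite mulr0 add0r.
  have d2 : is_derive (1 : R) (1 : R) (fun r : R => r ^+ 2) 2.
    have := @is_deriveX _ _ id 2 (1 : R) 1 1 (is_derive_id _ _).
    rewrite (_ : id ^+ 2 = fun r : R => r ^+ 2); last by apply/funext => z; rewrite fctE.
    by move=> /is_derive_eq; apply; rewrite expr1 mulr1; exact: mulr1.
  have dq := is_derive1_powR q (@ltr01 R).
  have dp := is_derive1_powR p (@ltr01 R).
  rewrite (_ : F = (fun s : R => (2^-1 * G2) * s ^+ 2 + (q^-1 * Cq) * s `^ q - (mu / p * Cp) * s `^ p)); last first.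
    by apply/funext => s; rewrite /F; ring.
  apply: (is_derive_eq (is_deriveB (is_deriveD (is_deriveZ (2^-1 * G2) d2) (is_deriveZ (q^-1 * Cq) dq)) (is_deriveZ (mu / p * Cp) dp))).
  rewrite /GRing.scale/= !powR1; field.
  by rewrite !gt_eqF.
(* The formula for the energy holds for 1 + t > 0, hence near t = 0. *)
have DE : is_derive (0 : R) (1 : R) (fun t : R => energy mu p q (fun x => u x + t * u x))
   ((G2 + Cq - mu * Cp) * 1).
  apply: near_eq_is_derive DF; near=> t.
  have t1 : 0 < t + 1.
    have : -1 < t by near: t; apply: lt_nbhsr; rewrite ltrN10.
    by lra.
  apply: etrans (esym (energyE mu (finite_energyD p2 pq qc t ug ug))).
  rewrite mul1r; apply: etrans (esym (energy_homothety t1)) _.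
  apply: eq_Rintegral => x _; rewrite /energy_density scalerDl scale1r addrC.
  by rewrite [t *: _ + _]addrC mulrDl mul1r [t * _ + _]addrC addrC.
have [_ e1] := D; have [_ e2] := DE.
by move: e2; rewrite e1 mulr1.
Unshelve. all: by end_near.
Qed.

End nehari.

Theorem corollary5p1 (R : realType) (N : nat) (mu p q : R) :
  (3 <= N)%N -> 2 < p -> p < q -> q < crit_exp R N ->
  ~ exists (u : 'rV[R]_N -> R) (e : R),
      [/\ weak_solution mu p q u,
          ~ {ae lebesgue_rV N, forall x, u x = 0},
          0 <= e &
          energy mu p q u = e].
Proof.
move=> N3 p2 pq qc [u [e [[Du crit] nu _ _]]]; apply: nu.
have ug := Dspace_finite_energy Du.
have h1 := nehari p2 pq qc ug crit.
have h2 := pohozaev p2 pq qc ug crit.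
have i2 := integrable_enorm_sqr ug.
rewrite (integral_potential mu p2 pq ug) RintegralZl// in h2.
have iq : (lebesgue_rV N).-integrable setT (EFin \o (fun x => `|u x| `^ q)).
  by case: ug => _ _ _ uq _; apply: (Lfun_integrable _ uq); lra.
set G2 := Rintegral _ _ _ in h1 h2.
move: h1 h2; set Cq := (\int[_]_x `|u x| `^ q); set Cp := (\int[_]_x `|u x| `^ p) => h1 h2.
have G20 : 0 <= G2 by apply: Rintegral_ge0 => x _; exact: sqr_ge0.
have Cq0 : 0 <= Cq by apply: Rintegral_ge0 => x _; exact: powR_ge0.
have Cq_eq0 : Cq = 0.
  have n3 : 3 <= N%:R :> R by rewrite ler_nat.
  have p0 : 0 < p by lra.
  have q0 : 0 < q by lra.
  have n2 : 0 < N%:R - 2 :> R by lra.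
  have pc : p * (N%:R - 2) < 2 * N%:R.
    by rewrite -ltr_pdivlMr//; exact: lt_trans qc.
  have mE : mu * Cp = G2 + Cq by lra.
  (* The Pohozaev identity multiplied by 2 p q, with the term in [mu] eliminated by Nehari. The
     bracket on the right is positive exactly because p is below the critical exponent. *)
  have key : Cq * (2 * N%:R * (q - p)) = - (G2 * (q * (2 * N%:R - p * (N%:R - 2)))).
    have : 2 * p * q * ((N%:R - 2) * (2^-1 * G2) + N%:R * (q^-1 * Cq - mu / p * Cp)) = 0.
      by rewrite h2 mulr0.
    rewrite (_ : 2 * p * q * _ = p * q * (N%:R - 2) * G2 + 2 * N%:R * (p * Cq - q * (mu * Cp))); last first.
      by field; rewrite !gt_eqF.
    by rewrite mE => h; apply/eqP; rewrite -subr_eq0; apply/eqP; rewrite -[RHS]oppr0 -h; ring.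
  have k1 : 0 < 2 * N%:R * (q - p) by rewrite !mulr_gt0 ?subr_gt0//; lra.
  have k2 : 0 <= G2 * (q * (2 * N%:R - p * (N%:R - 2))).
    by rewrite mulr_ge0// mulr_ge0 ?subr_ge0// ltW.
  apply/eqP; rewrite eq_le Cq0 andbT -(pmulr_lle0 _ k1) key oppr_le0//.
have : (\int[lebesgue_rV N]_x `|(`|u x| `^ q)%:E| = 0)%E.
  rewrite (eq_integral (fun x => (`|u x| `^ q)%:E)); last first.
    by move=> x _; rewrite gee0_abs// lee_fin powR_ge0.
  by rewrite -(fineK (integrable_fin_num measurableT iq)); congr EFin.
move=> /(ae_eq_integral_abs _ measurableT (measurable_int _ iq)).
apply: filterS => x /(_ I) [] /powR_eq0_eq0 /eqP.
by rewrite normr_eq0 => /eqP.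
Qed.
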